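(* Let $C$, $g$, $\varepsilon$, $\Omega$, $\tilde g$, $d\mu$ satisfy Conditions A, B and C of the context, and put $$F(x,z,y,t)=\iint_\Omega \exp\bigl[ip(x-z)-q(x+z)+2qf(p,q,y)t\bigr]\,d\mu(p,q).$$ Then the scheme consisting of the Marchenko integral equation $$K(x,z,y,t)+F(x,z,y,t)+\int_x^\infty K(x,\xi,y,t)F(\xi,z,y,t)\,d\xi=0,\qquad z\ge x$$ (an equation in $z$, for a function $K(x,\cdot,y,t)\in L^2[x,\infty)$, with $x,y\in\mathbb{R}$, $t>0$ as parameters), and the formula $$v(x,y,t)=2\,\frac{\partial}{\partial x}K(x,x,y,t)$$ determines a smooth real solution $v$ of the Johnson equation JE-I $$\Bigl(v_t+\tfrac14 v_{xxx}+\tfrac32 v v_x+\tfrac{v}{2t}\Bigr)_x=\frac{12}{t^2}\,v_{yy},\qquad t>0,$$ which vanishes as $x\to+\infty$ (for fixed $y,t$) and is bounded for all fixed $x,y,t$ $(t>0)$.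
   Context: $\mathbb{R}^+=(0,\infty)$. ''Determines'' means that the Marchenko equation has a unique solution in $L^2[x,\infty)$ for all parameter values and that $v$ is well defined by the formula. ''Bounded for all fixed $x,y,t$'' means finite at every point with $t>0$. Let $f(p,q,y)=q^2-3p^2+\frac{py}{2}-\frac{y^2}{48}$. Condition A. $C:\mathbb{R}\to\mathbb{R}^+$ is of class $C^2$ and there are constants $\delta,\varepsilon>0$ with $C(s)\ge\delta>\varepsilon^2$ and $C''(s)>-1/24$ for all $s$. Condition B. $\Omega=\{(p,q)\in\mathbb{R}^2 : -\infty<p<\infty,\ 0<\varepsilon\le q\le h(p)\}$, where $q=h(p)$, $p\in\mathbb{R}$, is the envelope of the family of hyperbolas $f(p,q,s)=C(s)$ ($s$ the parameter, $q>0$). It touches the hyperbola with parameter $y$ at the point $(p_0(y),q_0(y))=\bigl(2C'(y)+\frac{y}{12},\ \sqrt{C(y)+12(C'(y))^2}\bigr)$; thus $h(p_0(y))=q_0(y)$ for all $y$. (It is part of the condition that the envelope is a graph over the whole $p$-axis.) Under this structure $C(s)=\max_{(p,q)\in\Omega}f(p,q,s)$. Condition C. $g:\mathbb{R}\to\mathbb{R}^+$ is of class $C^\infty$, $g(s)<A$ for a constant $A$, and $d\mu(p,q)=\tilde g(p,q)\,dp\,dq$ with a real positive $\tilde g\in C^\infty$, $\tilde g(p_0(y),q_0(y))=g(y)$ for all $y$, such that $\iint_\Omega e^{a(q+|p|)}d\mu(p,q)<\infty$ for every constant $a>0$. *)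

(* Defs.v *)
(* MathComp world: MathComp-Analysis, and R[i] from mathcomp real-closed. *)
From mathcomp Require Import all_boot all_order all_algebra.
From mathcomp Require Import complex.
From mathcomp Require Import ring.
From mathcomp Require Import all_classical all_reals all_analysis.

Set Implicit Arguments.
Unset Strict Implicit.
Unset Printing Implicit Defensive.

Import Order.TTheory GRing.Theory Num.Theory.
Import numFieldNormedType.Exports.

Local Open Scope classical_set_scope.
Local Open Scope complex_scope.
Local Open Scope ring_scope.

(* C^oo on an open set of a finite-dimensional space: every iterated
   directional derivative of f is (Frechet) differentiable at every point. *)
Definition smooth_on (R : realType) (V : normedModType R) (U : set V)
    (f : V -> R) : Prop :=
  forall (ws : seq V) (x : V), U x ->
    differentiable (foldr (fun w h => fun z => 'D_w h z) f ws) x.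

Definition class_C2 (R : realType) (f : R -> R) : Prop :=
  [/\ forall s, derivable f s 1,
      forall s, derivable (derive1 f) s 1
    & continuous (derive1n 2 f)].

Section Complex.
Context (R : realType).

Definition expc (z : R[i]) : R[i] :=
  (expR (complex.Re z))%:C *
    (cos (complex.Im z) +i* sin (complex.Im z)).

Definition cintegral d (T : measurableType d) (mu : {measure set T -> \bar R})
    (D : set T) (f : T -> R[i]) : R[i] :=
  Rintegral mu D (fun w => complex.Re (f w)) +i*
  Rintegral mu D (fun w => complex.Im (f w)).

Definition cderivable (f : R -> R[i]) (x : R) : Prop :=
  derivable (fun w => complex.Re (f w)) x 1 /\
  derivable (fun w => complex.Im (f w)) x 1.

Definition cderive (f : R -> R[i]) (x : R) : R[i] :=
  derive1 (fun w => complex.Re (f w)) x +i* derive1 (fun w => complex.Im (f w)) x.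

(* k restricted to [x, +oo[ is a (representative of an) element of the complex
   space L^2[x, +oo[; the values of k to the left of x are irrelevant. *)
Definition in_L2_from (x : R) (k : R -> R[i]) : Prop :=
  [/\ measurable_fun `[x, +oo[ (fun z => complex.Re (k z)),
      measurable_fun `[x, +oo[ (fun z => complex.Im (k z))
    & (\int[lebesgue_measure]_(z in `[x, +oo[)
         (complex.Re (k z) ^+ 2 + complex.Im (k z) ^+ 2)%:E < +oo)%E].

End Complex.

Section Data.
Context (R : realType).

Definition phase (p q y : R) : R :=
  q ^+ 2 - 3 * p ^+ 2 + p * y / 2 - y ^+ 2 / 48.

Definition plane_measure :
    {measure set (measurableTypeR R * measurableTypeR R) -> \bar R} :=
  (@lebesgue_measure R \x @lebesgue_measure R)%E.

Definition Omega (eps : R) (h : R -> R) : set (R * R) :=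
  [set pq | eps <= pq.2 <= h pq.1].

Definition p0 (C : R -> R) (y : R) : R := 2 * derive1 C y + y / 12.

Definition q0 (C : R -> R) (y : R) : R :=
  Num.sqrt (C y + 12 * (derive1 C y) ^+ 2).

(* The curve q = h(p), p in R, is the whole envelope in {q > 0} of the
   one-parameter family phase(p, q, s) = C(s): a point lies on the envelope iff,
   for some s, both the equation and its s-derivative hold there.  In
   particular every p is the abscissa of exactly one envelope point. *)
Definition is_envelope (C h : R -> R) : Prop :=
  forall p q : R,
    (0 < q /\ exists s : R,
       phase p q s = C s /\ derive1 (phase p q) s = derive1 C s)
    <-> q = h p.

Lemma derive_phase (p q s : R) : derive1 (phase p q) s = p / 2 - s / 24.
Proof.
have Hd : is_derive s 1 (phase p q) (p / 2 - s / 24).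
  rewrite /phase; apply: is_derive_eq.
  by rewrite /GRing.scale /=; field.
by rewrite derive1E derive_val.
Qed.

Lemma envelope_contact (C h : R -> R) :
  (forall s, 0 < C s) -> is_envelope C h -> forall y, h (p0 C y) = q0 C y.
Proof.
move=> C0 E y; symmetry; apply/E.
have D0 : 0 < C y + 12 * (derive1 C y) ^+ 2.
  by rewrite ltr_wpDr ?C0// mulr_ge0// sqr_ge0.
split; first by rewrite sqrtr_gt0.
exists y; rewrite derive_phase /phase /p0 /q0 sqr_sqrtr ?ltW//; split; by field.
Qed.

Definition conditionA (C : R -> R) (delta eps : R) : Prop :=
  [/\ forall s, 0 < C s,
      class_C2 C,
      [/\ 0 < delta, 0 < eps & eps ^+ 2 < delta],
      forall s, delta <= C s
    & forall s, - 24^-1 < derive1n 2 C s].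

(* The contact point of the envelope with the hyperbola of parameter y is
   (p0 C y, q0 C y); this follows from is_envelope (see envelope_contact). *)
Definition conditionB (C h : R -> R) : Prop := is_envelope C h.

(* gt is the density of mu on Omega; being of class C^oo on the closed set
   Omega means being the restriction of a function that is C^oo on an open
   neighbourhood of Omega. *)
Definition conditionC (C h : R -> R) (eps : R) (g : R -> R) (A : R)
    (gt : R * R -> R) : Prop :=
  [/\ [/\ forall s, 0 < g s, smooth_on setT g & forall s, g s < A],
      forall w, Omega eps h w -> 0 < gt w,
      exists U : set (R * R), [/\ open U, Omega eps h `<=` U & smooth_on U gt],
      forall y, gt (p0 C y, q0 C y) = g y
    & forall a : R, 0 < a ->
        (\int[plane_measure]_(w in Omega eps h)
           (expR (a * (w.2 + `|w.1|)) * gt w)%:E < +oo)%E].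

Definition marchenko_kernel (eps : R) (h : R -> R) (gt : R * R -> R)
    (x z y t : R) : R[i] :=
  cintegral plane_measure (Omega eps h) (fun w =>
    let: (p, q) := w in
    expc ('i%C * (p * (x - z))%:C - (q * (x + z))%:C
            + (2 * q * phase p q y * t)%:C) * (gt w)%:C).

(* The left-hand side at z of the Marchenko equation with parameters x, y, t,
   for the unknown function k of the second variable. *)
Definition marchenko_lhs (F : R -> R -> R -> R -> R[i]) (x y t : R)
    (k : R -> R[i]) (z : R) : R[i] :=
  k z + F x z y t +
  cintegral lebesgue_measure `[x, +oo[ (fun xi => k xi * F xi z y t).

(* For all x, y and t > 0 the equation has one and only one solution in
   L^2[x, +oo[, where elements of L^2 are taken up to equality almost
   everywhere.  K x _ y t is the representative that satisfies the equation at
   every z >= x, which gives K x x y t a meaning; v is then twice the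
   derivative of this diagonal, so that this derivative is real. *)
Definition marchenko_determines (F : R -> R -> R -> R -> R[i])
    (v : R -> R -> R -> R) : Prop :=
  exists K : R -> R -> R -> R -> R[i],
    forall x y t : R, 0 < t ->
    [/\ in_L2_from x (fun z => K x z y t),
        forall z, x <= z -> marchenko_lhs F x y t (fun z => K x z y t) z = 0,
        forall k : R -> R[i], in_L2_from x k ->
          {ae lebesgue_measure, forall z, x <= z ->
            marchenko_lhs F x y t k z = 0} ->
          {ae lebesgue_measure, forall z, x <= z -> k z = K x z y t},
        cderivable (fun w => K w w y t) x
      & (v x y t)%:C = 2 * cderive (fun w => K w w y t) x].

Definition johnson_equation (v : R -> R -> R -> R) (x y t : R) : Prop :=
  derive1 (fun x' => derive1 (fun t' => v x' y t') t
                     + 4^-1 * derive1n 3 (fun x'' => v x'' y t) x'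
                     + 3 / 2 * v x' y t * derive1 (fun x'' => v x'' y t) x'
                     + v x' y t / (2 * t)) x
  = 12 / t ^+ 2 * derive1n 2 (fun y' => v x y' t) y.

End Data.

(* Main.v *)
(** With alpha = - q + i p, absorb g~ and the exponential factors e^theta,
    theta = - 2 q x + 2 q f t, into a weight w on Omega.  Then F(xi, z) is the
    integral of e^(alpha (xi - x)) conj (e^(alpha (z - x))) w, that is, the
    Marchenko operator is L* L for a Laplace-type transform L from L^2[x, oo) to
    L^2(Omega, w).  Hence the equation is equivalent to (1 + T) phi = 1 where
    T = L L* has the kernel - 1 / (alpha(a) + conj alpha(c)).  Positivity of T
    gives uniqueness, and a Richardson iteration gives existence.

    Let phi_j solve (1 + T) phi_j = alpha^j, and let u_ij = <phi_i, alpha^j>, so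
    that K(x, x) = - u_00.  The kernel of T satisfies alpha T + T conj alpha =
    - (rank one), so the pairing of phi_i with (alpha^n - (- conj alpha)^n) phi_j
    is a quadratic polynomial in the u_ij.  The derivatives of theta in x, y, t
    are combinations of alpha^n - (- conj alpha)^n for n = 1, 2, 3, so every
    derivative of u_ij is a polynomial in y, t and the u_kl.  Therefore
    v = - 2 d/dx u_00 is smooth and JE-I becomes a polynomial identity. *)

From HB Require Import structures.
Require Import Defs.
From mathcomp Require Import all_boot all_order all_algebra.
From mathcomp Require Import complex.
From mathcomp Require Import ring lra.
From mathcomp Require Import all_classical all_reals all_analysis.
From mathcomp Require Import measurable_realfun.
Import Order.TTheory GRing.Theory Num.Theory.
Import numFieldNormedType.Exports.
Local Open Scope classical_set_scope.
Local Open Scope ring_scope.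
Import Normc.

Set Implicit Arguments.
Unset Strict Implicit.
Unset Printing Implicit Defensive.

(** The kernel of T is free of x, y, t: all parameters sit in the weight, so differentiating a
    moment means comparing the resolvents of two weights. Hence functions on Omega are taken
    pointwise, measurable and of at most exponential growth, and not as classes in one space
    L^2(Omega, w). The kernel is bounded by 1 / (2 eps), so L^2 estimates for the inverse of 1 + T
    turn into estimates at every point, and the Richardson series can be summed pointwise.

    Derivatives are obtained as first-order expansions with remainder O(|Y - X|^2), not by
    differentiating under the integral sign. This form survives sums and products; as the
    derivatives of the moments are polynomials in y, t and the moments, it iterates formally, and
    smoothness needs no further analysis.

    The exponent 2 q f t is cubic in (p, q) and could outgrow the exponential moments of Condition
    C. The envelope gives f <= C on Omega, which makes the exponent at most linear in q, locally
    uniformly in y and t. *)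

Notation cRe := complex.Re.
Notation cIm := complex.Im.

(** * Complex arithmetic and integrals *)

Section ComplexArith.
Context {R : realType}.
Implicit Types z w : R[i].

Lemma ReD z w : cRe (z + w) = cRe z + cRe w. Proof. by case: z w => a b [c d]. Qed.
Lemma ImD z w : cIm (z + w) = cIm z + cIm w. Proof. by case: z w => a b [c d]. Qed.
Lemma ReN z : cRe (- z) = - cRe z. Proof. by case: z. Qed.
Lemma ImN z : cIm (- z) = - cIm z. Proof. by case: z. Qed.
Lemma ReM z w : cRe (z * w) = cRe z * cRe w - cIm z * cIm w.
Proof. by case: z w => a b [c d]. Qed.
Lemma ImM z w : cIm (z * w) = cRe z * cIm w + cIm z * cRe w.
Proof. by case: z w => a b [c d]. Qed.
Lemma ReJ z : cRe (conjc z) = cRe z. Proof. by case: z. Qed.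
Lemma ImJ z : cIm (conjc z) = - cIm z. Proof. by case: z. Qed.
Definition ReImE := (ReD, ImD, ReN, ImN, ReM, ImM, ReJ, ImJ).

Lemma complex_ext z w : cRe z = cRe w -> cIm z = cIm w -> z = w.
Proof. by case: z w => a b [c d] /= -> ->. Qed.

Lemma normcE2 z : normc z ^+ 2 = cRe z ^+ 2 + cIm z ^+ 2.
Proof. by case: z => a b; rewrite /= sqr_sqrtr // addr_ge0 ?sqr_ge0. Qed.

Lemma normc_ge0 z : 0 <= normc z.
Proof. by case: z => a b /=; exact: sqrtr_ge0. Qed.

Lemma normc_conjc z : normc (conjc z) = normc z.
Proof. by case: z => a b /=; rewrite sqrrN. Qed.

Lemma normc_real (x : R) : normc x%:C%C = `|x|.
Proof. by rewrite /= expr0n addr0 sqrtr_sqr. Qed.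

Lemma Re_le_normc z : `|cRe z| <= normc z.
Proof.
rewrite -(ler_pXn2r (ltn0Sn 1)) ?nnegrE ?normc_ge0//.
by rewrite normcE2 real_normK ?num_real// lerDl sqr_ge0.
Qed.

Lemma Im_le_normc z : `|cIm z| <= normc z.
Proof.
rewrite -(ler_pXn2r (ltn0Sn 1)) ?nnegrE ?normc_ge0//.
by rewrite normcE2 real_normK ?num_real// lerDr sqr_ge0.
Qed.

Lemma normc_le_ReIm z : normc z <= `|cRe z| + `|cIm z|.
Proof.
rewrite -(ler_pXn2r (ltn0Sn 1)) ?nnegrE ?normc_ge0 ?addr_ge0//.
rewrite normcE2 sqrrD !real_normK ?num_real// lerD2r lerDl.
by rewrite mulrn_wge0 // mulr_ge0.
Qed.

Lemma ReMr z (x : R) : cRe (z * x%:C%C) = cRe z * x.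
Proof. by rewrite ReM /= mulr0 subr0. Qed.

Lemma conjM z w : conjc (z * w) = conjc z * conjc w.
Proof. exact: rmorphM. Qed.

Lemma mulcJ z : z * conjc z = (normc z ^+ 2)%:C%C.
Proof.
by apply: complex_ext; rewrite !ReImE /= ?normcE2; ring.
Qed.

Lemma normc_expc z : normc (expc z) = expR (cRe z).
Proof.
rewrite /expc normcM normc_real ger0_norm ?expR_ge0//= cos2Dsin2 sqrtr1.
by rewrite mulr1.
Qed.

Lemma expcD z w : expc (z + w) = expc z * expc w.
Proof.
apply: complex_ext; rewrite /expc !(ReImE, expRD, cosD, sinD) /=; ring.
Qed.

Lemma conjc_expc z : conjc (expc z) = expc (conjc z).
Proof.
apply: complex_ext; rewrite /expc !ReImE /= ?cosN ?sinN; ring.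
Qed.

Lemma expc0 : expc (0 : R[i]) = 1.
Proof. by apply: complex_ext; rewrite /expc !ReImE /= expR0 cos0 sin0; ring. Qed.

Lemma expc_real (x : R) : expc x%:C%C = (expR x)%:C%C.
Proof. by apply: complex_ext; rewrite /expc !ReImE /= cos0 sin0; ring. Qed.

End ComplexArith.

Section ComplexIntegral.
Context d (T : measurableType d) (R : realType).
Variable mu : {measure set T -> \bar R}.
Implicit Types (D : set T) (f g : T -> R[i]).

Definition cmeasurable D f :=
  measurable_fun D (fun x => cRe (f x)) /\ measurable_fun D (fun x => cIm (f x)).

Definition cintegrable D f :=
  mu.-integrable D (EFin \o (fun x => cRe (f x))) /\
  mu.-integrable D (EFin \o (fun x => cIm (f x))).

Lemma eq_cintegral D f g : {in D, f =1 g} ->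
  cintegral mu D f = cintegral mu D g.
Proof.
by move=> fg; congr (_ +i* _)%C; apply: eq_Rintegral => x xD; rewrite fg.
Qed.

Lemma eq_cmeasurable D f g : {in D, f =1 g} -> cmeasurable D f -> cmeasurable D g.
Proof.
move=> fg [f1 f2]; split.
  by apply: eq_measurable_fun f1 => x xD; rewrite fg.
by apply: eq_measurable_fun f2 => x xD; rewrite fg.
Qed.

Lemma cmeasurableD D f g : cmeasurable D f -> cmeasurable D g ->
  cmeasurable D (fun x => f x + g x).
Proof.
move=> [f1 f2] [g1 g2]; split.
  by under eq_fun do rewrite ReD; exact: measurable_funD.
by under eq_fun do rewrite ImD; exact: measurable_funD.
Qed.

Lemma cmeasurableN D f : cmeasurable D f -> cmeasurable D (fun x => - f x).
Proof.
move=> [f1 f2]; split.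
  by under eq_fun do rewrite ReN; exact: measurableT_comp.
by under eq_fun do rewrite ImN; exact: measurableT_comp.
Qed.

Lemma cmeasurableM D f g : cmeasurable D f -> cmeasurable D g ->
  cmeasurable D (fun x => f x * g x).
Proof.
move=> [f1 f2] [g1 g2]; split.
  by under eq_fun do rewrite ReM; apply: measurable_funB; exact: measurable_funM.
by under eq_fun do rewrite ImM; apply: measurable_funD; exact: measurable_funM.
Qed.

Lemma cmeasurableJ D f : cmeasurable D f -> cmeasurable D (fun x => conjc (f x)).
Proof.
move=> [f1 f2]; split.
  by under eq_fun do rewrite ReJ.
by under eq_fun do rewrite ImJ; exact: measurableT_comp.
Qed.

Lemma cmeasurable_cst D (c : R[i]) : cmeasurable D (fun=> c).
Proof. by split; exact: measurable_cst. Qed.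

Lemma cmeasurable_real D (f : T -> R) : measurable_fun D f ->
  cmeasurable D (fun x => (f x)%:C%C).
Proof. by split => //=; exact: measurable_cst. Qed.

Lemma cmeasurable_expc D f : cmeasurable D f -> cmeasurable D (fun x => expc (f x)).
Proof.
move=> [f1 f2]; rewrite /expc; apply: cmeasurableM.
  by apply: cmeasurable_real; apply: measurableT_comp.
by split => /=; apply: measurableT_comp => //; apply: continuous_measurable_fun;
  [exact: continuous_cos | exact: continuous_sin].
Qed.

Lemma measurable_normc D f : cmeasurable D f -> measurable_fun D (fun x => normc (f x)).
Proof.
move=> [f1 f2].
have -> : (fun x => normc (f x)) =
    (fun x => Num.sqrt (cRe (f x) ^+ 2 + cIm (f x) ^+ 2)).
  by apply/funext => x; case: (f x).
apply: measurableT_comp.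
  by apply: continuous_measurable_fun; exact: sqrt_continuous.
by apply: measurable_funD; exact: measurable_funX.
Qed.

Lemma cintegrable_le D f (g : T -> R) : measurable D -> cmeasurable D f ->
  mu.-integrable D (EFin \o g) -> (forall x, D x -> normc (f x) <= g x) ->
  cintegrable D f.
Proof.
move=> mD [f1 f2] ig fg; split; apply: le_integrable ig => //.
- exact/measurable_EFinP.
- move=> x Dx /=; rewrite lee_fin (le_trans (Re_le_normc _))//.
  by rewrite (le_trans (fg _ Dx))// ler_norm.
- exact/measurable_EFinP.
- move=> x Dx /=; rewrite lee_fin (le_trans (Im_le_normc _))//.
  by rewrite (le_trans (fg _ Dx))// ler_norm.
Qed.

Lemma cintegrable_meas D f : cintegrable D f -> cmeasurable D f.
Proof. by move=> [f1 f2]; split; apply/measurable_EFinP; exact: measurable_int f1 || exact: measurable_int f2. Qed.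

Lemma cintegrable_normc D f : measurable D -> cintegrable D f ->
  mu.-integrable D (EFin \o (fun x => normc (f x))).
Proof.
move=> mD fi; have [f1 f2] := fi.
have h : mu.-integrable D (EFin \o (fun x => `|cRe (f x)| + `|cIm (f x)|)).
  have -> : EFin \o (fun x => `|cRe (f x)| + `|cIm (f x)|) =
    (fun x => (abse \o (EFin \o (fun x => cRe (f x)))) x +
              (abse \o (EFin \o (fun x => cIm (f x)))) x)%E by [].
  by apply: integrableD => //; exact: integrable_abse.
apply: le_integrable h => //.
  by apply/measurable_EFinP; apply: measurable_normc; exact: cintegrable_meas.
move=> x Dx /=; rewrite lee_fin ger0_norm ?normc_ge0// ger0_norm ?addr_ge0//.
exact: normc_le_ReIm.
Qed.

Lemma cintegralD D f g : measurable D -> cintegrable D f -> cintegrable D g ->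
  cintegral mu D (fun x => f x + g x) = cintegral mu D f + cintegral mu D g.
Proof.
move=> mD [f1 f2] [g1 g2]; rewrite /cintegral; apply: complex_ext => /=.
  by under eq_Rintegral do rewrite ReD; rewrite RintegralD.
by under eq_Rintegral do rewrite ImD; rewrite RintegralD.
Qed.

Lemma integrable_mulcl D (f : T -> R) (c : R) : measurable D ->
  mu.-integrable D (EFin \o f) -> mu.-integrable D (EFin \o (fun x => c * f x)).
Proof.
move=> mD fi.
by under [X in mu.-integrable _ X]eq_fun do rewrite /= EFinM; exact: integrableZl.
Qed.

Lemma cintegrableZ D f (c : R[i]) : measurable D -> cintegrable D f ->
  cintegrable D (fun x => c * f x).
Proof.
move=> mD fi; apply: (@cintegrable_le _ _ (fun x => normc c * normc (f x))) => //.
- by apply: cmeasurableM; [exact: cmeasurable_cst|exact: cintegrable_meas].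
- by apply: integrable_mulcl => //; exact: cintegrable_normc.
- by move=> x _; rewrite normcM.
Qed.

Lemma cintegralZ D f (c : R[i]) : measurable D -> cintegrable D f ->
  cintegral mu D (fun x => c * f x) = c * cintegral mu D f.
Proof.
move=> mD [f1 f2]; apply: complex_ext; rewrite !ReImE /=.
  under eq_Rintegral do rewrite ReM.
  by rewrite RintegralB ?RintegralZl//; exact: integrable_mulcl.
under eq_Rintegral do rewrite ImM.
by rewrite RintegralD ?RintegralZl//; exact: integrable_mulcl.
Qed.

Lemma cintegralJ D f : measurable D -> cintegrable D f ->
  cintegral mu D (fun x => conjc (f x)) = conjc (cintegral mu D f).
Proof.
move=> mD [f1 f2]; apply: complex_ext; rewrite !ReImE /=.
  by under eq_Rintegral do rewrite ReJ.
under eq_Rintegral do rewrite ImJ -mulN1r.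
by rewrite RintegralZl// mulN1r.
Qed.

(** Multiplication by the conjugate of the integral [I] rotates it onto the real axis, where the
    bound for real integrals loses no factor. *)
Lemma normc_cintegral D f : measurable D -> cintegrable D f ->
  normc (cintegral mu D f) <= Rintegral mu D (fun x => normc (f x)).
Proof.
move=> mD fi; set I := cintegral mu D f.
have [->|I0] := eqVneq (normc I) 0.
  by apply: Rintegral_ge0 => x _; exact: normc_ge0.
have Ip : 0 < normc I by rewrite lt_neqAle eq_sym I0 normc_ge0.
rewrite -(ler_pM2l Ip) -expr2.
have -> : normc I ^+ 2 = cRe (conjc I * I).
  by rewrite mulrC mulcJ.
rewrite {2}/I -cintegralZ//.
rewrite -[leLHS]/(Rintegral mu D (fun x => cRe (conjc I * f x))).
have ni := cintegrable_normc mD fi.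
rewrite -RintegralZl//; apply: le_Rintegral => //.
- by have [] := cintegrableZ (conjc I) mD fi.
- exact: integrable_mulcl.
- move=> x _; rewrite (le_trans (ler_norm _))// (le_trans (Re_le_normc _))//.
  by rewrite normcM normc_conjc.
Qed.

End ComplexIntegral.

(** * Fubini theorems under product majorants *)

Section Fubini.
Context d1 d2 (T1 : measurableType d1) (T2 : measurableType d2) (R : realType).
Variable m1 : {sigma_finite_measure set T1 -> \bar R}.
Variable m2 : {sigma_finite_measure set T2 -> \bar R}.

(** No integrability is assumed: the inner integral is a difference of two measurable extended-real
    functions, and [fine] preserves measurability where it is infinite. *)
Lemma measurable_Rintegral_snd (f : T1 * T2 -> R) : measurable_fun setT f ->
  measurable_fun setT (fun x => Rintegral m2 setT (fun y => f (x, y))).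
Proof.
move=> mf; rewrite /Rintegral; apply: (@measurableT_comp _ _ _ _ _ _ fine) => //.
have mf' : measurable_fun setT (EFin \o f) by exact/measurable_EFinP.
rewrite [X in measurable_fun _ X](_ : _ = (fun x =>
    fubini_F m2 (EFin \o f)^\+%E x - fubini_F m2 (EFin \o f)^\-%E x)%E); last first.
  apply/funext => x; rewrite integralE /fubini_F.
  by congr (_ - _)%E; apply: eq_integral => y _; rewrite ?funeposE ?funenegE.
apply: emeasurable_funB; apply: measurable_fun_fubini_tonelli_F => //.
- exact: measurable_funepos.
- exact: measurable_funeneg.
Qed.

Lemma measurable_Rintegral_fst (f : T1 * T2 -> R) : measurable_fun setT f ->
  measurable_fun setT (fun y => Rintegral m1 setT (fun x => f (x, y))).
Proof.
move=> mf; rewrite /Rintegral; apply: (@measurableT_comp _ _ _ _ _ _ fine) => //.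
have mf' : measurable_fun setT (EFin \o f) by exact/measurable_EFinP.
rewrite [X in measurable_fun _ X](_ : _ = (fun x =>
    fubini_G m1 (EFin \o f)^\+%E x - fubini_G m1 (EFin \o f)^\-%E x)%E); last first.
  apply/funext => x; rewrite integralE /fubini_G.
  by congr (_ - _)%E; apply: eq_integral => y _; rewrite ?funeposE ?funenegE.
apply: emeasurable_funB; apply: measurable_fun_fubini_tonelli_G => //.
- exact: measurable_funepos.
- exact: measurable_funeneg.
Qed.

Lemma cmeasurable_cintegral_snd (f : T1 * T2 -> R[i]) : cmeasurable setT f ->
  cmeasurable setT (fun x => cintegral m2 setT (fun y => f (x, y))).
Proof.
move=> [f1 f2]; split; first exact: (measurable_Rintegral_snd f1).
exact: (measurable_Rintegral_snd f2).
Qed.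

Lemma cmeasurable_cintegral_fst (f : T1 * T2 -> R[i]) : cmeasurable setT f ->
  cmeasurable setT (fun y => cintegral m1 setT (fun x => f (x, y))).
Proof.
move=> [f1 f2]; split; first exact: (measurable_Rintegral_fst f1).
exact: (measurable_Rintegral_fst f2).
Qed.

(** A majorant in product form makes [f] jointly integrable and each of its sections integrable, so
    no exceptional null sets of sections arise and [Rintegral] can be used throughout. *)
Lemma Rfubini (f : T1 * T2 -> R) (u : T1 -> R) (v : T2 -> R) :
  measurable_fun setT f ->
  m1.-integrable setT (EFin \o u) -> m2.-integrable setT (EFin \o v) ->
  (forall x y, `|f (x, y)| <= u x * v y) ->
  Rintegral m1 setT (fun x => Rintegral m2 setT (fun y => f (x, y))) =
  Rintegral m2 setT (fun y => Rintegral m1 setT (fun x => f (x, y))).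
Proof.
move=> mf iu iv fuv.
have mf' : measurable_fun setT (EFin \o f) by exact/measurable_EFinP.
have sx x : m2.-integrable setT (EFin \o (fun y => f (x, y))).
  apply: (@le_integrable _ _ _ _ _ measurableT _ (EFin \o (fun y => u x * v y))) => //.
  - by apply/measurable_EFinP; exact: measurableT_comp.
  - by move=> y _ /=; rewrite lee_fin (le_trans (fuv _ _))// ler_norm.
  - exact: integrable_mulcl.
have sy y : m1.-integrable setT (EFin \o (fun x => f (x, y))).
  apply: (@le_integrable _ _ _ _ _ measurableT _ (EFin \o (fun x => v y * u x))) => //.
  - by apply/measurable_EFinP; exact: measurableT_comp.
  - by move=> x _ /=; rewrite lee_fin mulrC (le_trans (fuv _ _))// ler_norm.
  - exact: integrable_mulcl.
have ifp : (m1 \x m2)%E.-integrable setT (EFin \o f).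
  apply/integrable12ltyP => //=.
  apply: (@le_lt_trans _ _
    (\int[m1]_x ((`|u x|)%:E * \int[m2]_y (`|v y|)%:E))%E).
    apply: ge0_le_integral => //.
    - by move=> x _; apply: integral_ge0.
    - apply: (measurable_fun_fubini_tonelli_F (m2 := m2) (fun z => (abse (f z)%:E))) => //.
      by apply: measurableT_comp.
    - apply: emeasurable_funM => //; apply/measurable_EFinP.
      by apply: measurableT_comp => //; apply/measurable_EFinP; exact: measurable_int iu.
    - move=> x _; rewrite -ge0_integralZl//; last first.
        by apply/measurable_EFinP; apply: measurableT_comp => //;
          apply/measurable_EFinP; exact: measurable_int iv.
      apply: ge0_le_integral => //.
      + by apply/measurable_EFinP; apply: measurableT_comp => //; exact: measurableT_comp.
      + apply: emeasurable_funM => //; apply/measurable_EFinP.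
        by apply: measurableT_comp => //; apply/measurable_EFinP; exact: measurable_int iv.
      + by move=> y _; rewrite -EFinM lee_fin -normrM (le_trans (fuv _ _))// ler_norm.
  rewrite ge0_integralZr//.
  - have /integrableP[_ +] := iu; have /integrableP[_ +] := iv => /= iv' iu'.
    by apply: lte_mul_pinfty => //; [exact: integral_ge0
      | rewrite ge0_fin_numE //; exact: integral_ge0].
  - by apply/measurable_EFinP; apply: measurableT_comp => //;
      apply/measurable_EFinP; exact: measurable_int iu.
  - exact: integral_ge0.
have := Fubini ifp.
rewrite {1 3}/Rintegral => FE; congr fine.
transitivity (\int[m1]_x \int[m2]_y (EFin \o f) (x, y))%E.
  by apply: eq_integral => x _; rewrite fineK//; exact: integrable_fin_num (sx x).
rewrite FE; apply: eq_integral => y _.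
by rewrite fineK//; exact: integrable_fin_num (sy y).
Qed.

Lemma cfubini (f : T1 * T2 -> R[i]) (u : T1 -> R) (v : T2 -> R) :
  cmeasurable setT f ->
  m1.-integrable setT (EFin \o u) -> m2.-integrable setT (EFin \o v) ->
  (forall x y, normc (f (x, y)) <= u x * v y) ->
  cintegral m1 setT (fun x => cintegral m2 setT (fun y => f (x, y))) =
  cintegral m2 setT (fun y => cintegral m1 setT (fun x => f (x, y))).
Proof.
move=> [f1 f2] iu iv fuv; apply: complex_ext => /=.
  apply: (Rfubini (f := fun z => cRe (f z)) f1 iu iv) => x y.
  by rewrite (le_trans (Re_le_normc _)).
apply: (Rfubini (f := fun z => cIm (f z)) f2 iu iv) => x y.
by rewrite (le_trans (Im_le_normc _)).
Qed.

End Fubini.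

Section Restrict.
Context d (T : measurableType d) (R : realType).
Variable mu : {measure set T -> \bar R}.

Lemma Rintegral_indic_mul (D : set T) (f : T -> R) :
  Rintegral mu D f = Rintegral mu setT (fun z => \1_D z * f z).
Proof.
rewrite Rintegral_mkcond; apply: eq_Rintegral => z _.
by rewrite patchE indicE; case: (z \in D); rewrite ?mul1r ?mul0r.
Qed.

Lemma cintegral_indic_mul (D : set T) (f : T -> R[i]) :
  cintegral mu D f = cintegral mu setT (fun z => (\1_D z)%:C%C * f z).
Proof.
apply: complex_ext => /=; rewrite Rintegral_indic_mul; apply: eq_Rintegral => z _.
  by rewrite ReM /= mul0r subr0.
by rewrite ImM /= mul0r addr0.
Qed.

Lemma measurable_fun_indic_mul (D : set T) (f : T -> R) : measurable D ->
  measurable_fun D f -> measurable_fun setT (fun z => \1_D z * f z).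
Proof.
move=> mD mf; have -> : (fun z => \1_D z * f z) = f \_ D.
  apply/funext => z.
  by rewrite patchE indicE; case: (z \in D); rewrite ?mul1r ?mul0r.
exact/(measurable_restrictT _ mD).
Qed.

Lemma cmeasurable_indic_mul (D : set T) (f : T -> R[i]) : measurable D ->
  cmeasurable D f -> cmeasurable setT (fun z => (\1_D z)%:C%C * f z).
Proof.
move=> mD [f1 f2]; split.
  under eq_fun do rewrite ReM /= mul0r subr0; exact: measurable_fun_indic_mul.
under eq_fun do rewrite ImM /= mul0r addr0; exact: measurable_fun_indic_mul.
Qed.

Lemma integrable_indic_mul (D : set T) (f : T -> R) : measurable D ->
  mu.-integrable D (EFin \o f) ->
  mu.-integrable setT (EFin \o (fun z => \1_D z * f z)).
Proof.
move=> mD /(integrable_mkcond _ mD).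
have -> : (EFin \o f) \_ D = EFin \o (fun z => \1_D z * f z).
  apply/funext => z /=; rewrite patchE indicE.
  by case: (z \in D); rewrite ?mul1r ?mul0r.
by [].
Qed.

Lemma cintegral_ae_eq (D : set T) (f g : T -> R[i]) : measurable D ->
  cmeasurable D f -> cmeasurable D g ->
  {ae mu, forall z, D z -> f z = g z} -> cintegral mu D f = cintegral mu D g.
Proof.
move=> mD [f1 f2] [g1 g2] fg; apply: complex_ext; congr fine;
  apply: ae_eq_integral => //; try exact/measurable_EFinP.
- by apply: filterS fg => z h Dz; rewrite h.
- by apply: filterS fg => z h Dz; rewrite h.
Qed.

End Restrict.

Lemma ae_lebesgue_imp (R : realType) (A B : R -> Prop) : (forall z, A z -> B z) ->
  {ae @lebesgue_measure R, forall z, A z} -> {ae @lebesgue_measure R, forall z, B z}.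
Proof.
by move=> AB; apply: (@filterS _ _ (ae_filter_ringOfSetsType (@lebesgue_measure R)) A B).
Qed.

(** * Integrals of decaying exponentials on a half-line *)

Section ExpIntegral.
Context {R : realType}.
Implicit Types (b x : R).

Let mu := @lebesgue_measure R.

Lemma expR_decay b x : 0 < b -> expR (- b * (z - x)) @[z --> +oo] --> (0 : R).
Proof.
move=> b0.
have -> : (fun z => expR (- b * (z - x))) = (fun z => expR (b * x) * expR (- (b * z))).
  by apply/funext => z; rewrite -expRD; congr expR; ring.
rewrite -[X in _ --> X](mulr0 (expR (b * x))); apply: cvgM; first exact: cvg_cst.
apply: (@cvg_comp _ _ _ (fun z => b * z) (fun z => expR (- z)) _ (pinfty_nbhs R)); last exact: cvgr_expR.
by apply: gt0_cvgMry => //; exact: cvg_id.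
Qed.

Lemma integral_expR_decay b x : 0 < b ->
  mu.-integrable `[x, +oo[ (EFin \o (fun z => expR (- b * (z - x)))) /\
  Rintegral mu `[x, +oo[ (fun z => expR (- b * (z - x))) = b^-1.
Proof.
move=> b0; pose F z := - b^-1 * expR (- b * (z - x)).
have dF (z : R) : is_derive z 1 F (expR (- b * (z - x))).
  rewrite /F; apply: is_derive_eq.
  by rewrite /GRing.scale /=; field; rewrite gt_eqF.
have h : (\int[mu]_(z in `[x, +oo[) (expR (- b * (z - x)))%:E = 0%:E - (F x)%:E)%E.
  apply: (@ge0_continuous_FTC2y _ _ F).
  - by move=> z _; exact: expR_ge0.
  - apply: continuous_subspaceT => z; apply: differentiable_continuous.
    by apply/derivable1_diffP; apply: ex_derive.
  - rewrite -[X in _ --> X](mulr0 (- b^-1)); apply: cvgM; first exact: cvg_cst.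
    exact: expR_decay.
  - by move=> z _; apply: ex_derive.
  - apply: cvg_at_right_filter; apply: differentiable_continuous.
    by apply/derivable1_diffP; apply: ex_derive.
  - by move=> z _; rewrite derive1E; apply: derive_val.
split; last by rewrite /Rintegral h /F subrr mulr0 expR0 /= sub0r mulr1 opprK.
apply/integrableP; split.
  apply/measurable_EFinP; apply: measurable_funTS; apply: continuous_measurable_fun => z.
  by apply: differentiable_continuous; apply/derivable1_diffP; apply: ex_derive.
under eq_integral => z _ do rewrite /= ger0_norm ?expR_ge0//.
by rewrite h -EFinB ltry.
Qed.

(** Adding the majorant [expR (- b * (z - x))] to [f] makes the integrand nonnegative, so the
    fundamental theorem for nonnegative functions on a half-line applies. The integral [b^-1] of the
    majorant is subtracted afterwards. *)
Lemma integral_decaying_derivative b x (M : R) (f F : R -> R) : 0 < b ->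
  (forall z : R, is_derive z 1 F (f z)) -> continuous f ->
  (forall z : R, `|f z| <= expR (- b * (z - x))) ->
  (forall z : R, `|F z| <= M * expR (- b * (z - x))) ->
  Rintegral mu `[x, +oo[ f = - F x.
Proof.
move=> b0 dF cf fb Fb.
have [ie eE] := integral_expR_decay x b0.
pose E z := - b^-1 * expR (- b * (z - x)).
have dE (z : R) : is_derive z 1 E (expR (- b * (z - x))).
  rewrite /E; apply: is_derive_eq.
  by rewrite /GRing.scale /=; field; rewrite gt_eqF.
have fi : mu.-integrable `[x, +oo[ (EFin \o f).
  apply: le_integrable ie => //.
    by apply/measurable_EFinP; apply: measurable_funTS; exact: continuous_measurable_fun.
  by move=> z _ /=; rewrite lee_fin (le_trans (fb z))// ler_norm.
have F0 : F z @[z --> +oo] --> (0 : R).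
  apply/cvgr0Pnorm_le => e e0.
  have : M * expR (- b * (z - x)) @[z --> +oo] --> (0 : R).
    rewrite -[X in _ --> X](mulr0 M); apply: cvgM; first exact: cvg_cst.
    exact: expR_decay.
  move=> /cvgr0Pnorm_le /(_ _ e0); apply: filterS => z.
  by apply: le_trans; rewrite (le_trans (Fb z))// ler_norm.
have E0 : E z @[z --> +oo] --> (0 : R).
  rewrite -[X in _ --> X](mulr0 (- b^-1)); apply: cvgM; first exact: cvg_cst.
  exact: expR_decay.
have cE : continuous (fun z : R => expR (- b * (z - x))).
  by move=> z; apply: differentiable_continuous; apply/derivable1_diffP; apply: ex_derive.
pose g z := f z + expR (- b * (z - x)); pose G z := F z + E z.
have dG (z : R) : is_derive z 1 G (g z) by apply: is_deriveD.
have h : Rintegral mu `[x, +oo[ g = 0 - G x.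
  apply: Rintegral_ge0_continuous_FTC2y.
  - move=> z _; rewrite /g -lerBlDr sub0r.
    by have := fb z; rewrite ler_norml => /andP[].
  - apply: continuous_subspaceT => z; apply: cvgD; first exact: cf.
    exact: cE.
  - by rewrite -[X in _ --> X](addr0 0); exact: cvgD.
  - by move=> z _; apply: ex_derive.
  - apply: cvg_at_right_filter; apply: differentiable_continuous.
    by apply/derivable1_diffP; apply: ex_derive.
  - by move=> z _; rewrite derive1E; apply: derive_val.
have : Rintegral mu `[x, +oo[ g = Rintegral mu `[x, +oo[ f + b^-1.
  by rewrite /g RintegralD// eE.
rewrite h /G /E subrr mulr0 expR0 mulr1 sub0r opprB => hE.
by apply: (addIr b^-1); rewrite -hE addrC.
Qed.

Lemma cintegral_expc (c : R[i]) x : cRe c < 0 ->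
  cintegral mu `[x, +oo[ (fun z => expc (c * (z - x)%:C%C)) = - c^-1.
Proof.
case: c => c1 beta /= c10.
have [b b0 ->] : exists2 b, 0 < b & c1 = - b.
  by exists (- c1); rewrite ?oppr_gt0 ?opprK.
have n0 : b ^+ 2 + beta ^+ 2 != 0.
  by rewrite gt_eqF// ltr_pwDl ?exprn_gt0 ?sqr_ge0.
have bnd (z u v : R) : `|expR (- b * (z - x)) * (u * sin (beta * (z - x)) + v * cos (beta * (z - x)))|
   <= (`|u| + `|v|) * expR (- b * (z - x)).
  rewrite normrM ger0_norm ?expR_ge0// mulrC ler_wpM2r ?expR_ge0//.
  rewrite (le_trans (ler_normD _ _))// !normrM lerD// ler_piMr//.
    by rewrite ler_norml sin_geN1 sin_le1.
  by rewrite ler_norml cos_geN1 cos_le1.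
have cont (u v : R) : continuous (fun z => expR (- b * (z - x)) * (u * sin (beta * (z - x)) + v * cos (beta * (z - x)))).
  by move=> z; apply: differentiable_continuous; apply/derivable1_diffP; apply: ex_derive.
apply: complex_ext; rewrite /expc.
(* This antiderivative is the real part of [c^-1 * expc (c * (z - x))]; the second case uses the
   imaginary part. *)
- pose F z := expR (- b * (z - x)) * ((beta / (b ^+ 2 + beta ^+ 2)) * sin (beta * (z - x))
     + (- b / (b ^+ 2 + beta ^+ 2)) * cos (beta * (z - x))).
  transitivity (- F x); last first.
    rewrite /F subrr !mulr0 expR0 sin0 cos0 /= sqrrN. ring.
  have -> : cRe (cintegral mu `[x, +oo[ (fun z => expc ((- b +i* beta)%C * (z - x)%:C%C))) =
     Rintegral mu `[x, +oo[ (fun z => expR (- b * (z - x)) *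
        (0 * sin (beta * (z - x)) + 1 * cos (beta * (z - x)))).
    apply: eq_Rintegral => z _; rewrite /expc !ReImE /=.
    by rewrite !(mulr0, mul0r, subr0, add0r, mul1r, addr0).
  apply: (integral_decaying_derivative (F := F) b0) => [z| |z|z]; last exact: bnd.
  - rewrite /F; apply: is_derive_eq.
    by rewrite /GRing.scale /=; field.
  - exact: cont.
  - by rewrite (le_trans (bnd _ _ _))// normr0 normr1 add0r mul1r.
- pose F z := expR (- b * (z - x)) * ((- b / (b ^+ 2 + beta ^+ 2)) * sin (beta * (z - x))
     + (- beta / (b ^+ 2 + beta ^+ 2)) * cos (beta * (z - x))).
  transitivity (- F x); last first.
    rewrite /F subrr !mulr0 expR0 sin0 cos0 /= (sqrrN b); ring.
  have -> : cIm (cintegral mu `[x, +oo[ (fun z => expc ((- b +i* beta)%C * (z - x)%:C%C))) =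
     Rintegral mu `[x, +oo[ (fun z => expR (- b * (z - x)) *
        (1 * sin (beta * (z - x)) + 0 * cos (beta * (z - x)))).
    apply: eq_Rintegral => z _; rewrite /expc !ReImE /=.
    by rewrite !(mulr0, mul0r, subr0, add0r, mul1r, addr0).
  apply: (integral_decaying_derivative (F := F) b0) => [z| |z|z]; last exact: bnd.
  - rewrite /F; apply: is_derive_eq.
    by rewrite /GRing.scale /=; field.
  - exact: cont.
  - by rewrite (le_trans (bnd _ _ _))// normr0 normr1 addr0 mul1r.
Qed.

End ExpIntegral.

(** * Pointwise sums of geometrically bounded series *)

Section GeometricSeries.
Context d (T : measurableType d) (R : realType).
Implicit Types (C r : R).

Lemma geometric_le0 (x : R) C r : 0 <= r < 1 -> (forall n, x <= C * r ^+ n) -> x <= 0.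
Proof.
move=> /andP[r0 r1] h.
have : (C * r ^+ n) @[n --> \oo] --> (0 : R).
  rewrite -[X in _ --> X](mulr0 C); apply: cvgM; first exact: cvg_cst.
  by apply: cvg_expr; rewrite ger0_norm.
by move=> hc; apply: cvgr_to_ge hc _; near=> n.
Unshelve. all: by end_near. Qed.

Lemma sum_geometric_le (f : nat -> R) C r N m : 0 <= r < 1 -> 0 <= C ->
  (forall n, `|f n| <= C * r ^+ n) ->
  `|\sum_(0 <= n < m + N) f n - \sum_(0 <= n < N) f n| <= C * r ^+ N / (1 - r).
Proof.
move=> /andP[r0 r1] C0 h; have q : 0 < 1 - r by rewrite subr_gt0.
rewrite (big_cat_nat (n := N))//= ?leq_addl// addrAC subrr add0r.
(* The exact finite geometric sum is the bound that passes through the induction on [m]. *)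
suff : `|\sum_(N <= i < m + N) f i| <= C * (r ^+ N - r ^+ (m + N)) / (1 - r).
  move=> /le_trans; apply; rewrite ler_wpM2r ?invr_ge0 ?(ltW q)// ler_wpM2l//.
  by rewrite lerBlDr lerDl exprn_ge0.
elim: m => [|m ih].
  by rewrite add0n big_geq// normr0 subrr mulr0 mul0r.
rewrite addSn big_nat_recr ?leq_addl//= (le_trans (ler_normD _ _))//.
rewrite (le_trans (lerD ih (h _)))// le_eqVlt; apply/orP; left; apply/eqP.
by rewrite exprS; field; rewrite gt_eqF.
Qed.

(** Takes the place of completeness of a function space: the limit is built point by point, and the
    tail bound is uniform in [a]. *)
Lemma geometric_limit (g : nat -> T -> R) C r : 0 <= r < 1 -> 0 <= C ->
  (forall n, measurable_fun setT (g n)) ->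
  (forall n a, `|g n a| <= C * r ^+ n) ->
  exists2 G : T -> R, measurable_fun setT G &
    forall N a, `|G a - \sum_(0 <= n < N) g n a| <= C * r ^+ N / (1 - r).
Proof.
move=> r01 C0 mg h; have /andP[r0 r1] := r01.
pose s a : R^nat := fun N => \sum_(0 <= n < N) g n a.
have cs a : cvgn (s a).
  apply: normed_cvg.
  apply: (@series_le_cvg _ _ (fun n => C * r ^+ n)).
  - by move=> n /=.
  - by move=> n; rewrite mulr_ge0// exprn_ge0.
  - by move=> n; exact: h.
  - by apply: is_cvg_geometric_series; rewrite ger0_norm.
exists (fun a => limn (s a)).
  apply: (@measurable_fun_cvg _ _ _ _ (fun N a => s a N)).
    by move=> N; exact: measurable_sum.
  by move=> a _; exact: cs.
move=> N a; have c1 : (s a (n + N)%N) @[n --> \oo] --> limn (s a).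
  by have := cs a; rewrite -(cvg_shiftn N).
have c2 : `|s a (n + N)%N - s a N| @[n --> \oo] --> `|limn (s a) - s a N|.
  by apply: cvg_norm; apply: cvgB => //; exact: cvg_cst.
apply: cvgr_to_le c2 _; near=> n; exact: sum_geometric_le.
Unshelve. all: by end_near. Qed.

Lemma cgeometric_limit (g : nat -> T -> R[i]) C r : 0 <= r < 1 -> 0 <= C ->
  (forall n, cmeasurable setT (g n)) ->
  (forall n a, normc (g n a) <= C * r ^+ n) ->
  exists2 G : T -> R[i], cmeasurable setT G &
    forall N a, normc (G a - \sum_(0 <= n < N) g n a) <= (2 * C / (1 - r)) * r ^+ N.
Proof.
move=> r01 C0 mg h.
have [G1 mG1 h1] := @geometric_limit (fun n a => cRe (g n a)) C r r01 C0
  (fun n => (mg n).1) (fun n a => le_trans (Re_le_normc _) (h n a)).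
have [G2 mG2 h2] := @geometric_limit (fun n a => cIm (g n a)) C r r01 C0
  (fun n => (mg n).2) (fun n a => le_trans (Im_le_normc _) (h n a)).
exists (fun a => (G1 a +i* G2 a)%C); first by split.
move=> N a; rewrite (le_trans (normc_le_ReIm _))//.
have -> : 2 * C / (1 - r) * r ^+ N = C * r ^+ N / (1 - r) + C * r ^+ N / (1 - r).
  by ring.
have sumE (p : R[i] -> R) : p 0 = 0 -> {morph p : x y / x + y} ->
    p (\sum_(0 <= n < N) g n a) = \sum_(0 <= n < N) p (g n a).
  by move=> p0 pD; elim/big_rec2: _ => // n x y _ <-; rewrite pD.
rewrite !ReImE (sumE (@complex.Re R) erefl ReD) (sumE (@complex.Im R) erefl ImD).
by apply: lerD; [exact: h1|exact: h2].
Qed.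

End GeometricSeries.

(** * Taylor estimates for the exponential and for the exponent *)

Section CTaylor.
Context {R : realType}.
Implicit Types (X Y H : R * R * R).

Lemma norm3_1 H : `|H.1.1| <= `|H|.
Proof. by rewrite !prod_normE /= !le_max lexx. Qed.
Lemma norm3_2 H : `|H.1.2| <= `|H|.
Proof. by rewrite !prod_normE /= !le_max lexx orbT. Qed.
Lemma norm3_3 H : `|H.2| <= `|H|.
Proof. by rewrite !prod_normE /= !le_max lexx orbT. Qed.

(** An expansion in (x, y, t) with quadratic remainder, stronger than Frechet differentiability. It
    is what the integral estimates yield directly, and it is stable under sums and products. *)
Definition cdiff (f : R * R * R -> R[i]) X (d1 d2 d3 : R[i]) :=
  exists C r, [/\ 0 <= C, 0 < r & forall Y, `|Y - X| < r ->
    normc (f Y - f X - (d1 * ((Y - X).1.1)%:C%C + d2 * ((Y - X).1.2)%:C%C + d3 * ((Y - X).2)%:C%C))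
      <= C * `|Y - X| ^+ 2].

Lemma expR_sub1_bounds (u : R) : u <= expR u - 1 <= u * expR u.
Proof.
apply/andP; split; first by have := expR_ge1Dx u; lra.
have := expR_ge1Dx (- u); rewrite expRN => h.
have := ler_wpM2r (expR_ge0 u) h; rewrite mulVf ?gt_eqF ?expR_gt0//; lra.
Qed.

(** The sum of the two end values stands for the maximum of [expR] between [u] and [v]; later both
    ends are bounded by one common weight. *)
Lemma expR_lipschitz (u v : R) :
  `|expR v - expR u| <= `|v - u| * (expR u + expR v).
Proof.
have /andP[h1 h2] := expR_sub1_bounds (v - u).
have eu := expR_gt0 u; have ev := expR_gt0 v.
have E : expR v = expR (v - u) * expR u by rewrite -expRD subrK.
have h3 := ler_wpM2r (ltW eu) h1; have h4 := ler_wpM2r (ltW eu) h2.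
rewrite [leRHS]mulrBl mul1r -E in h3; rewrite [leLHS]mulrBl mul1r -E -mulrA -E in h4.
have := ler_norm (v - u); have := ler_norm (u - v); rewrite (distrC u v) => h5 h6.
rewrite mulrDr ler_norml; apply/andP; split.
  have : - (`|v - u| * expR u) <= (v - u) * expR u.
    by rewrite -mulNr ler_wpM2r ?(ltW eu)//; lra.
  have : 0 <= `|v - u| * expR v by rewrite mulr_ge0 ?(ltW ev).
  lra.
have : (v - u) * expR v <= `|v - u| * expR v by rewrite ler_wpM2r ?(ltW ev).
have : 0 <= `|v - u| * expR u by rewrite mulr_ge0 ?(ltW eu).
lra.
Qed.

(** By convexity the remainder lies between [0] and [(v - u) * (expR v - expR u)], to which
    [expR_lipschitz] applies. *)
Lemma expR_taylor (u v : R) :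
  `|expR v - expR u - (v - u) * expR u| <= (v - u) ^+ 2 * (expR u + expR v).
Proof.
have /andP[h1 h2] := expR_sub1_bounds (v - u).
have eu := expR_gt0 u; have ev := expR_gt0 v.
have E : expR v = expR (v - u) * expR u by rewrite -expRD subrK.
have h3 := ler_wpM2r (ltW eu) h1; have h4 := ler_wpM2r (ltW eu) h2.
rewrite [leRHS]mulrBl mul1r -E in h3; rewrite [leLHS]mulrBl mul1r -E -mulrA -E in h4.
rewrite ger0_norm; last by lra.
apply: (@le_trans _ _ ((v - u) * (expR v - expR u))); first by lra.
rewrite (le_trans (ler_norm _))// normrM.
apply: (@le_trans _ _ (`|v - u| * (`|v - u| * (expR u + expR v)))).
  by rewrite ler_wpM2l// expR_lipschitz.
by rewrite mulrA -expr2 real_normK ?num_real.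
Qed.

(** With the phase bounded by [5 * N ^ 2], the coefficients of the expanded increment [D] add up to
    less than 20. As [s <= 1 <= N], each monomial is at most [N ^ 3 * s]; those of [D - d] contain
    at least two increments and are at most [N ^ 3 * s ^ 2]. *)
Lemma theta_increment_poly (p q x y t h k l N s : R) : 1 <= N -> 0 <= s -> s <= 1 ->
  `|p| <= N -> `|q| <= N -> `|y| <= N -> `|t| <= N -> `|h| <= s -> `|k| <= s -> `|l| <= s ->
  let D := - 2 * q * (x + h) + 2 * q * phase p q (y + k) * (t + l) -
     (- 2 * q * x + 2 * q * phase p q y * t) in
  let d := - 2 * q * h + 2 * q * (p / 2 - y / 24) * t * k + 2 * q * phase p q y * l in
  `|D| <= 20 * N ^+ 3 * s /\ `|D - d| <= 20 * N ^+ 3 * s ^+ 2.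
Proof.
move=> N1 s0 s1 nP nQ ny nt hh hk hl D d.
have N0 : 0 <= N by lra.
have bM (u v A B : R) : `|u| <= A -> `|v| <= B -> `|u * v| <= A * B.
  by move=> *; rewrite normrM ler_pM.
have ph : `|phase p q y| <= 5 * (N * N).
  have := bM _ _ _ _ nQ nQ; have := bM _ _ _ _ nP nP; have := bM _ _ _ _ nP ny.
  have := bM _ _ _ _ ny ny; rewrite /phase !ler_norml; lra.
have pd : `|p / 2 - y / 24| <= N by move: nP ny; rewrite !ler_norml; lra.
have E : phase p q (y + k) = phase p q y + k * (p / 2 - y / 24) - k * k / 48.
  by rewrite /phase; field.
have eD : D = - 2 * (q * h) + 2 * (q * phase p q y * l) + 2 * (q * (p / 2 - y / 24) * t * k)
   + 2 * (q * (p / 2 - y / 24) * k * l) - (q * k * k * t + q * k * k * l) / 24.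
  by rewrite /D E; field.
have ed : D - d = 2 * (q * (p / 2 - y / 24) * k * l) - (q * k * k * t + q * k * k * l) / 24.
  by rewrite eD /d; field.
move: (phase p q y) (p / 2 - y / 24) ph pd eD ed => F G ph pd -> ->.
have b1 := bM _ _ _ _ nQ hh; have b2 := bM _ _ _ _ (bM _ _ _ _ nQ ph) hl.
have b3 := bM _ _ _ _ (bM _ _ _ _ (bM _ _ _ _ nQ pd) nt) hk.
have b4 := bM _ _ _ _ (bM _ _ _ _ (bM _ _ _ _ nQ pd) hk) hl.
have b5 := bM _ _ _ _ (bM _ _ _ _ (bM _ _ _ _ nQ hk) hk) nt.
have b6 := bM _ _ _ _ (bM _ _ _ _ (bM _ _ _ _ nQ hk) hk) hl.
have NN : N <= N * N by rewrite ler_peMl.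
have N3 : N * N <= N * N * N by rewrite ler_peMr ?mulr_ge0.
have ss : s * s <= s by rewrite ler_piMl.
have sss : s * s * s <= s * s by rewrite ler_piMr ?mulr_ge0.
have c1 : N * s <= N * N * N * s by rewrite ler_wpM2r//; lra.
have c2 : N * N * s * s <= N * N * N * s * s by rewrite -!mulrA !mulrA ler_wpM2r// ler_wpM2r.
have c3 : N * N * N * s * s <= N * N * N * s.
  by rewrite -(mulrA _ s s) ler_wpM2l ?mulr_ge0.
have c4 : N * s * s * s <= N * N * N * s * s.
  have -> : N * s * s * s = N * (s * s * s) by ring.
  have -> : N * N * N * s * s = (N * N * N) * (s * s) by ring.
  by rewrite ler_pM ?mulr_ge0//; lra.
move: b1 b2 b3 b4 b5 b6; rewrite !ler_norml !expr2 !exprS expr0; split; lra.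
Qed.

(* For moments u this is the integral of (alpha^n - (- conj alpha)^n) phi_i conj (phi_j): see
   moment_sylvester. *)
Definition sylv (u : nat -> nat -> R[i]) n i j : R[i] :=
  u (n + i)%N j - (-1) ^+ n * u i (n + j)%N
  + \sum_(k < n) (-1) ^+ k * u i k * u (n.-1 - k)%N j.

(* From q p = (i / 4) (alpha^2 - conj alpha^2), where alpha = - q + i p. *)
Definition quarter_i : R[i] := (0 +i* 4^-1)%C.

End CTaylor.

(** * The Marchenko operator and its resolvent *)

Section Spectral.
Context d (T : measurableType d) (R : realType).
Variable mu : {sigma_finite_measure set T -> \bar R}.
Variables (P Q : T -> R) (eps : R).
Hypothesis eps_gt0 : 0 < eps.
Hypothesis measP : measurable_fun setT P.
Hypothesis measQ : measurable_fun setT Q.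
Hypothesis Qeps : forall a, eps <= Q a.

Definition size1 a := Q a + `|P a|.
Local Notation G := size1.

Lemma G_gt0 a : 0 < G a.
Proof. by rewrite ltr_pwDl// (lt_le_trans eps_gt0). Qed.

Lemma measurable_G : measurable_fun setT G.
Proof. by apply: measurable_funD => //; exact: measurableT_comp. Qed.

(** All exponential moments are required so that every function of exponential growth, at whatever
    rate, is integrable against [w]. *)
Definition admissible (w : T -> R) :=
  [/\ measurable_fun setT w, forall a, 0 <= w a
    & forall c, mu.-integrable setT (EFin \o (fun a => w a * expR (c * G a)))].

Definition growth (u : T -> R) := exists C c, forall a, u a <= C * expR (c * G a).

(** The class does not refer to a weight, because one and the same function is integrated against
    several weights. *)
Definition tame (f : T -> R[i]) := cmeasurable setT f /\ growth (fun a => normc (f a)).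

Definition rtame (f : T -> R) := measurable_fun setT f /\ growth (fun a => `|f a|).

Lemma growth_le u v : (forall a, u a <= v a) -> growth v -> growth u.
Proof. by move=> uv [C [c h]]; exists C, c => a; rewrite (le_trans (uv a)). Qed.

Lemma growth_pos u : growth u ->
  exists C c, [/\ 0 <= C, 0 <= c & forall a, u a <= C * expR (c * G a)].
Proof.
move=> [C [c h]]; exists `|C|, `|c|; split => // a.
rewrite (le_trans (h a))// (le_trans (ler_wpM2r (expR_ge0 _) (ler_norm C)))//.
by rewrite ler_wpM2l// ler_expR ler_wpM2r ?ler_norm// ltW// G_gt0.
Qed.

Lemma growth_cst C : growth (fun=> C).
Proof. by exists C, 0 => a; rewrite mul0r expR0 mulr1. Qed.

Lemma growthD u v : growth u -> growth v -> growth (fun a => u a + v a).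
Proof.
move=> /growth_pos[C [c [C0 c0 h]]] /growth_pos[D [e [D0 e0 k]]].
exists (C + D), (c + e) => a; rewrite mulrDl lerD//.
  by rewrite (le_trans (h a))// ler_wpM2l// ler_expR mulrDl lerDl mulr_ge0// ltW// G_gt0.
by rewrite (le_trans (k a))// ler_wpM2l// ler_expR mulrDl lerDr mulr_ge0// ltW// G_gt0.
Qed.

Lemma growthM u v : (forall a, 0 <= u a) -> (forall a, 0 <= v a) ->
  growth u -> growth v -> growth (fun a => u a * v a).
Proof.
move=> u0 v0 [C [c h]] [D [e k]]; exists (C * D), (c + e) => a.
by rewrite mulrDl expRD mulrACA ler_pM.
Qed.

Lemma growth_G : growth G.
Proof.
exists 1, 1 => a; rewrite !mul1r (le_trans _ (expR_ge1Dx _))//.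
by rewrite lerDr.
Qed.

Lemma rtame_cst C : rtame (fun=> C).
Proof. by split; [exact: measurable_cst | exact: growth_cst]. Qed.

Lemma rtameD f g : rtame f -> rtame g -> rtame (fun a => f a + g a).
Proof.
move=> [mf gf] [mg gg]; split; first exact: measurable_funD.
by apply: growth_le (growthD gf gg) => a; exact: ler_normD.
Qed.

Lemma rtameM f g : rtame f -> rtame g -> rtame (fun a => f a * g a).
Proof.
move=> [mf gf] [mg gg]; split; first exact: measurable_funM.
apply: growth_le (growthM _ _ gf gg) => // a; exact: ler_normM || by rewrite normrM.
Qed.

Lemma rtameX f n : rtame f -> rtame (fun a => f a ^+ n).
Proof.
move=> tf; elim: n => [|n ih]; first exact: rtame_cst.
by under [X in rtame X]eq_fun do rewrite exprS; exact: rtameM.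
Qed.

Lemma tame_normc f : tame f -> rtame (fun a => normc (f a)).
Proof.
move=> [mf gf]; split; first exact: measurable_normc.
by apply: growth_le gf => a; rewrite ger0_norm ?normc_ge0.
Qed.

Lemma rtame_tame f : rtame f -> tame (fun a => (f a)%:C%C).
Proof.
move=> [mf gf]; split; first exact: cmeasurable_real.
by apply: growth_le gf => a; rewrite normc_real.
Qed.

Lemma rtame_P : rtame P.
Proof.
split => //; apply: growth_le growth_G => a.
by rewrite lerDr (le_trans (ltW eps_gt0)).
Qed.

Lemma rtame_Q : rtame Q.
Proof.
split => //; apply: growth_le growth_G => a.
by rewrite ger0_norm ?lerDl// (le_trans (ltW eps_gt0)).
Qed.

Lemma tame_cst C : tame (fun=> C).
Proof. by split; [exact: cmeasurable_cst | exact: growth_cst]. Qed.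

Lemma tameD f g : tame f -> tame g -> tame (fun a => f a + g a).
Proof.
move=> [mf gf] [mg gg]; split; first exact: cmeasurableD.
by apply: growth_le (growthD gf gg) => a; exact: le_normcD.
Qed.

Lemma tameN f : tame f -> tame (fun a => - f a).
Proof.
move=> [mf gf]; split; first exact: cmeasurableN.
by apply: growth_le gf => a; rewrite normcN.
Qed.

Lemma tameB f g : tame f -> tame g -> tame (fun a => f a - g a).
Proof. by move=> tf tg; apply: tameD => //; exact: tameN. Qed.

Lemma tameM f g : tame f -> tame g -> tame (fun a => f a * g a).
Proof.
move=> [mf gf] [mg gg]; split; first exact: cmeasurableM.
by apply: growth_le (growthM _ _ gf gg) => a; rewrite ?normcM ?normc_ge0.
Qed.

Lemma tameJ f : tame f -> tame (fun a => conjc (f a)).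
Proof.
move=> [mf gf]; split; first exact: cmeasurableJ.
by apply: growth_le gf => a; rewrite normc_conjc.
Qed.

Lemma tameX f n : tame f -> tame (fun a => f a ^+ n).
Proof.
move=> tf; elim: n => [|n ih]; first exact: tame_cst.
by under [X in tame X]eq_fun do rewrite exprS; exact: tameM.
Qed.

Lemma tame_bounded f M : cmeasurable setT f -> (forall a, normc (f a) <= M) -> tame f.
Proof.
by move=> mf h; split => //; apply: growth_le (growth_cst M).
Qed.

Definition alpha a : R[i] := (- Q a +i* P a)%C.

Lemma tame_alpha : tame alpha.
Proof.
split; first by split => //=; exact: measurableT_comp.
apply: growth_le growth_G => a.
by rewrite (le_trans (normc_le_ReIm _))//= normrN ger0_norm// (le_trans (ltW eps_gt0)).
Qed.

Definition kappa a c : R[i] := - (alpha a + conjc (alpha c))^-1.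

Lemma Re_alphaD a c : cRe (alpha a + conjc (alpha c)) <= - (2 * eps).
Proof. by rewrite ReD ReJ /=; have := Qeps a; have := Qeps c; lra. Qed.

Lemma alphaD_neq0 a c : alpha a + conjc (alpha c) != 0.
Proof.
apply/eqP => h; have := Re_alphaD a c; rewrite h /= => h'.
by have := eps_gt0; lra.
Qed.

Lemma alphaD_kappa a c : (alpha a + conjc (alpha c)) * kappa a c = -1.
Proof. by rewrite /kappa mulrN divff// alphaD_neq0. Qed.

(** Every [alpha] has real part at most [- eps]. This uniform bound makes [Kop] map integrable
    functions to bounded ones, which is how norm estimates become pointwise. *)
Lemma normc_kappa a c : normc (kappa a c) <= (2 * eps)^-1.
Proof.
rewrite /kappa normcN normcV lef_pV2 ?posrE.
- rewrite (le_trans _ (Re_le_normc _))//.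
  by have := Re_alphaD a c; have := eps_gt0; move=> ? ?; rewrite ler0_norm; lra.
- have := Re_le_normc (alpha a + conjc (alpha c)); apply: lt_le_trans.
  by rewrite normr_gt0; have := Re_alphaD a c; have := eps_gt0; move=> ? ?; apply/eqP; lra.
- by have := eps_gt0; lra.
Qed.

Lemma kappaJ a c : conjc (kappa a c) = kappa c a.
Proof.
rewrite /kappa rmorphN fmorphV; congr (- _^-1).
by apply: complex_ext; rewrite !ReImE; ring.
Qed.

Lemma cmeasurable_kappa :
  cmeasurable setT (fun z : T * T => kappa z.1 z.2).
Proof.
have mA i : measurable_fun setT (fun z : T * T => Q (if i then z.1 else z.2)).
  by case: i; apply: measurableT_comp.
have mB i : measurable_fun setT (fun z : T * T => P (if i then z.1 else z.2)).
  by case: i; apply: measurableT_comp.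
pose u (z : T * T) := Q z.1 + Q z.2; pose v (z : T * T) := P z.1 - P z.2.
have mu' : measurable_fun setT u by apply: measurable_funD; [exact: (mA true)|exact: (mA false)].
have mv : measurable_fun setT v by apply: measurable_funB; [exact: (mB true)|exact: (mB false)].
have u0 z : 0 < u z ^+ 2 + v z ^+ 2.
  rewrite ltr_pwDl ?sqr_ge0// exprn_gt0// /u.
  by have := Qeps z.1; have := Qeps z.2; have := eps_gt0; lra.
(* On positive reals the inverse is [expR (- ln _)], a composition of measurable functions. *)
pose r z := expR (- ln (u z ^+ 2 + v z ^+ 2)).
have rE z : r z = (u z ^+ 2 + v z ^+ 2)^-1 by rewrite /r expRN lnK ?posrE ?u0.
have mr : measurable_fun setT r.
  apply: measurableT_comp => //; apply: measurableT_comp => //; apply: measurableT_comp => //.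
  by apply: measurable_funD; exact: measurable_funX.
split.
  have -> : (fun z : T * T => cRe (kappa z.1 z.2)) = (fun z => u z * r z).
    apply/funext => z; rewrite rE /kappa /alpha /= /u /v; set D1 := (X in X^-1).
    have -> : D1 = (- Q z.1 - Q z.2) ^+ 2 + (P z.1 - P z.2) ^+ 2 by [].
    have -> : (- Q z.1 - Q z.2) ^+ 2 = (Q z.1 + Q z.2) ^+ 2 by ring.
    by ring.
  exact: measurable_funM.
have -> : (fun z : T * T => cIm (kappa z.1 z.2)) = (fun z => v z * r z).
  apply/funext => z; rewrite rE /kappa /alpha /= /u /v.
  have -> : (- Q z.1 - Q z.2) ^+ 2 = (Q z.1 + Q z.2) ^+ 2 by ring.
  by ring.
exact: measurable_funM.
Qed.

Section Weight.
Variable w : T -> R.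
Hypothesis hw : admissible w.

Definition cwint (f : T -> R[i]) : R[i] := cintegral mu setT (fun a => f a * (w a)%:C%C).
Definition rwint (f : T -> R) : R := Rintegral mu setT (fun a => f a * w a).

Lemma integrable_rtame f : rtame f ->
  mu.-integrable setT (EFin \o (fun a => f a * w a)).
Proof.
move=> [mf [C [c gf]]]; have [mw w0 iw] := hw.
apply: (@le_integrable _ _ _ _ _ measurableT _ (EFin \o (fun a => C * (w a * expR (c * G a))))).
- by apply/measurable_EFinP; exact: measurable_funM.
- move=> a _ /=; rewrite lee_fin normrM (le_trans _ (ler_norm _))//.
  by rewrite (ger0_norm (w0 a)) [X in _ <= _ * X]mulrC mulrA ler_wpM2r.
- exact: integrable_mulcl.
Qed.

Lemma cintegrable_tame f : tame f ->
  cintegrable mu setT (fun a => f a * (w a)%:C%C).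
Proof.
move=> tf; have [mw w0 iw] := hw.
apply: (cintegrable_le measurableT _ (integrable_rtame (tame_normc tf))).
  by apply: cmeasurableM; [have [] := tf | exact: cmeasurable_real].
by move=> a _; rewrite normcM normc_real ger0_norm.
Qed.

Lemma eq_cwint f g : f =1 g -> cwint f = cwint g.
Proof. by move=> fg; apply: eq_cintegral => a _; rewrite fg. Qed.

Lemma cwintD f g : tame f -> tame g -> cwint (fun a => f a + g a) = cwint f + cwint g.
Proof.
move=> tf tg; rewrite /cwint -cintegralD//; try exact: cintegrable_tame.
by apply: eq_cintegral => a _; rewrite mulrDl.
Qed.

Lemma cwintZ c f : tame f -> cwint (fun a => c * f a) = c * cwint f.
Proof.
move=> tf; rewrite /cwint -cintegralZ//; last exact: cintegrable_tame.
by apply: eq_cintegral => a _; rewrite mulrA.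
Qed.

Lemma cwintN f : tame f -> cwint (fun a => - f a) = - cwint f.
Proof.
move=> tf; rewrite -mulN1r -cwintZ//; by apply: eq_cwint => a; rewrite mulN1r.
Qed.

Lemma cwintB f g : tame f -> tame g -> cwint (fun a => f a - g a) = cwint f - cwint g.
Proof. by move=> tf tg; rewrite cwintD ?cwintN//; exact: tameN. Qed.

Lemma cwintJ f : tame f -> cwint (fun a => conjc (f a)) = conjc (cwint f).
Proof.
move=> tf; rewrite /cwint -cintegralJ//; last exact: cintegrable_tame.
by apply: eq_cintegral => a _; rewrite rmorphM /= oppr0.
Qed.

Lemma rwintD f g : rtame f -> rtame g -> rwint (fun a => f a + g a) = rwint f + rwint g.
Proof.
move=> tf tg; rewrite /rwint -RintegralD//; try exact: integrable_rtame.
by apply: eq_Rintegral => a _; rewrite mulrDl.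
Qed.

Lemma rwintZ c f : rtame f -> rwint (fun a => c * f a) = c * rwint f.
Proof.
move=> tf; rewrite /rwint -RintegralZl//; last exact: integrable_rtame.
by apply: eq_Rintegral => a _; rewrite mulrA.
Qed.

Lemma rwint_ge0 f : (forall a, 0 <= f a) -> 0 <= rwint f.
Proof. by move=> f0; apply: Rintegral_ge0 => a _; rewrite mulr_ge0//; case: hw. Qed.

Lemma le_rwint f g : rtame f -> rtame g -> (forall a, f a <= g a) -> rwint f <= rwint g.
Proof.
move=> tf tg fg; apply: le_Rintegral => //; try exact: integrable_rtame.
by move=> a _; rewrite ler_wpM2r//; case: hw.
Qed.

Lemma normc_cwint f : tame f -> normc (cwint f) <= rwint (fun a => normc (f a)).
Proof.
move=> tf; rewrite (le_trans (normc_cintegral _ (cintegrable_tame tf)))//.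
rewrite le_eqVlt; apply/orP; left; apply/eqP; apply: eq_Rintegral => a _.
by rewrite normcM normc_real ger0_norm//; case: hw.
Qed.

Lemma Re_cwint_real f : cRe (cwint (fun a => (f a)%:C%C)) = rwint f.
Proof. by apply: eq_Rintegral => a _; rewrite ReM /= mulr0 subr0. Qed.

(** The operator T. The weight enters as the measure of integration and [kappa] is the same for all
    weights, so two such operators differ by the difference of the weights alone. *)
Definition Kop (f : T -> R[i]) a : R[i] := cwint (fun c => kappa a c * f c).

Lemma tame_kappa a : tame (kappa a).
Proof.
apply: (tame_bounded (M := (2 * eps)^-1)); last exact: normc_kappa.
have [k1 k2] := cmeasurable_kappa.
by split; [exact: (measurableT_comp k1 (pair1_measurable a)) |
           exact: (measurableT_comp k2 (pair1_measurable a))].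
Qed.

Lemma normc_Kop f a : tame f ->
  normc (Kop f a) <= (2 * eps)^-1 * rwint (fun c => normc (f c)).
Proof.
move=> tf; rewrite (le_trans (normc_cwint _))//; first by apply: tameM => //; exact: tame_kappa.
rewrite -rwintZ; last exact: tame_normc.
apply: le_rwint.
- by apply: tame_normc; apply: tameM => //; exact: tame_kappa.
- by apply: rtameM; [exact: rtame_cst | exact: tame_normc].
- by move=> c; rewrite normcM ler_wpM2r ?normc_ge0// normc_kappa.
Qed.

Lemma cmeasurable_Kop f : tame f -> cmeasurable setT (Kop f).
Proof.
move=> [mf _]; rewrite /Kop /cwint.
apply: (cmeasurable_cintegral_snd mu (f := fun z : T * T => kappa z.1 z.2 * f z.2 * (w z.2)%:C%C)).
apply: cmeasurableM; first apply: cmeasurableM.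
- exact: cmeasurable_kappa.
- by have [f1 f2] := mf; split; [exact: (measurableT_comp f1 measurable_snd)|exact: (measurableT_comp f2 measurable_snd)].
- by apply: cmeasurable_real; apply: measurableT_comp => //; case: hw.
Qed.

Lemma tame_Kop f : tame f -> tame (Kop f).
Proof.
move=> tf; apply: (tame_bounded (cmeasurable_Kop tf)) => a; exact: normc_Kop.
Qed.

Lemma KopD f g a : tame f -> tame g -> Kop (fun c => f c + g c) a = Kop f a + Kop g a.
Proof.
move=> tf tg; rewrite /Kop -cwintD; first by apply: eq_cwint => c; rewrite mulrDr.
- by apply: tameM => //; exact: tame_kappa.
- by apply: tameM => //; exact: tame_kappa.
Qed.

Lemma KopZ u f a : tame f -> Kop (fun c => u * f c) a = u * Kop f a.
Proof.
move=> tf; rewrite /Kop -cwintZ; first by apply: eq_cwint => c; rewrite mulrCA.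
by apply: tameM => //; exact: tame_kappa.
Qed.

Lemma KopB f g a : tame f -> tame g -> Kop (fun c => f c - g c) a = Kop f a - Kop g a.
Proof.
move=> tf tg; rewrite -[- Kop g a]mulN1r -KopZ// -KopD//.
  by apply: eq_cwint => c; rewrite mulN1r.
by apply: tameM => //; exact: tame_cst.
Qed.

Lemma cwintJM f g : tame f -> tame g ->
  conjc (cwint (fun a => f a * g a)) = cwint (fun a => conjc (f a) * conjc (g a)).
Proof.
move=> tf tg; rewrite -cwintJ; last exact: tameM.
by apply: eq_cwint => a; rewrite conjM.
Qed.

(** * The Laplace-type transform and its adjoint *)

Definition wave (x : R) a (z : R) : R[i] := expc (alpha a * (z - x)%:C%C).

Arguments wave : simpl never.

Lemma normc_wave x a z : normc (wave x a z) = expR (- Q a * (z - x)).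
Proof. by rewrite normc_expc ReM /= mulr0 subr0. Qed.

Lemma normc_wave_le x a z : x <= z -> normc (wave x a z) <= expR (- eps * (z - x)).
Proof.
move=> xz; rewrite normc_wave ler_expR ler_wpM2r ?subr_ge0// lerN2; exact: Qeps.
Qed.

Lemma cmeasurable_wave2 x : cmeasurable setT (fun v : T * measurableTypeR R => wave x v.1 v.2).
Proof.
apply: cmeasurable_expc; apply: cmeasurableM.
  split => /=.
    by apply: measurableT_comp => //; exact: (measurableT_comp measQ measurable_fst).
  exact: (measurableT_comp measP measurable_fst).
by apply: cmeasurable_real; apply: measurable_funB => //; exact: measurable_snd.
Qed.

Lemma tame_wave x z : x <= z -> tame (fun a => wave x a z).
Proof.
move=> xz; apply: (tame_bounded (M := expR (- eps * (z - x)))).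
  have [k1 k2] := cmeasurable_wave2 x.
  split; [exact: (measurableT_comp k1 (pair2_measurable z)) |
          exact: (measurableT_comp k2 (pair2_measurable z))].
by move=> a; exact: normc_wave_le.
Qed.

Lemma cmeasurable_wave x a D : cmeasurable D (fun z : measurableTypeR R => wave x a z).
Proof.
have [k1 k2] := cmeasurable_wave2 x.
split; apply: measurable_funTS; [exact: (measurableT_comp k1 (pair1_measurable a)) |
          exact: (measurableT_comp k2 (pair1_measurable a))].
Qed.

Lemma indic_ray_in (x z : R) : x <= z -> \1_(`[x, +oo[%classic) z = 1 :> R.
Proof. by move=> xz; rewrite indicE mem_setE in_itv /= andbT xz. Qed.

Lemma indic_ray_out (x z : R) : ~~ (x <= z) -> \1_(`[x, +oo[%classic) z = 0 :> R.
Proof. by move=> xz; rewrite indicE mem_setE in_itv /= andbT (negbTE xz). Qed.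

Lemma mem_ray (x z : R) : z \in (`[x, +oo[%classic : set R) -> x <= z.
Proof. by rewrite inE /= in_itv /= andbT. Qed.

Lemma in_ray (x z : R) : (`[x, +oo[%classic : set R) z -> x <= z.
Proof. by rewrite /= in_itv /= andbT. Qed.

Local Notation leb := (@lebesgue_measure R).

(** The functions whose transform [Lap x] converges absolutely for every [a], since the waves are
    bounded by [expR (- eps * (z - x))]. The class contains L^2[x, oo) and the range of [hat]. *)
Definition decaying (x : R) (k : R -> R[i]) :=
  cmeasurable `[x, +oo[ (k : measurableTypeR R -> R[i]) /\
  leb.-integrable `[x, +oo[ (EFin \o (fun z => normc (k z) * expR (- eps * (z - x)))).

Definition Lap x (k : R -> R[i]) a : R[i] :=
  cintegral leb `[x, +oo[ (fun z => k z * wave x a z).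

(** Adjointness of [Lap] and [hat], stated without conjugates; the two conjugations are supplied by
    the uses. *)
Lemma Lap_fubini x k g : decaying x k -> tame g ->
  cwint (fun a => Lap x k a * g a) =
  cintegral leb `[x, +oo[ (fun z => k z * cwint (fun a => wave x a z * g a)).
Proof.
move=> [mk ik] tg; have [mg _] := tg; have [mw w0 _] := hw.
pose F (v : T * measurableTypeR R) : R[i] :=
  ((\1_(`[x, +oo[%classic) v.2)%:C%C * k v.2) * (wave x v.1 v.2 * (g v.1 * (w v.1)%:C%C)).
have mI : measurable (`[x, +oo[%classic : set (measurableTypeR R)) by exact: measurable_itv.
have mk' := cmeasurable_indic_mul mI mk.
have mF : cmeasurable setT F.
  apply: cmeasurableM.
    by have [k1 k2] := mk'; split; [exact: (measurableT_comp k1 measurable_snd)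
                           |exact: (measurableT_comp k2 measurable_snd)].
  apply: cmeasurableM; first exact: cmeasurable_wave2.
  apply: cmeasurableM.
    by have [k1 k2] := mg; split; [exact: (measurableT_comp k1 measurable_fst)
                           |exact: (measurableT_comp k2 measurable_fst)].
  apply: cmeasurable_real; exact: (measurableT_comp mw measurable_fst).
transitivity (cintegral mu setT (fun a => cintegral leb setT (fun z => F (a, z)))).
  apply: eq_cintegral => a _; rewrite /Lap -mulrA mulrC -cintegralZ//; last first.
    apply: (cintegrable_le mI _ ik).
      by apply: cmeasurableM => //; exact: cmeasurable_wave.
    move=> z /in_ray xz.
    by rewrite normcM ler_wpM2l ?normc_ge0// normc_wave_le.
  rewrite [LHS]cintegral_indic_mul; apply: eq_cintegral => z _; rewrite /F /=; ring.
rewrite (cfubini (f := F) (u := fun a => normc (g a) * w a)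
   (v := fun z => \1_(`[x, +oo[%classic) z * (normc (k z) * expR (- eps * (z - x)))))//; first last.
- have gen (p q r s u : R[i]) : normc (p * q * (r * (s * u))) =
      normc p * normc q * (normc r * (normc s * normc u)) by rewrite !normcM.
  move=> a z; rewrite /F gen !normc_real (ger0_norm (w0 a)).
  case: (boolP (x <= z)) => xz; rewrite ?(indic_ray_in xz) ?(indic_ray_out xz).
    rewrite normr1 !mul1r [leRHS]mulrC -mulrA ler_wpM2l ?normc_ge0//.
    by rewrite ler_wpM2r ?mulr_ge0 ?normc_ge0// normc_wave_le.
  by rewrite normr0 !mul0r mulr0.
- exact: integrable_indic_mul.
- by apply: integrable_rtame; exact: tame_normc.
rewrite [RHS]cintegral_indic_mul; apply: eq_cintegral => z _.
case: (boolP (x <= z)) => xz; rewrite ?(indic_ray_in xz) ?(indic_ray_out xz).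
  rewrite mul1r /cwint -cintegralZ//.
    apply: eq_cintegral => a _; rewrite /F /= indic_ray_in//; ring.
  by apply: cintegrable_tame; apply: tameM => //; exact: tame_wave.
rewrite mul0r /F; under eq_cintegral => a _ do rewrite indic_ray_out// !mul0r.
by apply: complex_ext => /=; rewrite /Rintegral integral0.
Qed.

(** The adjoint of [Lap x], given as a value at every [z] and not as an L^2 class. *)
Definition hat x (g : T -> R[i]) (z : R) : R[i] := cwint (fun a => g a * conjc (wave x a z)).

Lemma cmeasurable_hat x g D : tame g -> measurable D ->
  cmeasurable D (hat x g : measurableTypeR R -> R[i]).
Proof.
move=> [mg _] mD; have [mw w0 _] := hw.
suff [h1 h2] : cmeasurable setT (hat x g : measurableTypeR R -> R[i]).
  by split; apply: measurable_funTS.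
apply: (cmeasurable_cintegral_fst mu
   (f := fun v : T * measurableTypeR R => g v.1 * conjc (wave x v.1 v.2) * (w v.1)%:C%C)).
apply: cmeasurableM; first apply: cmeasurableM.
- by have [k1 k2] := mg; split; [exact: (measurableT_comp k1 measurable_fst)
                           |exact: (measurableT_comp k2 measurable_fst)].
- by apply: cmeasurableJ; exact: cmeasurable_wave2.
- apply: cmeasurable_real; exact: (measurableT_comp mw measurable_fst).
Qed.

Lemma normc_hat x g z : tame g -> x <= z ->
  normc (hat x g z) <= expR (- eps * (z - x)) * rwint (fun a => normc (g a)).
Proof.
move=> tg xz; have te := tameJ (tame_wave xz).
rewrite (le_trans (normc_cwint _))//; first exact: tameM.
rewrite -rwintZ; last exact: tame_normc.
apply: le_rwint.
- by apply: tame_normc; exact: tameM.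
- by apply: rtameM; [exact: rtame_cst|exact: tame_normc].
- by move=> a; rewrite normcM normc_conjc mulrC ler_wpM2r ?normc_ge0// normc_wave_le.
Qed.

Lemma integrable_expR2 (x C : R) : leb.-integrable `[x, +oo[
  (EFin \o (fun z => C * expR (- eps * (z - x)) * expR (- eps * (z - x)))).
Proof.
have e2 : 0 < 2 * eps by have := eps_gt0; lra.
have [h _] := integral_expR_decay x e2.
have -> : (fun z => C * expR (- eps * (z - x)) * expR (- eps * (z - x))) =
   (fun z => C * expR (- (2 * eps) * (z - x))).
  by apply/funext => z; rewrite -mulrA -expRD; congr (_ * expR _); ring.
exact: integrable_mulcl.
Qed.

Lemma decaying_le (x : R) (k : R -> R[i]) (C : R) : cmeasurable `[x, +oo[ (k : measurableTypeR R -> R[i]) ->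
  (forall z, x <= z -> normc (k z) <= C * expR (- eps * (z - x))) -> decaying x k.
Proof.
move=> mk h; split => //.
apply: le_integrable (integrable_expR2 x C) => //.
  apply/measurable_EFinP; apply: measurable_funM; first exact: measurable_normc.
  apply: measurable_funTS; apply: continuous_measurable_fun => z.
  by apply: differentiable_continuous; apply/derivable1_diffP; apply: ex_derive.
move=> z /in_ray xz /=; rewrite lee_fin.
rewrite ger0_norm ?mulr_ge0 ?normc_ge0 ?expR_ge0// (le_trans _ (ler_norm _))//.
by rewrite ler_wpM2r ?expR_ge0// h.
Qed.

Lemma decaying_hat x g : tame g -> decaying x (hat x g).
Proof.
move=> tg; apply: (@decaying_le _ _ (rwint (fun a => normc (g a)))).
  exact: cmeasurable_hat.
by move=> z xz; rewrite mulrC normc_hat.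
Qed.

Lemma decaying_waveJ x a : decaying x (fun z => conjc (wave x a z)).
Proof.
apply: (@decaying_le _ _ 1).
  by apply: cmeasurableJ; exact: cmeasurable_wave.
by move=> z xz; rewrite mul1r normc_conjc normc_wave_le.
Qed.

(** [kappa] is the Gram kernel of the waves on the half-line; this is the origin of the factor
    [- (alpha a + conjc (alpha c))^-1]. *)
Lemma Lap_waveJ x a c : Lap x (fun z => conjc (wave x a z)) c = kappa c a.
Proof.
rewrite /kappa -(cintegral_expc x); last first.
  by apply: le_lt_trans (Re_alphaD c a) _; rewrite oppr_lt0; have := eps_gt0; lra.
apply: eq_cintegral => z _; rewrite /wave conjc_expc -expcD; congr expc.
by apply: complex_ext; rewrite !ReImE /=; ring.
Qed.

(** The factorisation T = L L*: [Lap_fubini] with the conjugate wave at [a] as [k], then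
    conjugated. *)
Lemma Lap_hat x f a : tame f -> Lap x (hat x f) a = Kop f a.
Proof.
move=> tf; have tfJ := tameJ tf.
have := Lap_fubini (decaying_waveJ x a) tfJ.
have -> : cwint (fun c => Lap x (fun z => conjc (wave x a z)) c * conjc (f c)) = conjc (Kop f a).
  rewrite /Kop cwintJM//; last exact: tame_kappa.
  by apply: eq_cwint => c; rewrite Lap_waveJ kappaJ.
move=> /(congr1 conjc); rewrite conjcK => ->.
rewrite /Lap -cintegralJ//.
  apply: eq_cintegral => z /mem_ray xz.
  rewrite conjM conjcK mulrC; congr (_ * _).
  rewrite cwintJM//; last exact: tame_wave.
  by apply: eq_cwint => c; rewrite conjcK mulrC.
have dh := decaying_hat x tf.
have [mh ih] := dh.
apply: (cintegrable_le _ _ ih) => //.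
  apply: (eq_cmeasurable (f := fun z => conjc (wave x a z) * conjc (hat x f z))).
    move=> z /mem_ray xz; congr (_ * _).
    rewrite cwintJM//; last by apply: tameJ; exact: tame_wave.
    by apply: eq_cwint => c; rewrite conjcK mulrC.
  by apply: cmeasurableM; apply: cmeasurableJ => //; exact: cmeasurable_wave.
move=> z /in_ray xz.
rewrite normcM normc_conjc mulrC ler_pM ?normc_ge0//; last exact: normc_wave_le.
rewrite le_eqVlt -normc_conjc cwintJM//; last exact: tame_wave.
by apply/orP; left; apply/eqP; congr normc; apply: eq_cwint => c; rewrite conjcK mulrC.
Qed.

(** * Positivity of the operator and a priori bounds *)

Definition ip f g := cwint (fun a => f a * conjc (g a)).

(** Symmetry and positivity of [Kop] are read off from this L^2 pairing on the half-line. The base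
    point [x] is free, since [Kop] does not depend on it; the uses below take [0]. *)
Lemma ip_Kop_hat x f g : tame f -> tame g ->
  ip (Kop f) g = cintegral leb `[x, +oo[ (fun z => hat x f z * conjc (hat x g z)).
Proof.
move=> tf tg; rewrite /ip.
under eq_cwint => a do rewrite -(Lap_hat x)//.
rewrite (Lap_fubini (decaying_hat x tf) (tameJ tg)).
apply: eq_cintegral => z /mem_ray xz; congr (_ * _).
rewrite /hat cwintJM//; last by apply: tameJ; exact: tame_wave.
by apply: eq_cwint => c; rewrite conjcK mulrC.
Qed.

Lemma ipJ f g : tame f -> tame g -> ip g f = conjc (ip f g).
Proof.
move=> tf tg; rewrite /ip cwintJM//; last exact: tameJ.
by apply: eq_cwint => a; rewrite conjcK mulrC.
Qed.

Lemma Kop_sym f g : tame f -> tame g -> ip (Kop f) g = ip f (Kop g).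
Proof.
move=> tf tg; rewrite (ipJ (tame_Kop tg) tf) !(ip_Kop_hat 0)//.
have [mf _] := decaying_hat 0 tf; have [mg _] := decaying_hat 0 tg.
rewrite -cintegralJ//.
  by apply: eq_cintegral => z _; rewrite conjM conjcK mulrC.
have h := integrable_expR2 0 (rwint (fun a => normc (g a)) * rwint (fun a => normc (f a))).
apply: (cintegrable_le _ _ h) => //.
  by apply: cmeasurableM => //; exact: cmeasurableJ.
move=> z /in_ray xz.
rewrite normcM normc_conjc (le_trans (ler_pM _ _ (normc_hat tg xz) (normc_hat tf xz)))//; try exact: normc_ge0.
by rewrite le_eqVlt; apply/orP; left; apply/eqP; ring.
Qed.

Lemma Kop_ge0 f : tame f -> 0 <= cRe (ip (Kop f) f).
Proof.
move=> tf; rewrite (ip_Kop_hat 0)//; apply: Rintegral_ge0 => z _.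
by rewrite mulcJ /= sqr_ge0.
Qed.

Definition sqnorm f := rwint (fun a => normc (f a) ^+ 2).

Lemma rtame_sq f : tame f -> rtame (fun a => normc (f a) ^+ 2).
Proof. by move=> tf; apply: rtameX; exact: tame_normc. Qed.

Lemma sqnorm_ge0 f : 0 <= sqnorm f.
Proof. by apply: rwint_ge0 => a; exact: sqr_ge0. Qed.

Definition mass := rwint (fun=> 1).

Lemma mass_ge0 : 0 <= mass. Proof. exact: rwint_ge0. Qed.

Lemma ip_diag f : tame f -> cRe (ip f f) = sqnorm f.
Proof.
move=> tf; rewrite /sqnorm -Re_cwint_real; congr cRe.
by apply: eq_cwint => a; rewrite mulcJ.
Qed.

Lemma ipDl f g h : tame f -> tame g -> tame h ->
  ip (fun a => f a + g a) h = ip f h + ip g h.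
Proof.
move=> tf tg th; rewrite /ip -cwintD; try by apply: tameM => //; exact: tameJ.
by apply: eq_cwint => a; rewrite mulrDl.
Qed.

Lemma ipDr f g h : tame f -> tame g -> tame h ->
  ip h (fun a => f a + g a) = ip h f + ip h g.
Proof.
move=> tf tg th; rewrite /ip -cwintD; try by apply: tameM => //; exact: tameJ.
by apply: eq_cwint => a; rewrite rmorphD mulrDr.
Qed.

Lemma ipZl c f h : tame f -> tame h -> ip (fun a => c * f a) h = c * ip f h.
Proof.
move=> tf th; rewrite /ip -cwintZ; last by apply: tameM => //; exact: tameJ.
by apply: eq_cwint => a; rewrite mulrA.
Qed.

Lemma ipZr c f h : tame f -> tame h -> ip h (fun a => c * f a) = conjc c * ip h f.
Proof.
move=> tf th; rewrite /ip -cwintZ; last by apply: tameM => //; exact: tameJ.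
by apply: eq_cwint => a; rewrite conjM mulrCA.
Qed.

Lemma Re_ip_le f g : tame f -> tame g -> cRe (ip f g) <= (sqnorm f + sqnorm g) / 2.
Proof.
move=> tf tg; rewrite (le_trans (ler_norm _))// (le_trans (Re_le_normc _))//.
have tfg : tame (fun a => f a * conjc (g a)) by apply: tameM => //; exact: tameJ.
rewrite (le_trans (normc_cwint tfg))// mulrC /sqnorm -rwintD; try exact: rtame_sq.
rewrite -rwintZ; last by apply: rtameD; exact: rtame_sq.
apply: le_rwint.
- exact: tame_normc.
- by apply: rtameM; [exact: rtame_cst | apply: rtameD; exact: rtame_sq].
- move=> a; rewrite normcM normc_conjc.
  by have := sqr_ge0 (normc (f a) - normc (g a)); lra.
Qed.

(* Pairing with f: the operator is nonnegative, so ||f||^2 <= Re <b, f>. *)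
Lemma resolvent_sqnorm f b : tame f -> tame b ->
  (forall a, f a + Kop f a = b a) -> sqnorm f <= sqnorm b.
Proof.
move=> tf tb fb.
have : cRe (ip b f) = sqnorm f + cRe (ip (Kop f) f).
  rewrite -ip_diag// -ReD -ipDl//; last exact: tame_Kop.
  by congr cRe; apply: eq_cwint => a; rewrite -fb.
have := Re_ip_le tb tf; have := Kop_ge0 tf; lra.
Qed.

(** The pointwise inequality [|f| <= s / 2 + |f| ^ 2 / (2 * s)] does the work of Cauchy-Schwarz;
    each use chooses its own [s]. *)
Lemma rwint_normc_le f s : tame f -> 0 < s ->
  rwint (fun a => normc (f a)) <= (s * mass + sqnorm f / s) / 2.
Proof.
move=> tf s0; have r1 : rtame (fun=> 1) by exact: rtame_cst.
have rs := rtame_sq tf.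
have -> : (s * mass + sqnorm f / s) / 2 =
    rwint (fun a => (s / 2) * 1 + (2 * s)^-1 * normc (f a) ^+ 2).
  rewrite rwintD ?rwintZ//; try by apply: rtameM => //; exact: rtame_cst.
  by rewrite /mass /sqnorm; field; rewrite gt_eqF.
apply: le_rwint.
- exact: tame_normc.
- by apply: rtameD; apply: rtameM => //; exact: rtame_cst.
- move=> a; rewrite -subr_ge0.
  have -> : s / 2 * 1 + (2 * s)^-1 * normc (f a) ^+ 2 - normc (f a) =
    (2 * s)^-1 * (normc (f a) - s) ^+ 2 by field; rewrite gt_eqF.
  by rewrite mulr_ge0 ?sqr_ge0// invr_ge0; lra.
Qed.

(** In [f = b - Kop f] the last term is bounded at each point by the integral of [|f|], hence by the
    norm of [f], hence by that of [b]. *)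
Lemma resolvent_le f b a : tame f -> tame b ->
  (forall a, f a + Kop f a = b a) ->
  normc (f a) <= normc (b a) + (2 * eps)^-1 * ((mass + sqnorm b) / 2).
Proof.
move=> tf tb fb.
have -> : f a = b a - Kop f a by rewrite -fb addrK.
rewrite (le_trans (le_normcD _ _))// normcN lerD2l.
rewrite (le_trans (normc_Kop a tf))// ler_wpM2l//.
  by rewrite invr_ge0; have := eps_gt0; lra.
rewrite (le_trans (rwint_normc_le tf ltr01))// mul1r divr1.
by have := resolvent_sqnorm tf tb fb; lra.
Qed.

(** The bound is linear in the size [s] of the right-hand side, which [resolvent_le] does not give;
    this is what a Lipschitz estimate requires. Linearity comes from [rwint_normc_le] with this very
    [s]. *)
Lemma resolvent_le_sup f b (s : R) : tame f -> tame b -> 0 < s ->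
  (forall a, f a + Kop f a = b a) -> (forall a, normc (b a) <= s) ->
  rwint (fun a => normc (f a)) <= s * mass /\
  forall a, normc (f a) <= s * (1 + (2 * eps)^-1 * mass).
Proof.
move=> tf tb s0 fb bs.
have e0 : 0 <= (2 * eps)^-1 by rewrite invr_ge0; have := eps_gt0; lra.
have h : sqnorm b <= s ^+ 2 * mass.
  rewrite /mass -rwintZ; last exact: rtame_cst.
  apply: le_rwint; first exact: rtame_sq.
    by apply: rtameM; exact: rtame_cst.
  by move=> a; rewrite mulr1 ler_pXn2r// ?nnegrE ?normc_ge0// ltW.
have hJ : rwint (fun a => normc (f a)) <= s * mass.
  rewrite (le_trans (rwint_normc_le tf s0))//.
  have := resolvent_sqnorm tf tb fb => h2.
  have : sqnorm f / s <= s * mass.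
    by rewrite ler_pdivrMr// mulrAC -expr2 (le_trans h2).
  lra.
split => // a.
have -> : f a = b a - Kop f a by rewrite -fb addrK.
rewrite (le_trans (le_normcD _ _))// normcN mulrDr mulr1 lerD//.
by rewrite (le_trans (normc_Kop a tf))// mulrCA ler_wpM2l.
Qed.

(** The right-hand side [0] is bounded by every [s > 0], so [f] vanishes at every point, including
    points of zero weight. *)
Lemma resolvent_eq0 f : tame f -> (forall a, f a + Kop f a = 0) -> forall a, f a = 0.
Proof.
move=> tf f0 a; apply: eq0_normc; apply/eqP; rewrite eq_le normc_ge0 andbT.
have K0 : 0 < 1 + (2 * eps)^-1 * mass.
  by rewrite ltr_pwDl// mulr_ge0 ?mass_ge0// invr_ge0; have := eps_gt0; lra.
apply/ler_addgt0Pr => e e0; rewrite add0r.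
have s0 : 0 < e / (1 + (2 * eps)^-1 * mass) by rewrite divr_gt0.
have [|_ h] := @resolvent_le_sup f (fun=> 0) _ tf (tame_cst 0) s0 f0.
  by move=> c; rewrite normc0 ltW.
by have := h a; rewrite divfK// gt_eqF.
Qed.

(** Cauchy-Schwarz, from [rwint_normc_le] with [s = j / (mass + 1)]; the [+ 1] avoids division by a
    mass that may be zero. *)
Lemma sqr_rwint_normc_le f : tame f ->
  rwint (fun a => normc (f a)) ^+ 2 <= (mass + 1) * sqnorm f.
Proof.
move=> tf; set j := rwint _; have m0 := mass_ge0.
have [->|j0] := eqVneq j 0.
  by rewrite expr0n /= mulr_ge0 ?sqnorm_ge0// addr_ge0.
have jp : 0 < j by rewrite lt_neqAle eq_sym j0 rwint_ge0// => a; exact: normc_ge0.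
have M0 : 0 < mass + 1 by rewrite ltr_wpDl.
have s0 : 0 < j / (mass + 1) by rewrite divr_gt0.
have := rwint_normc_le tf s0; rewrite -/j => h.
have h2 : j * (mass / (mass + 1)) <= j.
  by rewrite ler_piMr ?(ltW jp)// ler_pdivrMr// mul1r lerDl.
have h3 : j <= sqnorm f * (mass + 1) / j.
  have e1 : sqnorm f / (j / (mass + 1)) = sqnorm f * (mass + 1) / j.
    by field; rewrite !gt_eqF.
  have e2 : j / (mass + 1) * mass = j * (mass / (mass + 1)) by rewrite mulrAC mulrA.
  by move: h; rewrite e1 e2; lra.
by move: h3; rewrite ler_pdivlMr// -expr2 mulrC.
Qed.

Lemma sqnorm_Kop_le f : tame f ->
  sqnorm (Kop f) <= ((2 * eps)^-1 * (mass + 1)) ^+ 2 * sqnorm f.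
Proof.
move=> tf; have m0 := mass_ge0.
have e0 : 0 <= (2 * eps)^-1 by rewrite invr_ge0; have := eps_gt0; lra.
have h : sqnorm (Kop f) <= ((2 * eps)^-1 * rwint (fun c => normc (f c))) ^+ 2 * mass.
  rewrite /mass -rwintZ; last exact: rtame_cst.
  apply: le_rwint; first by apply: rtame_sq; exact: tame_Kop.
    by apply: rtameM; exact: rtame_cst.
  move=> a; have hb := normc_Kop a tf; rewrite mulr1.
  apply: lerXn2r => //; rewrite nnegrE ?normc_ge0//.
  exact: le_trans (normc_ge0 _) hb.
have h2 := ler_wpM2r m0 (sqr_rwint_normc_le tf).
have h3 : (mass + 1) * sqnorm f * mass <= (mass + 1) ^+ 2 * sqnorm f.
  rewrite -subr_ge0; have -> : (mass + 1) ^+ 2 * sqnorm f - (mass + 1) * sqnorm f * mass =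
    (mass + 1) * sqnorm f by ring.
  by rewrite mulr_ge0 ?addr_ge0 ?sqnorm_ge0.
rewrite (le_trans h)// !exprMn -mulrA -[X in _ <= X]mulrA.
by rewrite ler_wpM2l ?sqr_ge0// (le_trans h2 h3).
Qed.

(** * Existence by Richardson iteration *)

Section Richardson.
(** [B2] bounds the squared norm of [Kop]. The step [c] is chosen so that [c * B2 = 1 - c], which
    gives [(1 - c) ^ 2 + c ^ 2 * B2 = 1 - c < 1]. *)
Let B2 := ((2 * eps)^-1 * (mass + 1)) ^+ 2.
Let c := (1 + B2)^-1.

Let B2_gt0 : 0 < B2.
Proof.
rewrite exprn_gt0// mulr_gt0 ?invr_gt0//; first by have := eps_gt0; lra.
by rewrite ltr_wpDl ?mass_ge0.
Qed.

Let c_gt0 : 0 < c. Proof. by rewrite invr_gt0 addr_gt0. Qed.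

Let c_lt1 : c < 1. Proof. by rewrite invf_lt1 ?addr_gt0// ltrDl. Qed.

Definition relax f a : R[i] := (1 - c)%:C%C * f a - c%:C%C * Kop f a.

Lemma tame_relax f : tame f -> tame (relax f).
Proof.
move=> tf; apply: tameB; apply: tameM => //; try exact: tame_cst; exact: tame_Kop.
Qed.

(** In the expanded square the cross term has a favourable sign by [Kop_ge0], and the choice of [c]
    adds the other two terms up to [1 - c]. *)
Lemma sqnorm_relax f : tame f -> sqnorm (relax f) <= (1 - c) * sqnorm f.
Proof.
move=> tf; have tT := tame_Kop tf.
have E : sqnorm (relax f) = (1 - c) ^+ 2 * sqnorm f + c ^+ 2 * sqnorm (Kop f)
    + (- (2 * c * (1 - c))) * cRe (ip (Kop f) f).
  have -> : cRe (ip (Kop f) f) = rwint (fun a => cRe (Kop f a * conjc (f a))).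
    by apply: eq_Rintegral => a _; rewrite ReMr.
  have r1 : rtame (fun a => cRe (Kop f a * conjc (f a))).
    have [[m1 _] g] : tame (fun a => Kop f a * conjc (f a)) by apply: tameM => //; exact: tameJ.
    by split => //; apply: growth_le g => a; exact: Re_le_normc.
  have rs := rtame_sq tf; have rT := rtame_sq tT.
  rewrite /sqnorm -!rwintZ// -!rwintD//; try by [apply: rtameM => //; exact: rtame_cst
      | apply: rtameD; apply: rtameM => //; exact: rtame_cst].
  apply: eq_Rintegral => a _; congr (_ * _).
  by rewrite !normcE2 /relax !ReImE /=; ring.
rewrite E.
have h1 := sqnorm_Kop_le tf; rewrite -/B2 in h1.
have h2 : 0 <= 2 * c * (1 - c) * cRe (ip (Kop f) f).
  by rewrite mulr_ge0 ?Kop_ge0// mulr_ge0 ?subr_ge0 ?(ltW c_lt1)// mulr_ge0// ltW.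
have h3 : c ^+ 2 * sqnorm (Kop f) <= c ^+ 2 * (B2 * sqnorm f).
  by rewrite ler_wpM2l ?sqr_ge0.
have h4 : (1 - c) ^+ 2 * sqnorm f + c ^+ 2 * (B2 * sqnorm f) = (1 - c) * sqnorm f.
  have e : c * B2 = 1 - c.
    by rewrite /c; field; rewrite gt_eqF// addr_gt0.
  transitivity (((1 - c) ^+ 2 + c * (c * B2)) * sqnorm f); first by ring.
  by rewrite e; ring.
by rewrite mulNr; lra.
Qed.

Let r := Num.sqrt (1 - c).

Let r2 : r ^+ 2 = 1 - c. Proof. by rewrite sqr_sqrtr// subr_ge0 ltW. Qed.

Let r_gt0 : 0 < r. Proof. by rewrite sqrtr_gt0 subr_gt0. Qed.

Let r_lt1 : r < 1.
Proof.
rewrite -(@ltr_pXn2r _ 2)// ?nnegrE ?(ltW r_gt0)// r2 expr1n.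
by rewrite ltrBlDr ltrDl.
Qed.

Lemma iter_relax_bound b : tame b -> (exists M, forall a, normc (b a) <= M) ->
  exists C, [/\ 0 <= C, forall n, tame (iter n relax b)
    & forall n a, normc (iter n relax b a) <= C * r ^+ n].
Proof.
move=> tb [M bM].
have tn n : tame (iter n relax b).
  by elim: n => //= n ih; exact: tame_relax.
have e0 : 0 <= (2 * eps)^-1 by rewrite invr_ge0; have := eps_gt0; lra.
have sn n : sqnorm (iter n relax b) <= (r ^+ n) ^+ 2 * sqnorm b.
  elim: n => [|n ih] /=; first by rewrite expr0 expr1n mul1r.
  rewrite (le_trans (sqnorm_relax (tn n)))// -r2 [r ^+ n.+1]exprS exprMn -(mulrA (r ^+ 2)).
  by rewrite ler_wpM2l ?sqr_ge0.
have Jn n : rwint (fun a => normc (iter n relax b a)) <= r ^+ n * ((mass + sqnorm b) / 2).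
  have p := exprn_gt0 n r_gt0.
  rewrite (le_trans (rwint_normc_le (tn n) p))//.
  have : sqnorm (iter n relax b) / r ^+ n <= r ^+ n * sqnorm b.
    by rewrite ler_pdivrMr// mulrAC -expr2.
  lra.
pose K := (mass + sqnorm b) / 2.
have K0 : 0 <= K by rewrite divr_ge0// addr_ge0 ?mass_ge0 ?sqnorm_ge0.
(* Solves [(1 - c) * C + c * (2 * eps)^-1 * K <= C * r] with [1 - c = r ^ 2], which is the induction
   step; [|M|] covers its start. *)
pose C := `|M| + c * (2 * eps)^-1 * K / (r * (1 - r)).
have rr : 0 < r * (1 - r) by rewrite mulr_gt0// subr_gt0.
have C0 : 0 <= C.
  by rewrite addr_ge0// divr_ge0// ?(ltW rr)// mulr_ge0// mulr_ge0// ltW.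
exists C; split => // n a; elim: n a => [|n ih] a.
  rewrite expr0 mulr1 (le_trans (bM a))// (le_trans (ler_norm _))// lerDl.
  by rewrite divr_ge0// ?(ltW rr)// mulr_ge0// mulr_ge0// ltW.
rewrite iterS {1}/relax (le_trans (le_normcD _ _))// normcN !normcM !normc_real.
rewrite ger0_norm ?subr_ge0 ?(ltW c_lt1)// (ger0_norm (ltW c_gt0)).
have h1 : c * normc (Kop (iter n relax b) a) <= c * ((2 * eps)^-1 * (r ^+ n * K)).
  rewrite ler_wpM2l ?(ltW c_gt0)// (le_trans (normc_Kop a (tn n)))//.
  by rewrite ler_wpM2l.
have h2 : (1 - c) * normc (iter n relax b a) <= (1 - c) * (C * r ^+ n).
  by rewrite ler_wpM2l ?ih// subr_ge0 ltW.
have h3 : (1 - c) * C + c * (2 * eps)^-1 * K <= C * r.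
  rewrite -r2 -lerBrDl.
  have -> : C * r - r ^+ 2 * C = C * (r * (1 - r)) by ring.
  rewrite {1}/C (mulrDl `|M|) divfK ?gt_eqF// lerDr.
  by rewrite mulr_ge0// ltW.
have := ler_wpM2r (exprn_ge0 n (ltW r_gt0)) h3; rewrite exprS; lra.
Qed.

End Richardson.

(* relax = 1 - c (1 + Kop) contracts sqnorm, so c times the sum of its iterates inverts 1 + Kop. *)
Lemma resolvent_exists_bounded b : tame b -> (exists M, forall a, normc (b a) <= M) ->
  exists2 f, tame f & forall a, f a + Kop f a = b a.
Proof.
move=> tb bM; have [C [C0 tn hn]] := iter_relax_bound tb bM.
set B2 := ((2 * eps)^-1 * (mass + 1)) ^+ 2 in hn.
set c := (1 + B2)^-1 in hn; set r := Num.sqrt _ in hn.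
have B2_ge0 : 0 < B2.
  rewrite exprn_gt0// mulr_gt0 ?invr_gt0//; first by have := eps_gt0; lra.
  by rewrite ltr_wpDl ?mass_ge0.
have c0 : 0 < c by rewrite invr_gt0 addr_gt0.
have c1 : c < 1 by rewrite invf_lt1 ?addr_gt0// ltrDl.
have r01 : 0 <= r < 1.
  rewrite sqrtr_ge0/= -(@ltr_pXn2r _ 2)// ?nnegrE ?sqrtr_ge0// sqr_sqrtr ?subr_ge0 ?(ltW c1)//.
  by rewrite expr1n ltrBlDr ltrDl.
have [G0 mG hG] := cgeometric_limit r01 C0 (fun n => (tn n).1) hn.
pose s N a := \sum_(0 <= n < N) iter n relax b a.
have ts N : tame (s N).
  elim: N => [|N ih].
    by rewrite /s; under eq_fun do rewrite big_nil; exact: tame_cst.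
  rewrite /s; under [X in tame X]eq_fun do rewrite big_nat_recr//=.
  by apply: tameD.
have tG : tame G0.
  apply: (tame_bounded (M := 2 * C / (1 - r))) => // a.
  by have := hG 0%N a; rewrite big_nil subr0 expr0 mulr1.
(* The partial sums telescope, and the residual of the equation is the next iterate. *)
have sE N a : c%:C%C * (s N a + Kop (s N) a) = b a - iter N relax b a.
  elim: N a => [|N ih] a.
    have z0 : s 0%N = fun=> 0 * 1 by apply/funext => x; rewrite mul0r /s big_nil.
    rewrite z0 KopZ ?mul0r ?addr0 ?mulr0 ?subrr//; exact: tame_cst.
  have sS : s N.+1 = fun x => s N x + iter N relax b x.
    by apply/funext => x; rewrite /s big_nat_recr.
  have rE x : iter N.+1 relax b x = (1 - c)%:C%C * iter N relax b x - c%:C%C * Kop (iter N relax b) x by [].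
  rewrite sS KopD// rE.
  move: (ih a); set F := iter N relax b a; set TF := Kop (iter N relax b) a.
  set S0 := s N a; set TS := Kop (s N) a; move: (b a) F TF S0 TS => u F TF S0 TS ihN.
  have -> : c%:C%C * (S0 + F + (TS + TF)) = c%:C%C * (S0 + TS) + c%:C%C * (F + TF) by ring.
  by rewrite ihN rmorphB rmorph1; ring.
exists (fun a => c%:C%C * G0 a); first by apply: tameM => //; exact: tame_cst.
move=> a; apply/eqP; rewrite -subr_eq0; apply/eqP/eq0_normc/eqP.
rewrite eq_le normc_ge0 andbT.
pose D := 2 * C / (1 - r).
apply: (@geometric_le0 _ _ (c * D + c * ((2 * eps)^-1 * (D * mass)) + C) r) => // N.
have tD : tame (fun x => G0 x - s N x) by exact: tameB.
have hD x : normc (G0 x - s N x) <= D * r ^+ N by exact: hG.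
have -> : c%:C%C * G0 a + Kop (fun a => c%:C%C * G0 a) a - b a =
   c%:C%C * (G0 a - s N a) + c%:C%C * Kop (fun x => G0 x - s N x) a - iter N relax b a.
  rewrite KopZ// KopB//; have := sE N a.
  move: (b a) (iter N relax b a) (G0 a) (s N a) (Kop G0 a) (Kop (s N) a) => u F g S0 TG TS e.
  have -> : u = c%:C%C * (S0 + TS) + F by rewrite e subrK.
  by ring.
rewrite (le_trans (le_normcD _ _))// normcN mulrDl lerD//.
rewrite (le_trans (le_normcD _ _))// !normcM !normc_real (ger0_norm (ltW c0)) mulrDl lerD//.
  by rewrite -mulrA ler_wpM2l// ltW.
rewrite -mulrA ler_wpM2l ?(ltW c0)// (le_trans (normc_Kop _ tD))// -mulrA ler_wpM2l//.
  by rewrite invr_ge0; have := eps_gt0; lra.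
rewrite mulrAC /mass -rwintZ; last exact: rtame_cst.
apply: le_rwint; first exact: tame_normc.
  by apply: rtameM; exact: rtame_cst.
by move=> x; rewrite mulr1.
Qed.

(** Right-hand sides such as [alpha a ^+ j] may be unbounded, but [Kop b] is bounded; if
    [f + Kop f = Kop b], then [b - f] solves the equation for [b]. *)
Lemma resolvent_exists b : tame b -> exists2 f, tame f & forall a, f a + Kop f a = b a.
Proof.
move=> tb; have [||f tf h] := @resolvent_exists_bounded (Kop b).
- exact: tame_Kop.
- by exists ((2 * eps)^-1 * rwint (fun c => normc (b c))) => a; exact: normc_Kop.
exists (fun a => b a - f a); first exact: tameB.
by move=> a; rewrite KopB// addrACA -opprD h addrK.
Qed.

End Weight.

(** * Pairings between two weights *)

Local Notation leb := (@lebesgue_measure R).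

Lemma cwint_Kop_hat w w' x f g : admissible w -> admissible w' -> tame f -> tame g ->
  cwint w (fun a => Kop w' f a * conjc (g a)) =
  cintegral leb `[x, +oo[ (fun z => hat w' x f z * conjc (hat w x g z)).
Proof.
move=> hw hw' tf tg.
have -> : cwint w (fun a => Kop w' f a * conjc (g a)) =
    cwint w (fun a => Lap x (hat w' x f) a * conjc (g a)).
  by apply: eq_cwint => a; rewrite (Lap_hat hw' x a tf).
rewrite (Lap_fubini hw (decaying_hat hw' x tf) (tameJ tg)).
apply: eq_cintegral => z /mem_ray xz; congr (_ * _).
have -> : conjc (hat w x g z) = cwint w (fun a => conjc (g a) * conjc (conjc (wave x a z))).
  by rewrite /hat (cwintJM hw tg (tameJ (tame_wave xz))).
by apply: eq_cwint => c; rewrite conjcK mulrC.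
Qed.

(** Symmetry across two weights: both sides are the same half-line pairing of [hat w' 0 f] with
    [hat w 0 g]. It lets the resolvents of different weights be compared. *)
Lemma cwint_Kop_swap w w' f g : admissible w -> admissible w' -> tame f -> tame g ->
  cwint w (fun a => Kop w' f a * conjc (g a)) = cwint w' (fun a => f a * conjc (Kop w g a)).
Proof.
move=> hw hw' tf tg; rewrite (cwint_Kop_hat 0 hw hw' tf tg).
have -> : cwint w' (fun a => f a * conjc (Kop w g a)) =
    conjc (cwint w' (fun a => Kop w g a * conjc (f a))).
  rewrite (cwintJM hw' (tame_Kop hw tg) (tameJ tf)).
  by apply: eq_cwint => a; rewrite conjcK mulrC.
rewrite (cwint_Kop_hat 0 hw' hw tg tf).
have [mf _] := decaying_hat hw' 0 tf; have [mg _] := decaying_hat hw 0 tg.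
rewrite -cintegralJ//.
  by apply: eq_cintegral => z _; rewrite conjM conjcK mulrC.
have h := integrable_expR2 0 (rwint w (fun a => normc (g a)) * rwint w' (fun a => normc (f a))).
apply: (cintegrable_le _ _ h) => //.
  by apply: cmeasurableM => //; exact: cmeasurableJ.
move=> z /in_ray xz.
rewrite normcM normc_conjc (le_trans (ler_pM _ _ (normc_hat hw tg xz) (normc_hat hw' tf xz)))//; try exact: normc_ge0.
by rewrite le_eqVlt; apply/orP; left; apply/eqP; ring.
Qed.

(** The choice by [xget] makes this a total function of the weight, with value [0] where no solution
    exists; [phiP] recovers the equation for admissible weights. *)
Definition phi w j : T -> R[i] :=
  xget (fun=> 0) [set f | tame f /\ forall a, f a + Kop w f a = alpha a ^+ j].

Lemma phiP w j : admissible w ->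
  tame (phi w j) /\ forall a, phi w j a + Kop w (phi w j) a = alpha a ^+ j.
Proof.
move=> hw; have [f tf hf] := resolvent_exists hw (tameX j tame_alpha).
have := @xgetPex _ (fun=> 0) [set f | tame f /\ forall a, f a + Kop w f a = alpha a ^+ j].
by apply; exists f.
Qed.

Definition moment w i j := cwint w (fun a => phi w i a * conjc (alpha a) ^+ j).

(** * Moments of the resolvent and their derivatives *)

Section Moments.
Variable w : T -> R.
Hypothesis hw : admissible w.

Let tphi j : tame (phi w j). Proof. by have [] := phiP j hw. Qed.

Let phiE j a : phi w j a + Kop w (phi w j) a = alpha a ^+ j.
Proof. by have [] := phiP j hw. Qed.

Let talpha n : tame (fun a => alpha a ^+ n).
Proof. by apply: tameX; exact: tame_alpha. Qed.

Let tbeta n : tame (fun a => conjc (alpha a) ^+ n).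
Proof. by apply: tameX; apply: tameJ; exact: tame_alpha. Qed.

Lemma moment_ip i j : moment w i j = ip w (phi w i) (fun a => alpha a ^+ j).
Proof. by apply: eq_cwint => a; rewrite rmorphXn. Qed.

(** Self-adjointness of 1 + T moves its inverse from one side of the pairing to the other. *)
Lemma moment_ip_sym i j : moment w i j = ip w (fun a => alpha a ^+ i) (phi w j).
Proof.
have tT k := tame_Kop hw (tphi k).
rewrite moment_ip.
have -> : ip w (phi w i) (fun a => alpha a ^+ j) =
    ip w (phi w i) (fun a => phi w j a + Kop w (phi w j) a).
  by apply: eq_cwint => a; rewrite phiE.
have -> : ip w (fun a => alpha a ^+ i) (phi w j) =
    ip w (fun a => phi w i a + Kop w (phi w i) a) (phi w j).
  by apply: eq_cwint => a; rewrite phiE.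
by rewrite (ipDr hw (tphi j) (tT j) (tphi i)) (ipDl hw (tphi i) (tT i) (tphi j)) (Kop_sym hw (tphi i) (tphi j)).
Qed.

(** The moments form a Hermitian matrix; its diagonal is real, and so is K(x, x). *)
Lemma conj_moment i j : conjc (moment w i j) = moment w j i.
Proof.
rewrite moment_ip [RHS]moment_ip_sym -(ipJ hw (tphi i) (talpha j)).
by apply: eq_cwint.
Qed.

Definition psi n i a := conjc (alpha a) ^+ n * phi w i a.

Lemma tame_psi n i : tame (psi n i).
Proof. exact: (tameM (tbeta n) (tphi i)). Qed.

Lemma psiE n i a : psi n i a = conjc (alpha a) ^+ n * phi w i a.
Proof. by []. Qed.

Local Opaque psi.

(** By [alphaD_kappa], [alpha a * kappa a c = -1 - conjc (alpha c) * kappa a c]: [alpha] passes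
    through the kernel at the price of a rank-one term, which is a moment. *)
Lemma alpha_Kop n i a : alpha a * Kop w (psi n i) a = - moment w i n - Kop w (psi n.+1 i) a.
Proof.
rewrite /Kop -(cwintZ hw); last exact: (tameM (tame_kappa a) (tame_psi n i)).
rewrite /moment -opprD -(cwintD hw); last 2 first.
- exact: (tameM (tphi i) (tbeta n)).
- exact: (tameM (tame_kappa a) (tame_psi n.+1 i)).
rewrite -(cwintN hw); last first.
  exact: (tameD (tameM (tphi i) (tbeta n)) (tameM (tame_kappa a) (tame_psi n.+1 i))).
apply: eq_cwint => c; rewrite !psiE exprS.
have e : alpha a * kappa a c = -1 - conjc (alpha c) * kappa a c.
  by rewrite -(alphaD_kappa a c) mulrDl addrK.
by rewrite !mulrA e; ring.
Qed.

(** [alpha_Kop] iterated [n] times, with a sign change at each passage. The exponent [n.-1 - k]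
    counts the factors [alpha] still outside when the [k]-th rank-one term appears. *)
Lemma alpha_phi n i a :
  alpha a ^+ n * phi w i a + (-1) ^+ n * Kop w (psi n i) a =
  alpha a ^+ (n + i) + \sum_(k < n) (-1) ^+ k * moment w i k * alpha a ^+ (n.-1 - k).
Proof.
elim: n => [|n ih].
  rewrite !expr0 !mul1r big_ord0 addr0 add0n -phiE; congr (_ + _).
  by apply: eq_cwint => c; rewrite psiE expr0 mul1r.
rewrite big_ord_recr /= subnn expr0 mulr1 addSn !exprS addrA.
have -> : \sum_(i0 < n) (-1) ^+ i0 * moment w i i0 * alpha a ^+ (n - i0) =
    alpha a * \sum_(k < n) (-1) ^+ k * moment w i k * alpha a ^+ (n.-1 - k).
  rewrite mulr_sumr; apply: eq_bigr => k _.
  have -> : (n - k)%N = (n.-1 - k).+1 by case: (n) k => [[]//|m k] /=; rewrite subSn// -ltnS ltn_ord.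
  by rewrite exprS mulrCA.
rewrite -mulrDr -ih mulrDr mulrA.
have -> : alpha a * ((-1) ^+ n * Kop w (psi n i) a) = (-1) ^+ n * (alpha a * Kop w (psi n i) a).
  by ring.
by rewrite alpha_Kop; ring.
Qed.

(** [alpha_phi] is paired with [phi w j]. Self-adjointness turns the pairing of [Kop w (psi n i)]
    with [phi w j] into that of [psi n i] with [alpha ^ j - phi w j]; the first part is a moment and
    the second completes the factor [alpha ^ n - (- conjc alpha) ^ n]. *)
Lemma moment_sylvester n i j :
  cwint w (fun a => (alpha a ^+ n - (- conjc (alpha a)) ^+ n) * (phi w i a * conjc (phi w j a))) =
  moment w (n + i) j - (-1) ^+ n * moment w i (n + j) + \sum_(k < n) (-1) ^+ k * moment w i k * moment w (n.-1 - k)%N j.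
Proof.
have tT f : tame f -> tame (Kop w f) by move=> tf; exact: tame_Kop.
have tJphi : tame (fun a => conjc (phi w j a)) by exact: tameJ.
have E1 : ip w (fun a => alpha a ^+ n * phi w i a + (-1) ^+ n * Kop w (psi n i) a) (phi w j) =
    moment w (n + i) j + \sum_(k < n) (-1) ^+ k * moment w i k * moment w (n.-1 - k)%N j.
  have -> : ip w (fun a => alpha a ^+ n * phi w i a + (-1) ^+ n * Kop w (psi n i) a) (phi w j) =
     ip w (fun a => alpha a ^+ (n + i) + \sum_(k < n) (-1) ^+ k * moment w i k * alpha a ^+ (n.-1 - k)) (phi w j).
    by apply: eq_cwint => a; rewrite alpha_phi.
  have : forall m (c : nat -> R[i]) (e : nat -> nat),
      tame (fun a => \sum_(k < m) c k * alpha a ^+ e k) /\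
      ip w (fun a => \sum_(k < m) c k * alpha a ^+ e k) (phi w j) = \sum_(k < m) c k * moment w (e k) j.
    move=> m c e; elim: m => [|m [ih1 ih2]].
      have -> : (fun a : T => \sum_(k < 0) c k * alpha a ^+ e k) = fun=> 0.
        by apply/funext => a; rewrite big_ord0.
      split; first exact: tame_cst.
      rewrite big_ord0 -[RHS](mul0r (ip w (fun=> 0) (phi w j))) -(ipZl hw)//; last exact: tame_cst.
      by apply: eq_cwint => a; rewrite mulr0.
    have -> : (fun a : T => \sum_(k < m.+1) c k * alpha a ^+ e k) =
        fun a => \sum_(k < m) c k * alpha a ^+ e k + c m * alpha a ^+ e m.
      by apply/funext => a; rewrite big_ord_recr.
    have tm : tame (fun a => c m * alpha a ^+ e m) by apply: tameM => //; exact: tame_cst.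
    split; first exact: tameD.
    by rewrite (ipDl hw ih1 tm (tphi j)) ih2 (ipZl hw _ (talpha _) (tphi j)) -moment_ip_sym big_ord_recr.
  move=> /(_ n (fun k => (-1) ^+ k * moment w i k) (fun k => n.-1 - k)%N) [ts es].
  by rewrite (ipDl hw (talpha _) ts (tphi j)) es -moment_ip_sym.
have tp := tame_psi n i; have tTp := tT _ tp.
have t1 : tame (fun a => alpha a ^+ n * phi w i a) := tameM (talpha n) (tphi i).
have t2 : tame (fun a => (-1) ^+ n * Kop w (psi n i) a) := tameM (tame_cst _) tTp.
have tpj : tame (fun a => psi n i a * conjc (phi w j a)) := tameM tp tJphi.
have E2 : ip w (Kop w (psi n i)) (phi w j) = moment w i (n + j) - ip w (psi n i) (phi w j).
  rewrite (Kop_sym hw tp (tphi j)).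
  have -> : ip w (psi n i) (Kop w (phi w j)) =
      ip w (psi n i) (fun a => alpha a ^+ j + (-1) * phi w j a).
    by apply: eq_cwint => a; rewrite -phiE; congr (_ * conjc _); ring.
  have tm : tame (fun a => (-1) * phi w j a) := tameM (tame_cst _) (tphi j).
  rewrite (ipDr hw (talpha j) tm tp) (ipZr hw _ (tphi j) tp) rmorphN rmorph1 mulN1r; congr (_ - _).
  by apply: eq_cwint => a; rewrite psiE rmorphXn exprD; ring.
have E3 : cwint w (fun a => (alpha a ^+ n - (- conjc (alpha a)) ^+ n) * (phi w i a * conjc (phi w j a))) =
    ip w (fun a => alpha a ^+ n * phi w i a) (phi w j) - (-1) ^+ n * ip w (psi n i) (phi w j).
  rewrite /ip -(cwintZ hw _ tpj) -(cwintB hw (tameM t1 tJphi) (tameM (tame_cst _) tpj)).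
  apply: eq_cwint => a; rewrite psiE (exprNn (conjc (alpha a))).
  move: (alpha a ^+ n) (conjc (alpha a) ^+ n) (phi w i a) (conjc (phi w j a)) => u1 u3 u4 u5.
  ring.
rewrite E3.
have := E1; rewrite (ipDl hw t1 t2 (tphi j)) (ipZl hw _ tTp (tphi j)).
rewrite E2 => h.
have -> : ip w (fun a => alpha a ^+ n * phi w i a) (phi w j) =
   moment w (n + i) j + \sum_(k < n) (-1) ^+ k * moment w i k * moment w (n.-1 - k)%N j -
   (-1) ^+ n * (moment w i (n + j) - ip w (psi n i) (phi w j)) by rewrite -h addrK.
by ring.
Qed.

Lemma moment00_real : cIm (moment w 0 0) = 0.
Proof. by have := congr1 (@complex.Im R) (conj_moment 0 0); rewrite ImJ; lra. Qed.

End Moments.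

(** A weak resolvent identity. In [moment w' i j] the power [alpha ^ j] is rewritten by the equation
    of [w], in [moment w i j] the power [alpha ^ i] by that of [w']; the two [Kop] terms cancel by
    [cwint_Kop_swap]. The same integrand remains under both weights. *)
Lemma U_difference w w' i j : admissible w -> admissible w' ->
  moment w' i j - moment w i j =
  cwint w' (fun a => phi w' i a * conjc (phi w j a)) - cwint w (fun a => phi w' i a * conjc (phi w j a)).
Proof.
move=> hw hw'; have [tf fE] := phiP i hw'; have [tg gE] := phiP j hw.
have tTf := tame_Kop hw' tf; have tTg := tame_Kop hw tg.
have ta n : tame (fun a => alpha a ^+ n) by apply: tameX; exact: tame_alpha.
have -> : cwint w' (fun a => phi w' i a * conjc (phi w j a)) =
    moment w' i j - cwint w' (fun a => phi w' i a * conjc (Kop w (phi w j) a)).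
  rewrite /moment -(cwintB hw'); last 2 first.
  - by apply: tameM => //; apply: tameX; apply: tameJ; exact: tame_alpha.
  - by apply: tameM => //; exact: tameJ.
  apply: eq_cwint => a; rewrite -mulrBr; congr (_ * _).
  by rewrite -rmorphXn -gE rmorphD addrK.
have -> : cwint w (fun a => phi w' i a * conjc (phi w j a)) =
    moment w i j - cwint w (fun a => Kop w' (phi w' i) a * conjc (phi w j a)).
  rewrite (moment_ip_sym hw) /ip -(cwintB hw); last 2 first.
  - by apply: tameM => //; exact: tameJ.
  - by apply: tameM => //; exact: tameJ.
  by apply: eq_cwint => a; rewrite -mulrBl -fE addrK.
by rewrite (cwint_Kop_swap hw hw' tf tg); ring.
Qed.

(** * First-order dependence on the weight, below a common majorant [W] *)

Section WeightChange.
Variable W : T -> R.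
Hypothesis hW : admissible W.

Lemma le_rwint_weight w f : admissible w -> (forall a, w a <= W a) -> rtame f ->
  (forall a, 0 <= f a) -> rwint w f <= rwint W f.
Proof.
move=> hw wW tf f0; apply: le_Rintegral => //; try exact: integrable_rtame.
by move=> a _; rewrite ler_wpM2l.
Qed.

(** Differences of weights are signed, hence the general density [rho]; it is controlled by an
    admissible weight times a factor [V] of exponential growth. *)
Lemma cintegrable_density f (V rho : T -> R) : tame f -> rtame V ->
  measurable_fun setT rho -> (forall a, `|rho a| <= V a * W a) ->
  cintegrable mu setT (fun a => f a * (rho a)%:C%C).
Proof.
move=> tf tV mrho h.
have tVf : rtame (fun a => V a * normc (f a)) := rtameM tV (tame_normc tf).
apply: (cintegrable_le measurableT _ (integrable_rtame hW tVf)).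
  by apply: cmeasurableM; [have [] := tf | exact: cmeasurable_real].
move=> a _; rewrite normcM normc_real mulrC mulrAC.
by rewrite ler_wpM2r ?normc_ge0.
Qed.

Lemma normc_density f (V rho : T -> R) : tame f -> rtame V ->
  measurable_fun setT rho -> (forall a, `|rho a| <= V a * W a) ->
  normc (cintegral mu setT (fun a => f a * (rho a)%:C%C)) <= rwint W (fun a => V a * normc (f a)).
Proof.
move=> tf tV mrho h.
have tVf : rtame (fun a => V a * normc (f a)) := rtameM tV (tame_normc tf).
have ci := cintegrable_density tf tV mrho h.
rewrite (le_trans (normc_cintegral _ ci))//; apply: le_Rintegral => //.
- exact: cintegrable_normc.
- exact: integrable_rtame.
- move=> a _; rewrite normcM normc_real mulrC mulrAC.
  by rewrite ler_wpM2r ?normc_ge0.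
Qed.

Lemma normc_cwint_weightB w w0 f V : admissible w -> admissible w0 -> tame f -> rtame V ->
  (forall a, `|w a - w0 a| <= V a * W a) ->
  normc (cwint w f - cwint w0 f) <= rwint W (fun a => V a * normc (f a)).
Proof.
move=> hw hw0 tf tV h; have [mw _ _] := hw; have [mw0 _ _] := hw0.
have md : measurable_fun setT (fun a => w a - w0 a) by exact: measurable_funB.
rewrite (le_trans _ (normc_density tf tV md h))// le_eqVlt; apply/orP; left; apply/eqP.
congr normc; rewrite /cwint -[in RHS](addrK (cwint w0 f) (cintegral _ _ _)); congr (_ - _).
rewrite /cwint -cintegralD//; last 2 first.
- exact: (cintegrable_density tf tV md h).
- exact: cintegrable_tame.
by apply: eq_cintegral => a _; rewrite -mulrDr -rmorphD subrK.
Qed.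

Lemma normc_cwint_weight_taylor w w0 f D V : admissible w -> admissible w0 -> tame f ->
  rtame D -> rtame V -> (forall a, `|w a - w0 a - D a * w0 a| <= V a * W a) ->
  normc (cwint w f - cwint w0 f - cwint w0 (fun a => (D a)%:C%C * f a)) <= rwint W (fun a => V a * normc (f a)).
Proof.
move=> hw hw0 tf tD tV h; have [mw _ _] := hw; have [mw0 _ _] := hw0.
have [mD _] := tD.
have md : measurable_fun setT (fun a => w a - w0 a - D a * w0 a).
  by apply: measurable_funB; [exact: measurable_funB | exact: measurable_funM].
have tDf : tame (fun a => (D a)%:C%C * f a) := tameM (rtame_tame tD) tf.
have t1Df : tame (fun a => f a + (D a)%:C%C * f a) := tameD tf tDf.
rewrite (le_trans _ (normc_density tf tV md h))// le_eqVlt; apply/orP; left; apply/eqP.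
congr normc; rewrite -addrA -opprD -(cwintD hw0 tf tDf).
rewrite -[in RHS](addrK (cwint w0 (fun a => f a + (D a)%:C%C * f a)) (cintegral _ _ _)); congr (_ - _).
rewrite /cwint -cintegralD//; last 2 first.
- exact: (cintegrable_density tf tV md h).
- exact: cintegrable_tame.
apply: eq_cintegral => a _; apply: complex_ext; rewrite !ReImE /=; ring.
Qed.

(** The bound of [resolvent_le] is monotone in the weight, so its value at [W] serves all weights
    below [W]. *)
Lemma phi_le_uniform i : exists Phi : T -> R, [/\ rtame Phi, forall a, 0 <= Phi a
  & forall w, admissible w -> (forall a, w a <= W a) -> forall a, normc (phi w i a) <= Phi a].
Proof.
pose b a := alpha a ^+ i; have tb : tame b by apply: tameX; exact: tame_alpha.
have e0 : 0 <= (2 * eps)^-1 by rewrite invr_ge0; have := eps_gt0; lra.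
exists (fun a => normc (b a) + (2 * eps)^-1 * ((mass W + sqnorm W b) / 2)); split.
- by apply: rtameD; [exact: tame_normc | exact: rtame_cst].
- move=> a; rewrite addr_ge0 ?normc_ge0// mulr_ge0// divr_ge0// addr_ge0//.
    exact: mass_ge0.
  exact: sqnorm_ge0.
move=> w hw wW a; have [tf fE] := phiP i hw.
rewrite (le_trans (resolvent_le hw a tf tb fE))// lerD2l ler_wpM2l// ler_wpM2r// lerD//.
  by apply: le_rwint_weight => //; exact: rtame_cst.
by apply: le_rwint_weight => //; [exact: rtame_sq | move=> a'; exact: sqr_ge0].
Qed.

(** The difference of the two solutions solves the equation of [w0] with right-hand side
    [(Kop w0 - Kop w) (phi w i)], which is O(s) uniformly; [K + 1] keeps the bound passed to
    [resolvent_le_sup] positive. *)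
Lemma phi_lipschitz w0 V i : admissible w0 -> (forall a, w0 a <= W a) ->
  rtame V -> (forall a, 0 <= V a) ->
  exists2 C, 0 <= C & forall w (s : R), admissible w -> (forall a, w a <= W a) -> 0 < s ->
    (forall a, `|w a - w0 a| <= s * V a * W a) ->
    forall a, normc (phi w i a - phi w0 i a) <= C * s.
Proof.
move=> hw0 w0W tV V0; have [Phi [tPhi Phi0 hPhi]] := phi_le_uniform i.
have e0 : 0 <= (2 * eps)^-1 by rewrite invr_ge0; have := eps_gt0; lra.
pose K := (2 * eps)^-1 * rwint W (fun a => V a * Phi a).
have tVP : rtame (fun a => V a * Phi a) := rtameM tV tPhi.
have K0 : 0 <= K by rewrite mulr_ge0// (rwint_ge0 hW)// => a; rewrite mulr_ge0.
exists ((K + 1) * (1 + (2 * eps)^-1 * mass w0)).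
  by rewrite mulr_ge0 ?addr_ge0// mulr_ge0// (mass_ge0 hw0).
move=> w s hw wW s0 h a.
have [tf fE] := phiP i hw; have [tf0 f0E] := phiP i hw0.
have tTf := tame_Kop hw tf; have tT0f := tame_Kop hw0 tf.
pose b a := Kop w0 (phi w i) a - Kop w (phi w i) a.
have tb : tame b := tameB tT0f tTf.
have td : tame (fun a => phi w i a - phi w0 i a) := tameB tf tf0.
have dE x : phi w i x - phi w0 i x + Kop w0 (fun x => phi w i x - phi w0 i x) x = b x.
  rewrite (KopB hw0 _ tf tf0) /b.
  have -> : phi w i x = alpha x ^+ i - Kop w (phi w i) x by rewrite -fE addrK.
  have -> : phi w0 i x = alpha x ^+ i - Kop w0 (phi w0 i) x by rewrite -f0E addrK.
  move: (alpha x ^+ i) (Kop w (phi w i) x) (Kop w0 (phi w i) x) (Kop w0 (phi w0 i) x) => u1 u2 u3 u4.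
  by ring.
have bs x : normc (b x) <= (K + 1) * s.
  have tk : tame (fun c => kappa x c * phi w i c) := tameM (tame_kappa x) tf.
  have tsV : rtame (fun a => s * V a) := rtameM (rtame_cst s) tV.
  have -> : b x = - (cwint w (fun c => kappa x c * phi w i c) - cwint w0 (fun c => kappa x c * phi w i c)).
    by rewrite opprB.
  rewrite normcN (le_trans (normc_cwint_weightB hw hw0 tk tsV h))//.
  apply: (@le_trans _ _ (K * s)); last by rewrite ler_wpM2r ?(ltW s0)// lerDl.
  have -> : K * s = rwint W (fun a => ((2 * eps)^-1 * s) * (V a * Phi a)).
    by rewrite (rwintZ hW _ tVP) /K mulrAC.
  apply: (le_rwint hW).
  - exact: (rtameM tsV (tame_normc tk)).
  - exact: (rtameM (rtame_cst _) tVP).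
  - move=> c; rewrite normcM.
    have -> : (2 * eps)^-1 * s * (V c * Phi c) = (s * V c) * (2 * eps)^-1 * Phi c by ring.
    rewrite mulrA.
    apply: ler_pM; rewrite ?normc_ge0//.
    + by rewrite mulr_ge0 ?normc_ge0// mulr_ge0// ltW.
    + by rewrite ler_wpM2l ?normc_kappa// mulr_ge0// ltW.
    + exact: hPhi.
have Ks : 0 < (K + 1) * s by rewrite mulr_gt0// ltr_wpDl.
have [_ hr] := resolvent_le_sup hw0 td tb Ks dE bs.
by rewrite (le_trans (hr a))// mulrAC.
Qed.

(** In [U_difference], replacing [phi w i] by [phi w0 i] costs a product of two first-order
    differences, of the weights and of the solutions. What remains is the expansion of the weight in
    a fixed integral. *)
Lemma U_taylor w0 V i j : admissible w0 -> (forall a, w0 a <= W a) ->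
  rtame V -> (forall a, 0 <= V a) ->
  exists2 C, 0 <= C & forall w D (s : R), admissible w -> (forall a, w a <= W a) -> 0 < s ->
    rtame D ->
    (forall a, `|w a - w0 a| <= s * V a * W a) ->
    (forall a, `|w a - w0 a - D a * w0 a| <= s ^+ 2 * V a * W a) ->
    normc (moment w i j - moment w0 i j - cwint w0 (fun a => (D a)%:C%C * (phi w0 i a * conjc (phi w0 j a))))
      <= C * s ^+ 2.
Proof.
move=> hw0 w0W tV V0; have [C C0 hC] := phi_lipschitz i hw0 w0W tV V0.
have [ti _] := phiP i hw0; have [tj _] := phiP j hw0.
have tjJ := tameJ tj.
have tij : tame (fun a => phi w0 i a * conjc (phi w0 j a)) := tameM ti tjJ.
have tV1 : rtame (fun a => V a * normc (phi w0 j a)) := rtameM tV (tame_normc tj).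
have tV2 : rtame (fun a => V a * normc (phi w0 i a * conjc (phi w0 j a))) := rtameM tV (tame_normc tij).
exists (C * rwint W (fun a => V a * normc (phi w0 j a)) +
        rwint W (fun a => V a * normc (phi w0 i a * conjc (phi w0 j a)))).
  apply: addr_ge0; last by apply: (rwint_ge0 hW) => a; rewrite mulr_ge0 ?normc_ge0.
  by rewrite mulr_ge0// (rwint_ge0 hW)// => a; rewrite mulr_ge0 ?normc_ge0.
move=> w D' s hw wW s0 tD h1 h2; have [tf _] := phiP i hw.
have td : tame (fun a => phi w i a - phi w0 i a) := tameB tf ti.
have tdj : tame (fun a => (phi w i a - phi w0 i a) * conjc (phi w0 j a)) := tameM td tjJ.
have tsV : rtame (fun a => s * V a) := rtameM (rtame_cst s) tV.
have tssV : rtame (fun a => s ^+ 2 * V a) := rtameM (rtame_cst (s ^+ 2)) tV.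
have -> : moment w i j - moment w0 i j - cwint w0 (fun a => (D' a)%:C%C * (phi w0 i a * conjc (phi w0 j a))) =
  (cwint w (fun a => (phi w i a - phi w0 i a) * conjc (phi w0 j a)) -
   cwint w0 (fun a => (phi w i a - phi w0 i a) * conjc (phi w0 j a))) +
  (cwint w (fun a => phi w0 i a * conjc (phi w0 j a)) - cwint w0 (fun a => phi w0 i a * conjc (phi w0 j a))
   - cwint w0 (fun a => (D' a)%:C%C * (phi w0 i a * conjc (phi w0 j a)))).
  rewrite (U_difference i j hw0 hw).
  have E (w1 : T -> R) : admissible w1 -> cwint w1 (fun a => phi w i a * conjc (phi w0 j a)) =
     cwint w1 (fun a => (phi w i a - phi w0 i a) * conjc (phi w0 j a)) +
     cwint w1 (fun a => phi w0 i a * conjc (phi w0 j a)).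
    move=> hw1; rewrite -(cwintD hw1 tdj tij).
    by apply: eq_cwint => a; rewrite mulrBl subrK.
  rewrite (E w hw) (E w0 hw0).
  by rewrite opprD addrACA -[LHS]addrA.
rewrite (le_trans (le_normcD _ _))// mulrDl lerD//.
  rewrite (le_trans (normc_cwint_weightB hw hw0 tdj tsV h1))//.
  have -> : C * rwint W (fun a => V a * normc (phi w0 j a)) * s ^+ 2 =
     rwint W (fun a => (C * s ^+ 2) * (V a * normc (phi w0 j a))).
    by rewrite (rwintZ hW _ tV1) mulrAC.
  apply: (le_rwint hW).
  - exact: (rtameM tsV (tame_normc tdj)).
  - exact: (rtameM (rtame_cst _) tV1).
  - move=> a; rewrite normcM normc_conjc.
    move: (normc (phi w0 j a)) (normc_ge0 (phi w0 j a)) => y y0.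
    have -> : C * s ^+ 2 * (V a * y) = s * V a * (C * s * y) by ring.
    rewrite ler_wpM2l ?mulr_ge0 ?(ltW s0)// ler_wpM2r//.
    exact: hC.
rewrite (le_trans (normc_cwint_weight_taylor hw hw0 tij tD tssV h2))//.
rewrite mulrC -(rwintZ hW _ tV2); apply: (le_rwint hW).
- exact: (rtameM tssV (tame_normc tij)).
- exact: (rtameM (rtame_cst _) tV2).
- by move=> a; rewrite mulrA.
Qed.

End WeightChange.

(** * The weight as a function of x, y, t *)

Section Flow.
Variable g0 : T -> R.
Hypothesis measg0 : measurable_fun setT g0.
Hypothesis g0_ge0 : forall a, 0 <= g0 a.
Hypothesis g0_moments : forall c, mu.-integrable setT (EFin \o (fun a => g0 a * expR (c * G a))).

Definition theta (X : R * R * R) a : R :=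
  - 2 * Q a * X.1.1 + 2 * Q a * phase (P a) (Q a) X.1.2 * X.2.

(** The cubic exponent is dominated by a linear one, locally uniformly in y and t, on the support of
    the density; [phase_dominated] supplies this. *)
Hypothesis theta_le : forall y t : R, 0 < t -> exists c r : R, 0 < r /\
  forall y' t', `|y' - y| < r -> `|t' - t| < r -> forall a, g0 a != 0 ->
    2 * Q a * phase (P a) (Q a) y' * t' <= c * G a.

Definition wt (X : R * R * R) a : R := g0 a * expR (theta X a).

Lemma rtame_phase y : rtame (fun a => phase (P a) (Q a) y).
Proof.
have tP := rtame_P; have tQ := rtame_Q.
have -> : (fun a => phase (P a) (Q a) y) =
    (fun a => Q a ^+ 2 + ((- 3) * P a ^+ 2 + (P a * (y / 2) + (- (y ^+ 2 / 48))))).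
  by apply/funext => a; rewrite /phase; ring.
apply: rtameD; first exact: rtameX.
apply: rtameD; first by apply: rtameM; [exact: rtame_cst|exact: rtameX].
by apply: rtameD; [apply: rtameM => //|]; exact: rtame_cst.
Qed.

Lemma rtame_theta X : rtame (theta X).
Proof.
have tQ := rtame_Q.
apply: rtameD; apply: rtameM; try exact: rtame_cst.
  by apply: rtameM => //; exact: rtame_cst.
by apply: rtameM; [apply: rtameM => //; exact: rtame_cst | exact: rtame_phase].
Qed.

Lemma theta_bound (X : R * R * R) : 0 < X.2 -> exists c r : R, [/\ 0 < r, r <= 1 &
  forall Y, `|Y - X| < r -> forall a, g0 a != 0 -> theta Y a <= c * G a].
Proof.
move=> t0; have [c [r [r0 h]]] := theta_le X.1.2 t0.
exists (2 * (`|X.1.1| + 1) + c), (Num.min r 1); split.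
- by rewrite lt_min r0 ltr01.
- by rewrite ge_min lexx orbT.
move=> Y; rewrite lt_min => /andP[Yr Y1] a ga.
rewrite /theta [leRHS]mulrDl; apply: lerD; last first.
  apply: h => //; first exact: le_lt_trans (norm3_2 (Y - X)) Yr.
  exact: le_lt_trans (norm3_3 (Y - X)) Yr.
have Q0 : 0 <= Q a by rewrite (le_trans (ltW eps_gt0)).
have hx : - Y.1.1 <= `|X.1.1| + 1.
  have := le_lt_trans (norm3_1 (Y - X)) Y1; rewrite /= ltr_norml => /andP[h1 _].
  have := ler_norm (- X.1.1); rewrite normrN; lra.
have QG : Q a <= G a by rewrite lerDl.
have X0 : 0 <= `|X.1.1| + 1 by rewrite addr_ge0.
have := ler_wpM2l Q0 hx; have := ler_wpM2r X0 QG; lra.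
Qed.

Definition dtheta (X H : R * R * R) a : R :=
  - 2 * Q a * H.1.1 + 2 * Q a * (P a / 2 - X.1.2 / 24) * X.2 * H.1.2
  + 2 * Q a * phase (P a) (Q a) X.1.2 * H.2.

Lemma rtame_dtheta X H : rtame (dtheta X H).
Proof.
have tQ : rtame (fun a => 2 * Q a) by apply: rtameM; [exact: rtame_cst | exact: rtame_Q].
rewrite /dtheta; apply: rtameD; first apply: rtameD.
- apply: rtameM; last exact: rtame_cst.
  by apply: rtameM; [exact: rtame_cst | exact: rtame_Q].
- apply: rtameM; last exact: rtame_cst.
  apply: rtameM; last exact: rtame_cst.
  apply: rtameM => //; apply: rtameD; last exact: rtame_cst.
  by apply: rtameM; [exact: rtame_P|exact: rtame_cst].
- by apply: rtameM; [apply: rtameM => //; exact: rtame_phase | exact: rtame_cst].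
Qed.

Definition nrm (X : R * R * R) a := 1 + G a + `|X.1.2| + `|X.2|.

Lemma theta_increment X Y a : `|Y - X| <= 1 ->
  `|theta Y a - theta X a| <= 20 * nrm X a ^+ 3 * `|Y - X| /\
  `|theta Y a - theta X a - dtheta X (Y - X) a| <= 20 * nrm X a ^+ 3 * `|Y - X| ^+ 2.
Proof.
set s := `|Y - X| => s1; have s0 : 0 <= s := normr_ge0 _.
set N := nrm X a.
have hh : `|(Y - X).1.1| <= s := norm3_1 _.
have hk : `|(Y - X).1.2| <= s := norm3_2 _.
have hl : `|(Y - X).2| <= s := norm3_3 _.
have Gp := G_gt0 a; have Q0 : 0 <= Q a by rewrite (le_trans (ltW eps_gt0)).
have nP : `|P a| <= N.
  by rewrite /N /nrm /size1; have := normr_ge0 X.1.2; have := normr_ge0 X.2; lra.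
have nQ : `|Q a| <= N.
  rewrite ger0_norm// /N /nrm /size1.
  by have := normr_ge0 X.1.2; have := normr_ge0 X.2; have := normr_ge0 (P a); lra.
have ny : `|X.1.2| <= N by rewrite /N /nrm; have := normr_ge0 X.2; lra.
have nt : `|X.2| <= N by rewrite /N /nrm; have := normr_ge0 X.1.2; lra.
have N1 : 1 <= N.
  by rewrite /N /nrm; have := normr_ge0 X.1.2; have := normr_ge0 X.2; lra.
have := theta_increment_poly X.1.1 N1 s0 s1 nP nQ ny nt hh hk hl.
rewrite /theta /dtheta.
have -> : X.1.1 + (Y - X).1.1 = Y.1.1 by rewrite /= addrC subrK.
have -> : X.1.2 + (Y - X).1.2 = Y.1.2 by rewrite /= addrC subrK.
by have -> : X.2 + (Y - X).2 = Y.2 by rewrite /= addrC subrK.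
Qed.

(** Near [X] all weights lie below one admissible [W], in which the exponent is replaced by its
    linear bound. The conclusions are the hypotheses of [U_taylor] with [s] the distance from [Y] to
    [X]. *)
Lemma wt_taylor (X : R * R * R) : 0 < X.2 -> exists (r : R) (W V : T -> R),
  [/\ 0 < r, admissible W, rtame V & forall a, 0 <= V a] /\
  forall Y, `|Y - X| < r -> [/\ admissible (wt Y), forall a, wt Y a <= W a,
    forall a, `|wt Y a - wt X a| <= `|Y - X| * V a * W a
    & forall a, `|wt Y a - wt X a - dtheta X (Y - X) a * wt X a| <= `|Y - X| ^+ 2 * V a * W a].
Proof.
move=> t0; have [c [r [r0 r1 hr]]] := theta_bound t0.
pose W a := g0 a * expR (c * G a).
pose K a := 20 * nrm X a ^+ 3.
have K0 a : 0 <= K a.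
  rewrite mulr_ge0// exprn_ge0// /nrm addr_ge0// addr_ge0// addr_ge0//.
  by rewrite ltW// G_gt0.
have tK : rtame K.
  apply: rtameM; first exact: rtame_cst.
  apply: rtameX; rewrite /nrm.
  apply: rtameD; last exact: rtame_cst.
  apply: rtameD; last exact: rtame_cst.
  apply: rtameD; first exact: rtame_cst.
  split; first exact: measurable_G.
  by apply: growth_le growth_G => a; rewrite ger0_norm// ltW// G_gt0.
(* Large enough for both estimates: [2 * K] at first order; at second order [2 * K ^ 2] from the
   exponential and [K] from the remainder of the exponent. *)
pose V a := 2 * K a ^+ 2 + 3 * K a.
have V0 a : 0 <= V a by rewrite addr_ge0// mulr_ge0// exprn_ge0.
have mW : measurable_fun setT W.
  apply: measurable_funM => //; apply: measurableT_comp => //.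
  by apply: measurable_funM => //; exact: measurable_G.
have hW : admissible W.
  split => // [a|e]; first by rewrite mulr_ge0 ?expR_ge0.
  have -> : (fun a => W a * expR (e * G a)) = (fun a => g0 a * expR ((c + e) * G a)).
    by apply/funext => a; rewrite /W mulrDl expRD mulrA.
  exact: g0_moments.
have wW Y : `|Y - X| < r -> forall a, wt Y a <= W a.
  move=> Yr a; rewrite /wt /W; have [->|ga] := eqVneq (g0 a) 0; first by rewrite !mul0r.
  by rewrite ler_wpM2l// ler_expR hr.
have w0 Y a : 0 <= wt Y a by rewrite mulr_ge0 ?expR_ge0.
have mwt Y : measurable_fun setT (wt Y).
  apply: measurable_funM => //; apply: measurableT_comp => //.
  by have [] := rtame_theta Y.
have aw Y : `|Y - X| < r -> admissible (wt Y).
  move=> Yr; split => // e; have [_ _ iW] := hW.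
  apply: (le_integrable measurableT _ _ (iW e)).
    apply/measurable_EFinP; apply: measurable_funM => //; apply: measurableT_comp => //.
    by apply: measurable_funM => //; exact: measurable_G.
  move=> a _ /=; rewrite lee_fin ger0_norm ?mulr_ge0 ?expR_ge0//.
  by rewrite (le_trans _ (ler_norm _))// ler_wpM2r ?expR_ge0// wW.
have XX : `|X - X| < r by rewrite subrr normr0.
exists r, W, V; split.
  by split => //; apply: rtameD; apply: rtameM; try exact: rtame_cst; rewrite //; exact: rtameX.
move=> Y Yr.
have s1 : `|Y - X| <= 1 by rewrite (le_trans (ltW Yr)).
have main a : `|wt Y a - wt X a| <= `|theta Y a - theta X a| * (wt X a + wt Y a) /\
   `|wt Y a - wt X a - (theta Y a - theta X a) * wt X a| <= (theta Y a - theta X a) ^+ 2 * (wt X a + wt Y a).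
  rewrite /wt; split.
    by rewrite -mulrBr normrM ger0_norm// -mulrDr mulrCA ler_wpM2l// expR_lipschitz.
  rewrite mulrCA -mulrBr -mulrBr normrM ger0_norm// -mulrDr [leRHS]mulrCA ler_wpM2l//.
  exact: expR_taylor.
have bound2 a : wt X a + wt Y a <= 2 * W a.
  by have := wW Y Yr a; have := wW X XX a; lra.
split => //; [exact: aw|exact: wW|move=> a|move=> a].
- have [h1 _] := theta_increment a s1; have [h _] := main a.
  rewrite (le_trans h)//; apply: (@le_trans _ _ ((K a * `|Y - X|) * (2 * W a))).
    by apply: ler_pM => //; rewrite addr_ge0.
  rewrite /V; have [_ W0 _] := hW; have := mulr_ge0 (normr_ge0 (Y - X)) (W0 a) => sW.
  have := mulr_ge0 sW (K0 a); have := mulr_ge0 sW (sqr_ge0 (K a)).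
  move: (K a) (`|Y - X|) (W a) => k s w; lra.
- have [h1 h2] := theta_increment a s1; have [_ h] := main a.
  have [_ W0 _] := hW.
  have -> : wt Y a - wt X a - dtheta X (Y - X) a * wt X a =
    (wt Y a - wt X a - (theta Y a - theta X a) * wt X a) +
    (theta Y a - theta X a - dtheta X (Y - X) a) * wt X a by ring.
  rewrite (le_trans (ler_normD _ _))//.
  have e1 : `|wt Y a - wt X a - (theta Y a - theta X a) * wt X a| <= (K a * `|Y - X|) ^+ 2 * (2 * W a).
    rewrite (le_trans h)//; apply: ler_pM => //; [exact: sqr_ge0|by rewrite addr_ge0|].
    by rewrite -real_normK ?num_real// lerXn2r// nnegrE// mulr_ge0.
  have e2 : `|(theta Y a - theta X a - dtheta X (Y - X) a) * wt X a| <= K a * `|Y - X| ^+ 2 * W a.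
    by rewrite normrM (ger0_norm (w0 X a)) ler_pM// wW.
  rewrite (le_trans (lerD e1 e2))// /V.
  have := mulr_ge0 (mulr_ge0 (sqr_ge0 (`|Y - X|)) (W0 a)) (K0 a).
  move: (K a) (`|Y - X|) (W a) => k s w; lra.
Qed.

Lemma admissible_wt (X : R * R * R) : 0 < X.2 -> admissible (wt X).
Proof.
move=> t0; have [r [W [V [[r0 _ _ _] h]]]] := wt_taylor t0.
by have [] := h X; rewrite ?subrr ?normr0.
Qed.

Lemma U_cdiff_dtheta i j (X : R * R * R) : 0 < X.2 -> exists C r : R, [/\ 0 <= C, 0 < r & forall Y, `|Y - X| < r ->
    normc (moment (wt Y) i j - moment (wt X) i j -
       cwint (wt X) (fun a => (dtheta X (Y - X) a)%:C%C * (phi (wt X) i a * conjc (phi (wt X) j a))))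
      <= C * `|Y - X| ^+ 2].
Proof.
move=> t0; have [r [W [V [[r0 hW tV V0] h]]]] := wt_taylor t0.
have [aX XW _ _] : [/\ admissible (wt X), forall a, wt X a <= W a,
    forall a, `|wt X a - wt X a| <= `|X - X| * V a * W a
    & forall a, `|wt X a - wt X a - dtheta X (X - X) a * wt X a| <= `|X - X| ^+ 2 * V a * W a].
  by apply: h; rewrite subrr normr0.
have [C C0 hC] := U_taylor hW i j aX XW tV V0.
exists C, r; split => // Y Yr; have [aY YW h1 h2] := h Y Yr.
(* [U_taylor] asks for [s > 0], so the case [Y = X] is separate. *)
have [->|YX] := eqVneq Y X.
  rewrite !subrr normr0 expr0n mulr0 sub0r normcN.
  have -> : cwint (wt X) (fun a => (dtheta X 0 a)%:C%C * (phi (wt X) i a * conjc (phi (wt X) j a))) = 0.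
    transitivity (cwint (wt X) (fun=> 0 * 0)); last by rewrite (cwintZ aX 0 (tame_cst 0)) mul0r.
    apply: eq_cwint => a; have -> : dtheta X 0 a = 0 by rewrite /dtheta /= !mulr0 !addr0.
    by rewrite rmorph0 !mul0r.
  by rewrite normc0.
apply: hC => //; last exact: rtame_dtheta.
by rewrite normr_gt0 subr_eq0.
Qed.

(** For n = 1, 2, 3 the differences are [-2 q], [-4 i p q] and [-2 q (q^2 - 3 p^2)]. These are the
    monomials in p, q of the derivative of the exponent, so every derivative of a moment falls under
    [moment_sylvester]. *)
Lemma dtheta_alpha X H a : (dtheta X H a)%:C%C =
  (H.1.1 + H.1.2 * (X.1.2 * X.2 / 24) + H.2 * (X.1.2 ^+ 2 / 48))%:C%C * (alpha a ^+ 1 - (- conjc (alpha a)) ^+ 1)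
  + (quarter_i * (H.1.2 * X.2 + H.2 * X.1.2)%:C%C) * (alpha a ^+ 2 - (- conjc (alpha a)) ^+ 2)
  + (- H.2)%:C%C * (alpha a ^+ 3 - (- conjc (alpha a)) ^+ 3).
Proof.
rewrite !expr1 !expr2 !exprS expr0 !mulr1 /dtheta /alpha /quarter_i /phase.
move: (P a) (Q a) H.1.1 H.1.2 H.2 X.1.2 X.2 => p q h k l y t.
apply: complex_ext => /=.
  by field.
by field.
Qed.

Lemma moment_cdiff i j (X : R * R * R) : 0 < X.2 ->
  cdiff (fun Y => moment (wt Y) i j) X
    (sylv (moment (wt X)) 1 i j)
    (X.2%:C%C * (quarter_i * sylv (moment (wt X)) 2 i j) + (X.1.2 * X.2 / 24)%:C%C * sylv (moment (wt X)) 1 i j)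
    (- sylv (moment (wt X)) 3 i j + X.1.2%:C%C * (quarter_i * sylv (moment (wt X)) 2 i j)
       + (X.1.2 ^+ 2 / 48)%:C%C * sylv (moment (wt X)) 1 i j).
Proof.
move=> t0; have [C [r [C0 r0 h]]] := U_cdiff_dtheta i j t0.
exists C, r; split => // Y Yr; have := h Y Yr; congr (normc (_ - _) <= _).
have aX := admissible_wt t0.
have [ti _] := phiP i aX; have [tj _] := phiP j aX.
have tij : tame (fun a => phi (wt X) i a * conjc (phi (wt X) j a)) := tameM ti (tameJ tj).
have tm n : tame (fun a => (alpha a ^+ n - (- conjc (alpha a)) ^+ n) * (phi (wt X) i a * conjc (phi (wt X) j a))).
  apply: tameM => //; apply: tameB; apply: tameX; first exact: tame_alpha.
  by apply: tameN; apply: tameJ; exact: tame_alpha.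
pose m n a := (alpha a ^+ n - (- conjc (alpha a)) ^+ n) * (phi (wt X) i a * conjc (phi (wt X) j a)).
have E n : cwint (wt X) (m n) = sylv (moment (wt X)) n i j by exact: moment_sylvester.
set H := Y - X.
pose c1 : R[i] := (H.1.1 + H.1.2 * (X.1.2 * X.2 / 24) + H.2 * (X.1.2 ^+ 2 / 48))%:C%C.
pose c2 : R[i] := quarter_i * (H.1.2 * X.2 + H.2 * X.1.2)%:C%C.
pose c3 : R[i] := (- H.2)%:C%C.
transitivity (c1 * cwint (wt X) (m 1%N) + c2 * cwint (wt X) (m 2%N) + c3 * cwint (wt X) (m 3%N)).
  have tc c n : tame (fun a => c * m n a) := tameM (tame_cst c) (tm n).
  rewrite -(cwintZ aX c1 (tm 1%N)) -(cwintZ aX c2 (tm 2%N)) -(cwintZ aX c3 (tm 3%N)).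
  rewrite -(cwintD aX (tc _ _) (tc _ _)) -(cwintD aX (tameD (tc _ _) (tc _ _)) (tc _ _)).
  apply: eq_cwint => a; rewrite dtheta_alpha -/c1 -/c2 -/c3 /m.
  move: c1 c2 c3 (alpha a ^+ 1 - _) (alpha a ^+ 2 - _) (alpha a ^+ 3 - _) (phi _ i a * _) => {}c1 {}c2 {}c3 u1 u2 u3 f.
  by rewrite !mulrDl !mulrA.
rewrite !E /c1 /c2 /c3.
move: (sylv _ 1 i j) (sylv _ 2 i j) (sylv _ 3 i j) => s1 s2 s3.
rewrite !(rmorphD, rmorphM, rmorphN) /=.
move: (H.1.1)%:C%C (H.1.2)%:C%C (H.2)%:C%C (X.1.2)%:C%C (X.2)%:C%C => h1 h2 h3 y t.
ring.
Qed.

End Flow.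

(** * The solution of the Marchenko equation *)

Section Marchenko.
Variables (w : T -> R) (x : R).
Hypothesis hw : admissible w.

(* The Marchenko kernel on [x, +oo[^2, with the x-dependence of its density put in the weight w. *)
Definition kern (xi z : R) : R[i] := cwint w (fun a => wave x a xi * conjc (wave x a z)).

(** As [kern x] is [hat w x] of the constant 1, the Marchenko equation reads
    [k = - hat (1 + Lap k)]. Applying [Lap] shows that [1 + Lap k] solves the equation of
    [phi w 0]. *)
Definition sol (z : R) : R[i] := - hat w x (phi w 0) z.

Arguments sol : simpl never.

Let tphi : tame (phi w 0). Proof. by have [] := phiP 0 hw. Qed.

Let phiE a : phi w 0 a + Kop w (phi w 0) a = 1.
Proof. by have [_ h] := phiP 0 hw; rewrite h expr0. Qed.

Lemma hat_sub f g z : x <= z -> tame f -> tame g ->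
  hat w x (fun a => f a - g a) z = hat w x f z - hat w x g z.
Proof.
move=> xz tf tg; have te := tameJ (tame_wave xz).
rewrite /hat -(cwintB hw (tameM tf te) (tameM tg te)).
by apply: eq_cwint => a; rewrite mulrBl.
Qed.

Lemma kern_x z : kern x z = hat w x (fun=> 1) z.
Proof. by apply: eq_cwint => a; rewrite /wave subrr mulr0 expc0. Qed.

Lemma Lap_kern k z : decaying x k -> x <= z ->
  cintegral leb `[x, +oo[ (fun xi => k xi * kern xi z) = hat w x (Lap x k) z.
Proof.
move=> dk xz; rewrite /hat (Lap_fubini hw dk (tameJ (tame_wave xz))).
by apply: eq_cintegral.
Qed.

Lemma cmeasurable_sol D : measurable D -> cmeasurable D (sol : measurableTypeR R -> R[i]).
Proof. by move=> mD; apply: cmeasurableN; exact: cmeasurable_hat. Qed.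

Lemma decaying_sol : decaying x sol.
Proof.
apply: (@decaying_le _ _ (rwint w (fun a => normc (phi w 0 a)))).
  exact: cmeasurable_sol.
by move=> z xz; rewrite normcN mulrC normc_hat.
Qed.

Lemma Lap_sol a : Lap x sol a = phi w 0 a - 1.
Proof.
have -> : phi w 0 a - 1 = - Kop w (phi w 0) a by rewrite -(phiE a) opprD addrA subrr add0r.
rewrite -(Lap_hat hw x a tphi) /Lap -mulN1r -cintegralZ//.
  by apply: eq_cintegral => z _; rewrite /sol mulNr mulN1r.
have [mh ih] := decaying_hat hw x tphi.
apply: (cintegrable_le _ _ ih) => //.
  by apply: cmeasurableM => //; exact: cmeasurable_wave.
by move=> z /in_ray xz; rewrite normcM ler_wpM2l ?normc_ge0// normc_wave_le.
Qed.

Lemma sol_marchenko z : x <= z ->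
  sol z + kern x z + cintegral leb `[x, +oo[ (fun xi => sol xi * kern xi z) = 0.
Proof.
move=> xz; rewrite (Lap_kern decaying_sol xz) kern_x.
have -> : hat w x (Lap x sol) z = hat w x (fun a => phi w 0 a - 1) z.
  by apply: eq_cwint => a; rewrite Lap_sol.
by rewrite (hat_sub xz tphi (tame_cst 1)) /sol; ring.
Qed.

Lemma sol_L2 : in_L2_from x sol.
Proof.
have mI : measurable (`[x, +oo[%classic : set (measurableTypeR R)) by exact: measurable_itv.
have [m1 m2] := cmeasurable_sol mI.
split => //.
pose C := rwint w (fun a => normc (phi w 0 a)).
have h := integrable_expR2 x (C * C).
have /integrableP[_ hlt] := h; apply: le_lt_trans hlt.
apply: ge0_le_integral => //.
- by move=> z _; rewrite lee_fin addr_ge0 ?sqr_ge0.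
- apply/measurable_EFinP; apply: measurable_funD; exact: measurable_funX.
- by apply: measurableT_comp => //; exact: measurable_int h.
- move=> z /in_ray xz; rewrite -normcE2 -[leRHS]/(`|C * C * expR (- eps * (z - x)) * expR (- eps * (z - x))|%:E) lee_fin (le_trans _ (ler_norm _))//.
  have hb : normc (sol z) <= expR (- eps * (z - x)) * C by rewrite normcN normc_hat.
  have -> : C * C * expR (- eps * (z - x)) * expR (- eps * (z - x)) = (expR (- eps * (z - x)) * C) ^+ 2.
    by ring.
  by rewrite lerXn2r// nnegrE ?normc_ge0// (le_trans (normc_ge0 _) hb).
Qed.

Lemma L2_decaying k : in_L2_from x k -> decaying x k.
Proof.
move=> [m1 m2 h2]; have mk : cmeasurable `[x, +oo[ (k : measurableTypeR R -> R[i]) by [].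
split => //.
have i1 : leb.-integrable `[x, +oo[ (EFin \o (fun z => cRe (k z) ^+ 2 + cIm (k z) ^+ 2)).
  apply/integrableP; split.
    by apply/measurable_EFinP; apply: measurable_funD; exact: measurable_funX.
  apply: le_lt_trans h2; rewrite le_eqVlt; apply/orP; left; apply/eqP.
  by apply: eq_integral => z _ /=; rewrite ger0_norm// addr_ge0 ?sqr_ge0.
have i2 := integrable_expR2 x 1.
have mI : measurable (`[x, +oo[%classic : set (measurableTypeR R)) by exact: measurable_itv.
have i12 := integrableD mI i1 i2.
apply: le_integrable i12 => //.
  apply/measurable_EFinP; apply: measurable_funM; first exact: measurable_normc.
  apply: measurable_funTS; apply: continuous_measurable_fun => z.
  by apply: differentiable_continuous; apply/derivable1_diffP; apply: ex_derive.
move=> z _ /=; rewrite lee_fin -normcE2 mul1r.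
rewrite ger0_norm ?mulr_ge0 ?normc_ge0 ?expR_ge0// (le_trans _ (ler_norm _))//.
move: (normc (k z)) (normc_ge0 (k z)) (expR _) (expR_ge0 (- eps * (z - x))) => n n0 e e0.
by have := sqr_ge0 (n - e); have := mulr_ge0 n0 e0; lra.
Qed.

Lemma tame_Lap k : decaying x k -> tame (Lap x k).
Proof.
move=> [mk ik].
apply: (tame_bounded (M := Rintegral leb `[x, +oo[ (fun z => normc (k z) * expR (- eps * (z - x))))).
  have mI : measurable (`[x, +oo[%classic : set (measurableTypeR R)) by exact: measurable_itv.
  have [k1 k2] := cmeasurable_indic_mul mI mk.
  have mF : cmeasurable setT (fun v : T * measurableTypeR R =>
      ((\1_(`[x, +oo[%classic) v.2)%:C%C * k v.2) * wave x v.1 v.2).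
    apply: cmeasurableM; last exact: cmeasurable_wave2.
    by split; [exact: (measurableT_comp k1 measurable_snd)|exact: (measurableT_comp k2 measurable_snd)].
  have := cmeasurable_cintegral_snd leb mF; apply: eq_cmeasurable => a _.
  by rewrite /Lap [RHS]cintegral_indic_mul; apply: eq_cintegral => z _; rewrite mulrA.
move=> a.
have bnd z : (`[x, +oo[%classic : set R) z ->
    normc (k z * wave x a z) <= normc (k z) * expR (- eps * (z - x)).
  by move=> /in_ray xz; rewrite normcM ler_wpM2l ?normc_ge0// normc_wave_le.
have ci : cintegrable leb `[x, +oo[ (fun z => k z * wave x a z).
  apply: (cintegrable_le _ _ ik) => //.
  by apply: cmeasurableM => //; exact: cmeasurable_wave.
rewrite (le_trans (normc_cintegral _ ci))//; apply: le_Rintegral => //.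
exact: cintegrable_normc.
Qed.

(** [Lap] ignores null sets: applied to the equation, which holds almost everywhere, it gives the
    resolvent equation for [1 + Lap k] at every [a]. Hence [1 + Lap k = phi w 0], and the equation
    then returns [k] almost everywhere. *)
Lemma sol_unique k : in_L2_from x k ->
  {ae leb, forall z, x <= z ->
     k z + kern x z + cintegral leb `[x, +oo[ (fun xi => k xi * kern xi z) = 0} ->
  {ae leb, forall z, x <= z -> k z = sol z}.
Proof.
move=> k2 hk; have dk := L2_decaying k2; have [mk ik] := dk.
pose g := Lap x k; have tg : tame g := tame_Lap dk.
have t1g : tame (fun a => 1 + g a) := tameD (tame_cst 1) tg.
have hk' : {ae leb, forall z, x <= z -> k z = - hat w x (fun a => 1 + g a) z}.
  apply: ae_lebesgue_imp hk => z h xz; have := h xz.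
  rewrite (Lap_kern dk xz) kern_x -/g => /eqP.
  have te := tameJ (tame_wave xz).
  have -> : hat w x (fun a => 1 + g a) z = hat w x (fun=> 1) z + hat w x g z.
    rewrite /hat -(cwintD hw (tameM (tame_cst 1) te) (tameM tg te)).
    by apply: eq_cwint => a; rewrite mulrDl.
  by rewrite -addrA addr_eq0 => /eqP.
have gE a : g a + Kop w (fun a => 1 + g a) a = 0.
  have -> : g a = - Lap x (hat w x (fun a => 1 + g a)) a.
    rewrite /g /Lap -mulN1r -cintegralZ//; last first.
      have [mh ih] := decaying_hat hw x t1g.
      apply: (cintegrable_le _ _ ih) => //.
        by apply: cmeasurableM => //; exact: cmeasurable_wave.
      by move=> z /in_ray xz; rewrite normcM ler_wpM2l ?normc_ge0// normc_wave_le.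
    apply: cintegral_ae_eq => //.
    - by apply: cmeasurableM => //; exact: cmeasurable_wave.
    - apply: cmeasurableM; first exact: cmeasurable_cst.
      by apply: cmeasurableM; [exact: cmeasurable_hat | exact: cmeasurable_wave].
    - by apply: ae_lebesgue_imp hk' => z h /in_ray xz; rewrite (h xz) mulN1r mulNr.
  by rewrite (Lap_hat hw x a t1g) addNr.
have gphi a : 1 + g a = phi w 0 a.
  apply/eqP; rewrite -subr_eq0; apply/eqP.
  have td : tame (fun a => 1 + g a - phi w 0 a) := tameB t1g tphi.
  apply: (resolvent_eq0 hw td) => c; rewrite (KopB hw c t1g tphi).
  have := gE c; have := phiE c.
  move: (g c) (phi w 0 c) (Kop w (fun a => 1 + g a) c) (Kop w (phi w 0) c) => u1 u2 u3 u4 h1 h2.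
  have -> : 1 + u1 - u2 + (u3 - u4) = 1 + (u1 + u3) - (u2 + u4) by ring.
  by rewrite h1 h2 addr0 subrr.
apply: ae_lebesgue_imp hk' => z h xz; rewrite (h xz) /sol; congr (- _).
by apply: eq_cwint => a; rewrite gphi.
Qed.

Lemma sol_diag : sol x = - moment w 0 0.
Proof.
rewrite /sol; congr (- _); apply: eq_cwint => a.
by rewrite expr0 /wave subrr mulr0 expc0 rmorph1.
Qed.

End Marchenko.

(** By [moment_sylvester] this x-derivative of u_00 is the integral of [- 2 * Q] times the squared
    modulus of [phi w 0], and [resolvent_le_sup] bounds [phi w 0] by means of the mass. *)
Lemma normc_sylv1_le w : admissible w ->
  normc (sylv (moment w) 1 0 0) <= 2 * (1 + (2 * eps)^-1 * mass w) ^+ 2 * rwint w Q.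
Proof.
move=> hw; have [tf fE] := phiP 0 hw.
pose K := 1 + (2 * eps)^-1 * mass w.
have hK a : normc (phi w 0 a) <= K.
  have [||_ h] := @resolvent_le_sup w hw (phi w 0) (fun=> 1) 1 tf (tame_cst 1) ltr01.
  - by move=> c; rewrite fE expr0.
  - by move=> c; rewrite normc1.
  by have := h a; rewrite mul1r.
have tff : tame (fun a => phi w 0 a * conjc (phi w 0 a)) := tameM tf (tameJ tf).
have ta : tame (fun a => alpha a ^+ 1 - (- conjc (alpha a)) ^+ 1).
  apply: tameB; apply: tameX; first exact: tame_alpha.
  by apply: tameN; apply: tameJ; exact: tame_alpha.
have tm : tame (fun a => (alpha a ^+ 1 - (- conjc (alpha a)) ^+ 1) * (phi w 0 a * conjc (phi w 0 a))) := tameM ta tff.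
have := moment_sylvester hw 1 0 0; rewrite -/(sylv (moment w) 1 0 0) => <-.
rewrite (le_trans (normc_cwint hw tm))//.
rewrite -/K -(rwintZ hw _ rtame_Q); apply: (le_rwint hw).
- exact: tame_normc.
- by apply: rtameM; [exact: rtame_cst | exact: rtame_Q].
move=> a; rewrite normcM normcM normc_conjc.
have -> : normc (alpha a ^+ 1 - (- conjc (alpha a)) ^+ 1) = 2 * Q a.
  have -> : alpha a ^+ 1 - (- conjc (alpha a)) ^+ 1 = (- (2 * Q a))%:C%C.
    by rewrite !expr1; apply: complex_ext; rewrite !ReImE /=; ring.
  by rewrite normc_real normrN ger0_norm// mulr_ge0// (le_trans (ltW eps_gt0)).
have Q0 : 0 <= 2 * Q a by rewrite mulr_ge0// (le_trans (ltW eps_gt0)).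
have -> : 2 * K ^+ 2 * Q a = 2 * Q a * (K * K) by ring.
by rewrite ler_wpM2l// ler_pM ?normc_ge0.
Qed.

(** The exponent contains [- 2 q x] with [q >= eps], so for [x >= 0] the weight is at most
    [expR (- (2 * eps) * x)] times the weight at [x = 0]. The mass stays bounded and the integral of
    [Q] decays. *)
Lemma sylv1_decay g0 (y t : R) : (forall a, 0 <= g0 a) ->
  (forall x, admissible (wt g0 (x, y, t))) ->
  exists C, forall x, 0 <= x -> normc (sylv (moment (wt g0 (x, y, t))) 1 0 0) <= C * expR (- (2 * eps) * x).
Proof.
move=> g00 ha; pose w0 := wt g0 (0, y, t).
exists (2 * (1 + (2 * eps)^-1 * mass w0) ^+ 2 * rwint w0 Q) => x x0.
have ww a : wt g0 (x, y, t) a <= expR (- (2 * eps) * x) * w0 a.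
  rewrite /w0 /wt mulrCA ler_wpM2l// -expRD ler_expR /theta /= mulr0 add0r lerD2r.
  have := ler_wpM2r x0 (Qeps a); lra.
have [m0 w00 _] := ha 0; have [mx wx0 _] := ha x.
have e0 : 0 <= (2 * eps)^-1 by rewrite invr_ge0; have := eps_gt0; lra.
have ex1 : expR (- (2 * eps) * x) <= 1.
  by rewrite -[leRHS]expR0 ler_expR; have := mulr_ge0 (ltW eps_gt0) x0; lra.
have ww1 a : wt g0 (x, y, t) a <= w0 a.
  by rewrite (le_trans (ww a))// ler_piMl// w00.
rewrite (le_trans (normc_sylv1_le (ha x)))//.
have hm : mass (wt g0 (x, y, t)) <= mass w0.
  by apply: (le_rwint_weight (ha 0) (ha x) ww1) => //; exact: rtame_cst.
have hJ : rwint (wt g0 (x, y, t)) Q <= rwint w0 Q * expR (- (2 * eps) * x).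
  rewrite mulrC -(rwintZ (ha 0) _ rtame_Q); apply: le_Rintegral => //.
  - exact: (integrable_rtame (ha x) rtame_Q).
  - by apply: (integrable_rtame (ha 0)); apply: rtameM; [exact: rtame_cst | exact: rtame_Q].
  - move=> a _; rewrite mulrAC mulrC ler_wpM2r ?ww// (le_trans _ (Qeps a))// ltW//.
have mx0 := mass_ge0 (ha x).
have J0 : 0 <= rwint (wt g0 (x, y, t)) Q.
  by apply: (rwint_ge0 (ha x)) => a; rewrite (le_trans (ltW eps_gt0)).
move: (mass _) (mass w0) (rwint _ Q) (rwint w0 Q) (expR _) e0 mx0 hm J0 hJ => m m' j j' e.
move: (_^-1) => k k0 m1 mm j1 jj.
rewrite -(mulrA _ j'); apply: ler_pM => //; first by rewrite mulr_ge0// sqr_ge0.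
have km : k * m <= k * m' by rewrite ler_wpM2l.
have km0 : 0 <= k * m by rewrite mulr_ge0.
by rewrite ler_wpM2l// lerXn2r ?nnegrE//; lra.
Qed.

End Spectral.

(** * Differential polynomials in the moments *)

Section QuadraticRemainder.
Context {R : realType} {V : normedModType R}.

Lemma quadratic_is_diff0 (F : V -> R) (X : V) (C r : R) : 0 < r ->
  (forall Y, `|Y - X| < r -> `|F Y - F X| <= C * `|Y - X| ^+ 2) ->
  is_diff X F (fun=> 0).
Proof.
move=> r0 h.
pose z : {linear V -> R} := \0.
have zc : continuous z by move=> ?; exact: cvg_cst.
have E : F \o shift X = cst (F X) + z +o_ (0 : V) id.
  apply/eqaddoP => e e0.
  have d0 : 0 < Num.min r (e / (`|C| + 1)) by rewrite lt_min r0 divr_gt0// ltr_wpDl.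
  near=> H.
  have : `|H| < Num.min r (e / (`|C| + 1)).
    by near: H; apply: nbhs0_lt.
  rewrite lt_min => /andP[Hr He].
  have -> : (F \o shift X - (cst (F X) + z)) H = F (H + X) - F X.
    by rewrite /= !fctE /= addr0.
  have := h (H + X); rewrite addrK => /(_ Hr) /le_trans; apply.
  rewrite expr2 mulrA ler_wpM2r//.
  apply: (@le_trans _ _ ((`|C| + 1) * `|H|)).
    by rewrite ler_wpM2r// (le_trans (ler_norm _))// lerDl.
  by rewrite mulrC -ler_pdivlMr ?ltr_wpDl// ltW.
have dE := diff_unique zc E.
apply: DiffDef; last by rewrite dE; apply/funext.
by apply/diff_locallyP; rewrite dE; split => //; exact: zc.
Unshelve. all: by end_near. Qed.

Lemma near_eq_differentiable (f g : V -> R) (X : V) :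
  (\near X, f X = g X) -> differentiable g X -> differentiable f X.
Proof.
move=> fg dg; have [r /= r0 h] := (nbhs_ballP _ _).1 fg.
have -> : f = g + (f - g) by rewrite addrC subrK.
suff dz : is_diff X (f - g) (fun=> 0) by apply: differentiableD => //; exact: ex_diff.
apply: (@quadratic_is_diff0 _ _ 0 r r0) => Y YX.
rewrite !fctE (h X (ballxx _ r0)) (h Y) ?subrr ?subr0 ?normr0 ?mul0r//.
by rewrite -ball_normE /= distrC.
Qed.

End QuadraticRemainder.

Section CDiff.
Context {R : realType}.
Implicit Types (X Y H : R * R * R) (f g : R * R * R -> R[i]).

Definition lin3 (d1 d2 d3 : R[i]) H : R[i] :=
  d1 * (H.1.1)%:C%C + d2 * (H.1.2)%:C%C + d3 * (H.2)%:C%C.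

Lemma lin3_100 d1 d2 d3 : lin3 d1 d2 d3 (1, 0, 0) = d1.
Proof. by rewrite /lin3 /= rmorph0 rmorph1 mulr1 !mulr0 !addr0. Qed.

Lemma lin3_010 d1 d2 d3 : lin3 d1 d2 d3 (0, 1, 0) = d2.
Proof. by rewrite /lin3 /= rmorph0 rmorph1 mulr1 !mulr0 addr0 add0r. Qed.

Lemma lin3_001 d1 d2 d3 : lin3 d1 d2 d3 (0, 0, 1) = d3.
Proof. by rewrite /lin3 /= rmorph0 rmorph1 mulr1 !mulr0 !add0r. Qed.

Lemma normc_lin3 d1 d2 d3 H :
  normc (lin3 d1 d2 d3 H) <= (normc d1 + normc d2 + normc d3) * `|H|.
Proof.
rewrite /lin3 (le_trans (le_normcD _ _))// [leRHS]mulrDl lerD//.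
  rewrite (le_trans (le_normcD _ _))// [leRHS]mulrDl lerD// normcM normc_real ler_wpM2l ?normc_ge0//.
    exact: norm3_1.
  exact: norm3_2.
by rewrite normcM normc_real ler_wpM2l ?normc_ge0// norm3_3.
Qed.

Lemma cdiff_lipschitz f X d1 d2 d3 : cdiff f X d1 d2 d3 ->
  exists K r : R, [/\ 0 <= K, 0 < r & forall Y, `|Y - X| < r -> normc (f Y - f X) <= K * `|Y - X|].
Proof.
move=> [C [r [C0 r0 h]]]; exists (C + (normc d1 + normc d2 + normc d3)), (Num.min r 1); split.
- by rewrite !addr_ge0 ?normc_ge0.
- by rewrite lt_min r0 ltr01.
move=> Y; rewrite lt_min => /andP[Yr Y1].
rewrite -[f Y - f X](subrK (lin3 d1 d2 d3 (Y - X))) (le_trans (le_normcD _ _))// [leRHS]mulrDl lerD//.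
  rewrite (le_trans (h _ Yr))// expr2 mulrA ler_piMr ?mulr_ge0// ltW//.
exact: normc_lin3.
Qed.

Lemma cdiff_cst (c : R[i]) X : cdiff (fun=> c) X 0 0 0.
Proof.
exists 0, 1; split => // Y _.
by rewrite subrr sub0r normcN !mul0r !addr0 normc0.
Qed.

Lemma cdiff_y X : cdiff (fun Y => (Y.1.2)%:C%C) X 0 1 0.
Proof.
exists 0, 1; split => // Y _.
by rewrite !mul0r addr0 add0r mul1r -rmorphB subrr normc0.
Qed.

Lemma cdiff_t X : cdiff (fun Y => (Y.2)%:C%C) X 0 0 1.
Proof.
exists 0, 1; split => // Y _.
by rewrite !mul0r !add0r mul1r -rmorphB subrr normc0.
Qed.

Lemma cdiffD f g X d1 d2 d3 e1 e2 e3 : cdiff f X d1 d2 d3 -> cdiff g X e1 e2 e3 ->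
  cdiff (fun Y => f Y + g Y) X (d1 + e1) (d2 + e2) (d3 + e3).
Proof.
move=> [C [r [C0 r0 h]]] [D [s [D0 s0 k]]].
exists (C + D), (Num.min r s); split; rewrite ?addr_ge0 ?lt_min ?r0//.
move=> Y; rewrite lt_min => /andP[Yr Ys].
rewrite [leRHS]mulrDl (le_trans _ (lerD (h Y Yr) (k Y Ys)))//.
rewrite (le_trans _ (le_normcD _ _))// le_eqVlt; apply/orP; left; apply/eqP; congr normc.
move: ((Y - X).1.1)%:C%C ((Y - X).1.2)%:C%C ((Y - X).2)%:C%C (f Y) (f X) (g Y) (g X) => u1 u2 u3 v1 v2 v3 v4.
ring.
Qed.

Lemma cdiffM f g X d1 d2 d3 e1 e2 e3 : cdiff f X d1 d2 d3 -> cdiff g X e1 e2 e3 ->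
  cdiff (fun Y => f Y * g Y) X (d1 * g X + f X * e1) (d2 * g X + f X * e2) (d3 * g X + f X * e3).
Proof.
move=> hf hg; have [K [r1 [K0 r10 hK]]] := cdiff_lipschitz hf.
have [L [s1 [L0 s10 hL]]] := cdiff_lipschitz hg.
have [C [r [C0 r0 h]]] := hf; have [D [s [D0 s0 k]]] := hg.
exists (K * L + (normc (g X) * C + normc (f X) * D)), (Num.min (Num.min r1 s1) (Num.min r s)); split.
- by rewrite addr_ge0 ?mulr_ge0// addr_ge0// mulr_ge0 ?normc_ge0.
- by rewrite !lt_min r10 s10 r0 s0.
move=> Y; rewrite !lt_min => /andP[/andP[Y1 Y2] /andP[Y3 Y4]].
have -> : f Y * g Y - f X * g X - ((d1 * g X + f X * e1) * ((Y - X).1.1)%:C%C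
    + (d2 * g X + f X * e2) * ((Y - X).1.2)%:C%C + (d3 * g X + f X * e3) * ((Y - X).2)%:C%C) =
  (f Y - f X) * (g Y - g X) + (g X * (f Y - f X - lin3 d1 d2 d3 (Y - X)) +
     f X * (g Y - g X - lin3 e1 e2 e3 (Y - X))).
  rewrite /lin3.
  move: ((Y - X).1.1)%:C%C ((Y - X).1.2)%:C%C ((Y - X).2)%:C%C (f Y) (f X) (g Y) (g X) => u1 u2 u3 v1 v2 v3 v4.
  ring.
rewrite (le_trans (le_normcD _ _))// [leRHS]mulrDl lerD//.
  rewrite normcM expr2 mulrACA ler_pM ?normc_ge0//; [exact: hK|exact: hL].
rewrite (le_trans (le_normcD _ _))// [leRHS]mulrDl !normcM -!mulrA lerD// ler_wpM2l ?normc_ge0//.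
  exact: h.
exact: k.
Qed.

Definition lin3r (a b c : R) (H : R * R * R) : R := a * H.1.1 + b * H.1.2 + c * H.2.

Fact lin3r_is_linear a b c : linear (lin3r a b c).
Proof.
move=> k u v; rewrite /lin3r /=.
by rewrite /GRing.scale /=; ring.
Qed.

HB.instance Definition _ a b c := GRing.isLinear.Build R (R * R * R)%type R *:%R
  (lin3r a b c) (lin3r_is_linear a b c).

Lemma continuous_lin3r a b c : continuous (lin3r a b c).
Proof.
move=> H; rewrite /lin3r.
have c1 : (fun Y : R * R * R => Y.1) Y @[Y --> H] --> H.1 by exact: cvg_fst.
have c2 : (fun Y : R * R * R => Y.2) Y @[Y --> H] --> H.2 by exact: cvg_snd.
have c11 : Y.1.1 @[Y --> H] --> H.1.1.
  by apply: (cvg_comp _ _ c1); exact: cvg_fst.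
have c12 : Y.1.2 @[Y --> H] --> H.1.2.
  by apply: (cvg_comp _ _ c1); exact: cvg_snd.
by apply: cvgD; first apply: cvgD; apply: cvgM => //; exact: cvg_cst.
Qed.

Lemma cdiff_Re f X d1 d2 d3 : cdiff f X d1 d2 d3 ->
  differentiable (fun Y => cRe (f Y)) X /\
  forall H, 'D_H (fun Y => cRe (f Y)) X = cRe (lin3 d1 d2 d3 H).
Proof.
move=> [C [r [C0 r0 h]]].
pose L := lin3r (cRe d1) (cRe d2) (cRe d3).
have LE H : cRe (lin3 d1 d2 d3 H) = L H by rewrite /lin3 !ReD !ReMr.
have dL : is_diff X L L.
  have cL : continuous L := @continuous_lin3r _ _ _.
  by apply: DiffDef; [exact: linear_differentiable | exact: diff_lin].
have dF : is_diff X (fun Y => cRe (f Y) - L Y) (fun=> 0).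
  apply: (@quadratic_is_diff0 _ _ _ _ C r r0) => Y Yr.
  apply: le_trans (h Y Yr); rewrite (le_trans _ (Re_le_normc _))// le_eqVlt.
  apply/orP; left; apply/eqP; congr (`|_|).
  rewrite ReD ReN ReD ReN -/(lin3 d1 d2 d3 (Y - X)) LE /L /lin3r /=; ring.
have dfull : is_diff X (fun Y => cRe (f Y)) L.
  have dS := is_diffD dF dL.
  have e1 : (fun Y => cRe (f Y) - L Y) + (L : R * R * R -> R) = (fun Y => cRe (f Y)).
    by apply/funext => Y; rewrite !fctE subrK.
  have e2 : (fun=> 0) + (L : R * R * R -> R) = L by apply/funext => Y; rewrite !fctE add0r.
  by rewrite e1 e2 in dS.
split; first exact: ex_diff.
by move=> H; rewrite deriveE ?diff_val//; exact: ex_diff.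
Qed.

End CDiff.

(** * Formal derivations on polynomials in the moments *)

Section DifferentialPolynomials.
Variable A : numFieldType.

(** Syntax trees over infinitely many unknowns u_ij: derivations are defined by recursion, and after
    evaluation identities are left to [ring] and [field]. *)
Inductive dpoly :=
  | Umon of nat & nat
  | Yvar
  | Tvar
  | Const of A
  | Sum of dpoly & dpoly
  | Prod of dpoly & dpoly.

Fixpoint deval (u : nat -> nat -> A) (y t : A) e :=
  match e with
  | Umon i j => u i j
  | Yvar => y
  | Tvar => t
  | Const c => c
  | Sum e1 e2 => deval u y t e1 + deval u y t e2
  | Prod e1 e2 => deval u y t e1 * deval u y t e2
  end.

Fixpoint derivation (du : nat -> nat -> dpoly) (dy dt : dpoly) e :=
  match e with
  | Umon i j => du i j
  | Yvar => dy
  | Tvar => dt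
  | Const _ => Const 0
  | Sum e1 e2 => Sum (derivation du dy dt e1) (derivation du dy dt e2)
  | Prod e1 e2 => Sum (Prod (derivation du dy dt e1) e2) (Prod e1 (derivation du dy dt e2))
  end.

(** Here and below: [sylv] for n = 1, 2, 3, expanded as syntax. *)
Definition sylv1 i j := Sum (Sum (Umon i.+1 j) (Umon i j.+1)) (Prod (Umon i 0) (Umon 0 j)).

Definition sylv2 i j :=
  Sum (Sum (Umon i.+2 j) (Prod (Const (-1)) (Umon i j.+2)))
   (Sum (Prod (Umon i 0) (Umon 1 j)) (Prod (Const (-1)) (Prod (Umon i 1) (Umon 0 j)))).

Definition sylv3 i j :=
  Sum (Sum (Umon i.+3 j) (Umon i j.+3))
   (Sum (Prod (Umon i 0) (Umon 2 j))
     (Sum (Prod (Const (-1)) (Prod (Umon i 1) (Umon 1 j))) (Prod (Umon i 2) (Umon 0 j)))).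

Variable q : A.

Definition dX := derivation sylv1 (Const 0) (Const 0).

Definition dY := derivation
  (fun i j => Sum (Prod Tvar (Prod (Const q) (sylv2 i j)))
                  (Prod (Prod (Const 24^-1) (Prod Yvar Tvar)) (sylv1 i j)))
  (Const 1) (Const 0).

Definition dT := derivation
  (fun i j => Sum (Sum (Prod (Const (-1)) (sylv3 i j)) (Prod Yvar (Prod (Const q) (sylv2 i j))))
                  (Prod (Prod (Const 48^-1) (Prod Yvar Yvar)) (sylv1 i j)))
  (Const 0) (Const 1).

(** On the unknowns this is a polynomial identity, and it extends to all trees by the product rule.
    It carries the outer x-derivative of the Johnson equation past the y-derivatives. *)
Lemma dX_dY u y t e : deval u y t (dX (dY e)) = deval u y t (dY (dX e)).
Proof.
elim: e => //= [i j|e1 h1 e2 h2|e1 h1 e2 h2].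
- ring.
- by rewrite h1 h2.
- rewrite h1 h2; ring.
Qed.

(* The Johnson equation for v = - 2 w_x, integrated once in x and multiplied by - t^2 / 2. *)
Lemma potential_equation u y t : q ^+ 2 = - 16^-1 ->
  let w := Umon 0 0 in let ev e := deval u y t e in
  t ^+ 2 * (ev (dT (dX w)) + 4^-1 * ev (dX (dX (dX (dX w)))) - 3 * ev (dX w) * ev (dX (dX w)))
  + t / 2 * ev (dX w) = 12 * ev (dY (dY w)).
Proof.
move=> q2 w ev.
(* The derivation along n = 2 alone, without the coefficients in y and t. For free [q] the two sides
   differ by a multiple of [d2 (d2 w)] with the factor [q ^ 2 + 1/16]. *)
pose d2 := derivation sylv2 (Const 0) (Const 0).
suff : t ^+ 2 * (ev (dT (dX w)) + 4^-1 * ev (dX (dX (dX (dX w)))) - 3 * ev (dX w) * ev (dX (dX w)))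
  + t / 2 * ev (dX w) - 12 * ev (dY (dY w)) = - 12 * (q ^+ 2 + 16^-1) * t ^+ 2 * ev (d2 (d2 w)).
  by rewrite q2 addNr mulr0 !mul0r => /eqP; rewrite subr_eq0 => /eqP.
by rewrite /ev /d2 /=; field.
Qed.

End DifferentialPolynomials.

(** * Partial derivatives along coordinate lines *)

Section RealCurves.
Context {R : realType}.

Lemma quadratic_is_derive (f : R -> R) (x d C r : R) : 0 < r ->
  (forall y, `|y - x| < r -> `|f y - f x - d * (y - x)| <= C * `|y - x| ^+ 2) ->
  is_derive x 1 f d.
Proof.
move=> r0 h; pose F y := f y - d * y.
have dF : is_diff x F (fun=> 0).
  apply: (@quadratic_is_diff0 _ _ _ _ C r r0) => y yr; have := h y yr.
  by congr (`|_| <= _); rewrite /F; ring.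
have d1 : is_derive x 1 F 0.
  have dd : differentiable F x by exact: ex_diff.
  apply: DeriveDef; first exact/derivable1_diffP.
  by rewrite deriveE// diff_val.
have -> : f = F + (fun y => d * y) by apply/funext => y; rewrite !fctE subrK.
have d2 : is_derive x 1 (fun y => d * y) d.
  by apply: is_derive_eq; rewrite /GRing.scale /= mulr1.
by have := is_deriveD d1 d2; rewrite add0r.
Qed.

Implicit Types (X : R * R * R) (f : R * R * R -> R[i]).

Lemma cdiff_is_derive_x f x y t d1 d2 d3 : cdiff f (x, y, t) d1 d2 d3 ->
  is_derive x 1 (fun x' => cRe (f (x', y, t))) (cRe d1) /\
  is_derive x 1 (fun x' => cIm (f (x', y, t))) (cIm d1).
Proof.
move=> [C [r [C0 r0 h]]].
have nE z : `|((z, y, t) : R * R * R) - (x, y, t)| = `|z - x|.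
  rewrite !prod_normE /= !subrr !normr0.
  by rewrite (max_l (normr_ge0 _)) max_l.
have h' z : `|z - x| < r ->
    normc (f (z, y, t) - f (x, y, t) - d1 * (z - x)%:C%C) <= C * `|z - x| ^+ 2.
  move=> zr; have := h (z, y, t); rewrite nE => /(_ zr).
  by rewrite /= !subrr !rmorph0 !mulr0 !addr0.
split; apply: (quadratic_is_derive r0) => z zr; apply: le_trans (h' z zr).
  rewrite (le_trans _ (Re_le_normc _))// le_eqVlt; apply/orP; left; apply/eqP; congr (`|_|).
  by rewrite !ReD !ReN ReMr.
rewrite (le_trans _ (Im_le_normc _))// le_eqVlt; apply/orP; left; apply/eqP; congr (`|_|).
by rewrite !ImD !ImN ImM mulr0 add0r.
Qed.

Lemma cdiff_is_derive_y f x y t d1 d2 d3 : cdiff f (x, y, t) d1 d2 d3 ->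
  is_derive y 1 (fun y' => cRe (f (x, y', t))) (cRe d2).
Proof.
move=> [C [r [C0 r0 h]]].
have nE z : `|((x, z, t) : R * R * R) - (x, y, t)| = `|z - y|.
  rewrite !prod_normE /= !subrr !normr0.
  by rewrite (max_r (normr_ge0 _)) max_l.
apply: (quadratic_is_derive r0) => z zr.
have := h (x, z, t); rewrite nE => /(_ zr); apply: le_trans.
rewrite /= !subrr !rmorph0 !mulr0 !addr0 !add0r.
rewrite (le_trans _ (Re_le_normc _))// le_eqVlt; apply/orP; left; apply/eqP; congr (`|_|).
by rewrite !ReD !ReN ReMr.
Qed.

Lemma cdiff_is_derive_t f x y t d1 d2 d3 : cdiff f (x, y, t) d1 d2 d3 ->
  is_derive t 1 (fun t' => cRe (f (x, y, t'))) (cRe d3).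
Proof.
move=> [C [r [C0 r0 h]]].
have nE z : `|((x, y, z) : R * R * R) - (x, y, t)| = `|z - t|.
  rewrite !prod_normE /= !subrr !normr0 maxxx.
  by rewrite (max_r (normr_ge0 _)).
apply: (quadratic_is_derive r0) => z zr.
have := h (x, y, z); rewrite nE => /(_ zr); apply: le_trans.
rewrite /= !subrr !rmorph0 !mulr0 !add0r.
rewrite (le_trans _ (Re_le_normc _))// le_eqVlt; apply/orP; left; apply/eqP; congr (`|_|).
by rewrite !ReD !ReN ReMr.
Qed.

End RealCurves.

(** * From the moments to the Johnson equation *)

Section MomentFlow.
Context {R : realType}.
Variable u : R * R * R -> nat -> nat -> R[i].
Hypothesis u_cdiff : forall i j X, 0 < X.2 ->
  cdiff (fun Y => u Y i j) X
    (sylv (u X) 1 i j)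
    (X.2%:C%C * (quarter_i * sylv (u X) 2 i j) + (X.1.2 * X.2 / 24)%:C%C * sylv (u X) 1 i j)
    (- sylv (u X) 3 i j + X.1.2%:C%C * (quarter_i * sylv (u X) 2 i j)
       + (X.1.2 ^+ 2 / 48)%:C%C * sylv (u X) 1 i j).
Hypothesis u00_real : forall X, 0 < X.2 -> cIm (u X 0 0) = 0.

Local Notation poly := (dpoly R[i]).
Local Notation q := (quarter_i : R[i]).

Definition ev (e : poly) (X : R * R * R) : R[i] := deval (u X) (X.1.2)%:C%C (X.2)%:C%C e.

Lemma sylv1E (X : R * R * R) i j : sylv (u X) 1 i j = ev (sylv1 _ i j) X.
Proof.
rewrite /sylv big_ord_recr big_ord0 /= add0r expr0 expr1 mul1r !add1n subnn /ev /=.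
by rewrite mulN1r opprK.
Qed.

Lemma sylv2E (X : R * R * R) i j : sylv (u X) 2 i j = ev (sylv2 _ i j) X.
Proof.
rewrite /sylv !big_ord_recr big_ord0 /= add0r expr0 expr1 !add2n subnn subn0 /ev /=.
move: (u X) => v; ring.
Qed.

Lemma sylv3E (X : R * R * R) i j : sylv (u X) 3 i j = ev (sylv3 _ i j) X.
Proof.
rewrite /sylv !big_ord_recr big_ord0 /= add0r expr0 expr1 !addSn !add0n subnn subn0 /ev /=.
rewrite (_ : (2 - 1)%N = 1%N)//; move: (u X) => v; ring.
Qed.

Lemma ev_cdiff e (X : R * R * R) : 0 < X.2 ->
  cdiff (ev e) X (ev (dX e) X) (ev (dY q e) X) (ev (dT q e) X).
Proof.
move=> t0; elim: e => [i j|||c|e1 h1 e2 h2|e1 h1 e2 h2].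
- have := u_cdiff i j t0; rewrite sylv1E sylv2E sylv3E.
  congr (cdiff _ X _ _ _); rewrite /ev /=.
    by rewrite !(rmorphM, fmorphV, rmorph_nat); move: (u X) => v; ring.
  by rewrite !(rmorphM, fmorphV, rmorph_nat, rmorphXn); move: (u X) => v; ring.
- exact: cdiff_y.
- exact: cdiff_t.
- exact: cdiff_cst.
- exact: cdiffD.
- by have := cdiffM h1 h2.
Qed.

Lemma near_snd_gt0 (X : R * R * R) : 0 < X.2 -> \forall Y \near X, 0 < Y.2.
Proof.
move=> t0; apply/nbhs_ballP; exists X.2 => //= Y.
rewrite -ball_normE /= => /(le_lt_trans (norm3_3 _)) /=.
by rewrite ltr_norml => /andP[_]; rewrite ltrBlDr ltrDl.
Qed.

(** Derivatives are taken of real parts; [rev_realE] recovers the complex value where the imaginary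
    part vanishes. *)
Definition rev (e : poly) (X : R * R * R) : R := cRe (ev e X).

Lemma rev_differentiable e (X : R * R * R) : 0 < X.2 -> differentiable (rev e) X.
Proof. by move=> t0; have [] := cdiff_Re (ev_cdiff e t0). Qed.

Lemma rev_derive e (X H : R * R * R) : 0 < X.2 ->
  'D_H (rev e) X = cRe (lin3 (ev (dX e) X) (ev (dY q e) X) (ev (dT q e) X) H).
Proof. by move=> t0; have [_] := cdiff_Re (ev_cdiff e t0). Qed.

(** A directional derivative of an evaluated tree is again an evaluated tree, so differentiability
    at first order already yields all orders. *)
Lemma iterated_derive_rev (ws : seq (R * R * R)) e : exists e', forall X, 0 < X.2 ->
  foldr (fun w h => fun z => 'D_w h z) (rev e) ws X = rev e' X.
Proof.
elim: ws => [|H ws [e' ih]]; first by exists e.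
exists (Sum (Sum (Prod (dX e') (Const (H.1.1)%:C%C)) (Prod (dY q e') (Const (H.1.2)%:C%C)))
  (Prod (dT q e') (Const (H.2)%:C%C))) => X t0.
rewrite [LHS](_ : _ = 'D_H (rev e') X); last first.
  apply: near_eq_derive; apply: filterS (near_snd_gt0 t0) => Y; exact: ih.
by rewrite rev_derive.
Qed.

Lemma rev_smooth e : smooth_on [set X : R * R * R | 0 < X.2] (rev e).
Proof.
move=> ws X t0; have [e' he'] := iterated_derive_rev ws e.
apply: near_eq_differentiable (rev_differentiable e' t0).
by apply: filterS (near_snd_gt0 t0) => Y; exact: he'.
Qed.

Lemma derive1_rev_x c e (x y t : R) : 0 < t ->
  derive1 (fun x' => c * rev e (x', y, t)) x = c * rev (dX e) (x, y, t).
Proof.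
move=> t0; have [h _] := cdiff_is_derive_x (@ev_cdiff e (x, y, t) t0).
rewrite derive1E; have hz := is_deriveZ c h; exact: (@derive_val _ _ _ _ _ _ _ hz).
Qed.

Lemma derive1_rev_y c e (x y t : R) : 0 < t ->
  derive1 (fun y' => c * rev e (x, y', t)) y = c * rev (dY q e) (x, y, t).
Proof.
move=> t0; have h := cdiff_is_derive_y (@ev_cdiff e (x, y, t) t0).
rewrite derive1E; have hz := is_deriveZ c h; exact: (@derive_val _ _ _ _ _ _ _ hz).
Qed.

Lemma derive1_rev_t c e (x y t : R) : 0 < t ->
  derive1 (fun t' => c * rev e (x, y, t')) t = c * rev (dT q e) (x, y, t).
Proof.
move=> t0; have h := cdiff_is_derive_t (@ev_cdiff e (x, y, t) t0).
rewrite derive1E; have hz := is_deriveZ c h; exact: (@derive_val _ _ _ _ _ _ _ hz).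
Qed.

Definition real_valued (e : poly) := forall X, 0 < X.2 -> cIm (ev e X) = 0.

Lemma real_derivations e : real_valued e ->
  [/\ real_valued (dX e), real_valued (dY q e) & real_valued (dT q e)].
Proof.
(* The real part of e' = - i e is the imaginary part of e, which vanishes. *)
move=> re; pose e' := Prod (Const (- 'i%C)) e.
have ImE z : cRe (- 'i%C * z) = cIm z :> R by rewrite !ReImE /=; ring.
have h (X : R * R * R) H : 0 < X.2 ->
    cRe (lin3 (ev (dX e') X) (ev (dY q e') X) (ev (dT q e') X) H) = 0.
  move=> t0; rewrite -rev_derive// (@near_eq_derive _ _ _ _ (fun=> 0)).
    by rewrite derive_cst.
  by apply: filterS (near_snd_gt0 t0) => Y Y0; rewrite /rev /ev /= ImE; exact: re.
have E (D : poly -> poly) X : ev (D e') X = 0 * ev e X + - 'i%C * ev (D e) X ->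
    cIm (ev (D e) X) = cRe (ev (D e') X).
  by move=> ->; rewrite mul0r add0r ImE.
split=> X t0.
- by rewrite (E (@dX _) X erefl); have := h X (1, 0, 0) t0; rewrite lin3_100.
- by rewrite (E (dY q) X erefl); have := h X (0, 1, 0) t0; rewrite lin3_010.
- by rewrite (E (dT q) X erefl); have := h X (0, 0, 1) t0; rewrite lin3_001.
Qed.

Lemma rev_realE e X : real_valued e -> 0 < X.2 -> ev e X = (rev e X)%:C%C.
Proof. by move=> re t0; apply: complex_ext => //=; exact: re. Qed.

Let w : poly := Umon _ 0 0.

Definition moment_v (x y t : R) : R := - 2 * rev (dX w) (x, y, t).

Let vpoly : poly := Prod (Const (- 2)%:C%C) (dX w).

Lemma moment_vE x y t : moment_v x y t = rev vpoly (x, y, t).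
Proof.
rewrite /moment_v /rev -[ev vpoly _]/((- 2)%:C%C * ev (dX w) (x, y, t)).
by rewrite [in RHS]mulrC ReMr mulrC.
Qed.

Lemma moment_v_smooth :
  smooth_on [set X : R * R * R | 0 < X.2] (fun X => moment_v X.1.1 X.1.2 X.2).
Proof.
rewrite (_ : (fun X => _) = rev vpoly); first exact: rev_smooth.
by apply/funext => -[[x y] t]; exact: moment_vE.
Qed.

Let rw : real_valued w. Proof. by move=> X; exact: u00_real. Qed.

Lemma potential_real (x y t : R) : 0 < t ->
  let X := (x, y, t) in
  rev (dT q (dX w)) X + 4^-1 * rev (dX (dX (dX (dX w)))) X
    - 3 * rev (dX w) X * rev (dX (dX w)) X + rev (dX w) X / (2 * t)
  = 12 / t ^+ 2 * rev (dY q (dY q w)) X.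
Proof.
move=> t0 X; have t0' : 0 < X.2 by [].
have [rx ry _] := real_derivations rw.
have [rxx _ rxt] := real_derivations rx; have [_ ryy _] := real_derivations ry.
have [rx3 _ _] := real_derivations rxx; have [rx4 _ _] := real_derivations rx3.
have q2 : q ^+ 2 = - 16^-1.
  by rewrite /quarter_i; apply: complex_ext; rewrite expr2 !ReImE /=; field.
have : t%:C%C ^+ 2 * (ev (dT q (dX w)) X + 4^-1 * ev (dX (dX (dX (dX w)))) X
    - 3 * ev (dX w) X * ev (dX (dX w)) X) + t%:C%C / 2 * ev (dX w) X = 12 * ev (dY q (dY q w)) X.
  exact: (potential_equation (u X) y%:C%C t%:C%C q2).
rewrite (rev_realE rxt t0') (rev_realE rx4 t0') (rev_realE rx t0') (rev_realE rxx t0') (rev_realE ryy t0').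
move: (rev (dT q _) X) (rev (dX (dX (dX (dX w)))) X) (rev (dX w) X) (rev (dX (dX w)) X) (rev (dY q _) X) => a b c d e.
move=> /(congr1 (@complex.Re R)).
have -> : cRe (t%:C%C ^+ 2 * (a%:C%C + 4^-1 * b%:C%C - 3 * c%:C%C * d%:C%C) + t%:C%C / 2 * c%:C%C) =
   t ^+ 2 * (a + 4^-1 * b - 3 * c * d) + t / 2 * c.
  have n4 : 4^-1 = (4^-1 : R)%:C%C by rewrite fmorphV rmorph_nat.
  have n3 : 3 = (3 : R)%:C%C by rewrite rmorph_nat.
  have n2 : 2^-1 = (2^-1 : R)%:C%C by rewrite fmorphV rmorph_nat.
  by rewrite n4 n3 n2 [in LHS]expr2 !ReImE /=; ring.
have -> : cRe (12 * e%:C%C) = 12 * e.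
  have n12 : 12 = (12 : R)%:C%C by rewrite rmorph_nat.
  by rewrite n12 ReMr.
move=> h; have tn : t != 0 by rewrite gt_eqF.
have -> : a + 4^-1 * b - 3 * c * d + c / (2 * t) =
   (t ^+ 2 * (a + 4^-1 * b - 3 * c * d) + t / 2 * c) / t ^+ 2 by field.
by rewrite h; field.
Qed.

(** By [potential_real] the expression under the outer x-derivative is [- 2 * (12 / t ^ 2)] times
    the second y-derivative of u_00; it remains to commute the derivatives. *)
Lemma moment_v_johnson (x y t : R) : 0 < t -> johnson_equation moment_v x y t.
Proof.
move=> t0; rewrite /johnson_equation /moment_v.
have Dx c e z : derive1 (fun x' => c * rev e (x', y, t)) z = c * rev (dX e) (z, y, t).
  exact: derive1_rev_x.
have Dxf c e : derive1 (fun x' => c * rev e (x', y, t)) = fun z => c * rev (dX e) (z, y, t).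
  by apply/funext => z; exact: Dx.
have Dyf c e : derive1 (fun y' => c * rev e (x, y', t)) = fun z => c * rev (dY q e) (x, z, t).
  by apply/funext => z; exact: derive1_rev_y.
rewrite /derive1n /= !Dxf !Dyf.
rewrite (_ : (fun x' => _) = fun x' => (- 2 * (12 / t ^+ 2)) * rev (dY q (dY q w)) (x', y, t)).
  have E1 z : rev (dX (dY q w)) (x, z, t) = rev (dY q (dX w)) (x, z, t).
    by rewrite /rev /ev dX_dY.
  have E2 : rev (dX (dY q (dY q w))) (x, y, t) = rev (dY q (dY q (dX w))) (x, y, t).
    have -> : rev (dX (dY q (dY q w))) (x, y, t) = rev (dY q (dX (dY q w))) (x, y, t).
      by rewrite /rev /ev dX_dY.
    (* [dX_dY] equates values and not trees, so under the outer [dY q] it is applied through an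
       actual y-derivative. *)
    rewrite -[LHS]mul1r -[RHS]mul1r -!derive1_rev_y//.
    by congr (derive1 _ y); apply/funext => z; rewrite E1.
  by rewrite Dx E2; ring.
apply/funext => z; rewrite derive1_rev_t//.
have /= := potential_real z y t0.
move=> pe; rewrite -[RHS]mulrA -pe; field.
by rewrite gt_eqF.
Qed.

End MomentFlow.

(** * The domain Omega *)

Section PlaneMeasurability.
Context {R : realType}.
Local Notation plane := (measurableTypeR R * measurableTypeR R)%type.

(** An open set is a countable union of boxes with rational centre and radius, which are measurable
    rectangles of the product sigma-algebra. *)
Lemma plane_open_measurable (O : set (R * R)) : open O -> measurable (O : set plane).
Proof.
move=> oO.
pose B (c : rat * rat * rat) : set plane :=
  [set w | `|w.1 - ratr c.1.1| < ratr c.2 /\ `|w.2 - ratr c.1.2| < ratr c.2].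
have mB c : measurable (B c).
  have -> : B c = ball (ratr c.1.1 : R) (ratr c.2) `*` ball (ratr c.1.2 : R) (ratr c.2).
    by apply/seteqP; split => -[p q] /= [h1 h2]; split; move: h1 h2; rewrite -?ball_normE /= 1?distrC// => ? ?; rewrite distrC.
  by apply: measurableX; exact: measurable_ball.
have -> : O = \bigcup_(c in [set c | B c `<=` O]) B c.
  apply/seteqP; split => [[p q] Opq|w [c /= cO]]; last exact: cO.
  have [r /= r0 rO] := (nbhs_ballP _ _).1 (oO _ Opq).
  have r4 : 0 < r / 4 by rewrite divr_gt0.
  (* Rational centres are taken within [r / 4]; a radius between [r / 4] and [r / 2] keeps the point
     in the box and the box in the ball of radius [r]. *)
  have [rho rh] : exists rho : rat, r / 4 < ratr rho < r / 2.
    have /rat_in_itvoo[rho] : r / 4 < r / 2 by lra.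
    by rewrite in_itv /= => h; exists rho.
  have near_rat (z : R) : exists c : rat, `|z - ratr c| < r / 4.
    have /rat_in_itvoo[c] : z - r / 4 < z + r / 4 by lra.
    rewrite in_itv /= => h; exists c; rewrite ltr_norml; lra.
  have [a ha] := near_rat p; have [b hb] := near_rat q.
  exists (a, b, rho).
    move=> [p' q'] /= [h1 h2]; apply: rO; rewrite -ball_normE /= prod_normE /=.
    rewrite gt_max; apply/andP; split.
      by move: ha h1; rewrite !ltr_norml /=; lra.
    by move: hb h2; rewrite !ltr_norml /=; lra.
  by split => /=; lra.
rewrite bigcup_mkcond; apply: countable_bigcupT_measurable => // c.
by case: ifP.
Qed.

Lemma plane_continuous_measurable (U : set (R * R)) (f : R * R -> R) :
  open U -> {in U, continuous f} -> measurable_fun (U : set plane) (f : plane -> R).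
Proof.
move=> oU cf.
apply: (measurability _ (RGenOpens.measurableE R)) => //.
move=> _ [_ [a [b ->] <-]]; apply: plane_open_measurable.
rewrite openE => w [Uw fw]; apply: filterI; first exact: oU.
apply: (cf w); first by rewrite inE.
by apply: open_nbhs_nbhs; split => //; exact: interval_open.
Qed.

End PlaneMeasurability.

(** * Omega described by the hyperbolas *)

Section Envelope.
Context {R : realType}.
Variables (C h : R -> R) (delta eps : R).
Hypothesis hA : conditionA C delta eps.
Hypothesis hB : conditionB C h.

Lemma eps_gt0 : 0 < eps. Proof. by case: hA => _ _ []. Qed.

(** The function [C s - phase p (h p) s] of [s] has second derivative [C'' + 1/24 > 0], and the
    envelope condition provides a point where it and its derivative vanish. By convexity this is its
    minimum. *)
Lemma phase_le_envelope p s : phase p (h p) s <= C s.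
Proof.
have [_ [C1 C2 _] _ _ Cc] := hA.
have [_ [s0 [e0 e1]]] := (hB p (h p)).2 erefl.
pose X s := C s - phase p (h p) s; pose X1 s := derive1 C s - (p / 2 - s / 24).
have dph (z : R) : is_derive z 1 (phase p (h p)) (p / 2 - z / 24).
  rewrite /phase; apply: is_derive_eq.
  by rewrite /GRing.scale /=; field.
have dX (z : R) : is_derive z 1 X (X1 z).
  have dC : is_derive z 1 C (derive1 C z).
    by rewrite derive1E; apply: derivableP; exact: C1.
  exact: is_deriveB.
have dX1 (z : R) : is_derive z 1 X1 (derive1n 2 C z + 24^-1).
  have dC : is_derive z 1 (derive1 C) (derive1n 2 C z).
    by rewrite /derive1n /= derive1E; apply: derivableP; exact: C2.
  rewrite /X1; apply: is_derive_eq.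
  by rewrite /GRing.scale /=; field.
have X1s0 : X1 s0 = 0 by rewrite /X1 -e1 derive_phase subrr.
have Xs0 : X s0 = 0 by rewrite /X e0 subrr.
have cX : continuous X.
  by move=> z; apply: differentiable_continuous; apply/derivable1_diffP; apply: ex_derive.
have cX1 : continuous X1.
  by move=> z; apply: differentiable_continuous; apply/derivable1_diffP; apply: ex_derive.
have X1_mono a b : a < b -> X1 a <= X1 b.
  move=> ab; have [c _ E] := MVT ab (fun z _ => dX1 z) (continuous_subspaceT cX1).
  rewrite -subr_ge0 E mulr_ge0 ?subr_ge0 ?(ltW ab)//.
  by have := Cc c; lra.
suff : 0 <= X s by rewrite /X subr_ge0.
have [ss0|s0s|->] := ltgtP s s0; last by rewrite Xs0.
- have [c cI E] := MVT ss0 (fun z _ => dX z) (continuous_subspaceT cX).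
  move: cI; rewrite in_itv /= => /andP[c1 c2].
  have h1 := X1_mono _ _ c2; rewrite X1s0 in h1; rewrite Xs0 in E.
  have : X1 c * (s0 - s) <= 0 by rewrite mulr_le0_ge0// subr_ge0 ltW.
  by rewrite -E; lra.
- have [c cI E] := MVT s0s (fun z _ => dX z) (continuous_subspaceT cX).
  move: cI; rewrite in_itv /= => /andP[c1 c2].
  have h1 := X1_mono _ _ c1; rewrite X1s0 in h1; rewrite Xs0 in E.
  have : 0 <= X1 c * (s - s0) by rewrite mulr_ge0// subr_ge0 ltW.
  by rewrite -E; lra.
Qed.

(** The phase increases with [q > 0]; the contact parameter [s0] gives the converse inclusion. This
    description replaces [h] by the regular function [C], for measurability and for the domination
    of the exponent. *)
Lemma OmegaE : Omega eps h =
  [set w | eps <= w.2 /\ forall s, phase w.1 w.2 s <= C s].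
Proof.
apply/seteqP; split => -[p q] /=.
  move=> /andP[e1 e2]; split => // s; apply: le_trans (phase_le_envelope p s).
  rewrite /phase !lerD2r lerXn2r// nnegrE (le_trans (ltW eps_gt0))//.
  exact: le_trans e1 e2.
move=> [e1 hs]; apply/andP; split => //.
have [hp [s0 [e0 _]]] := (hB p (h p)).2 erefl.
have := hs s0; rewrite -e0 /phase !lerD2r ler_pXn2r// nnegrE ?(ltW hp)//.
by rewrite (le_trans (ltW eps_gt0)).
Qed.

Lemma measurable_phase s : measurable_fun setT
  (fun w : measurableTypeR R * measurableTypeR R => phase w.1 w.2 s).
Proof.
apply: plane_continuous_measurable; first exact: openT.
move=> w _; rewrite /phase.
have c1 : (fun Y : R * R => Y.1) Y @[Y --> w] --> w.1 by exact: cvg_fst.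
have c2 : (fun Y : R * R => Y.2) Y @[Y --> w] --> w.2 by exact: cvg_snd.
apply: cvgB; last exact: cvg_cst.
apply: cvgD.
  apply: cvgB; first by apply: cvgM.
  by apply: cvgM; [exact: cvg_cst | apply: cvgM].
by apply: cvgM; [apply: cvgM => //; exact: cvg_cst | exact: cvg_cst].
Qed.

Lemma measurable_Omega : measurable (Omega eps h : set (measurableTypeR R * measurableTypeR R)).
Proof.
have [_ [C1 _ _] _ _ _] := hA.
have cC s : {for s, continuous C}.
  by apply: differentiable_continuous; exact/derivable1_diffP.
rewrite OmegaE.
(* By continuity in [s] the rational parameters suffice; codes of no rational contribute [setT]. *)
pose H (n : nat) : set (measurableTypeR R * measurableTypeR R) :=
  if unpickle n is Some r then [set w | phase w.1 w.2 (ratr r) <= C (ratr r)] else setT.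
have -> : [set w : R * R | eps <= w.2 /\ forall s, phase w.1 w.2 s <= C s] =
    [set w | eps <= w.2] `&` \bigcap_n H n.
  apply/seteqP; split => w /= [e hw]; split => //.
    by move=> n _; rewrite /H; case: (unpickle n) => [r|//]; exact: hw.
  move=> s; rewrite leNgt; apply/negP => lt.
  have op : \forall z \near s, C z < phase w.1 w.2 z.
    have cph : {for s, continuous (phase w.1 w.2)}.
      by apply: differentiable_continuous; apply/derivable1_diffP; rewrite /phase; apply: ex_derive.
    have cd : (phase w.1 w.2 z - C z) @[z --> s] --> phase w.1 w.2 s - C s by apply: cvgB; [exact: cph|exact: cC].
    have : 0 < phase w.1 w.2 s - C s by rewrite subr_gt0.
    move=> /(cvgr_gt _ cd); apply: filterS => z; by rewrite subr_gt0.
  have [r /= r0 hr] := (nbhs_ballP _ _).1 op.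
  have /rat_in_itvoo[c] : s - r < s + r by lra.
  rewrite in_itv /= => hc.
  have := hw (pickle c) I; rewrite /H pickleK /= leNgt => /negP; apply; apply: hr.
  by rewrite -ball_normE /= ltr_norml; lra.
apply: measurableI.
  rewrite (_ : [set w | _] = setT `&` (snd @^-1` `[eps, +oo[)).
    exact: (measurable_snd measurableT).
  by apply/seteqP; split => w /=; rewrite in_itv /= andbT; tauto.
apply: bigcapT_measurable => n; rewrite /H; case: (unpickle n) => [r|//].
rewrite (_ : [set w | _] = setT `&` ((fun w : measurableTypeR R * measurableTypeR R => phase w.1 w.2 (ratr r)) @^-1` `]-oo, C (ratr r)])).
  exact: (measurable_phase _ measurableT).
by apply/seteqP; split => w /=; rewrite in_itv /=; tauto.
Qed.

End Envelope.

(* plane_measure with the sigma-finiteness that the Fubini theorems need. *)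
Definition lebesgue2 (R : realType) : set (measurableTypeR R * measurableTypeR R)%type -> \bar R :=
  plane_measure R.

HB.instance Definition _ (R : realType) := Measure.copy (@lebesgue2 R) (plane_measure R).

Lemma lebesgue2_sigma_finite (R : realType) : sigma_finite setT (@lebesgue2 R).
Proof.
pose B n : set (measurableTypeR R) := ball (0 : R) n.+1%:R.
have mB n : measurable (B n) by exact: measurable_ball.
exists (fun n => B n `*` B n).
  apply/esym; rewrite -subTset => -[p q] _.
  have [n hn] : exists n : nat, `|p| + `|q| < n.+1%:R.
    exists (Num.bound (`|p| + `|q|)).
    by rewrite (lt_trans (archi_boundP _))// ?addr_ge0// ltr_nat.
  exists n => //; split; rewrite /B /= -ball_normE /= sub0r normrN;
    apply: le_lt_trans hn; by rewrite ?lerDl ?lerDr.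
move=> n; split; first exact: measurableX.
have fB : (@lebesgue_measure R (B n) < +oo)%E by rewrite /B lebesgue_measure_ball// ltry.
rewrite /lebesgue2 /plane_measure /= product_measure1E// lte_mul_pinfty//.
by rewrite ge0_fin_numE.
Qed.

HB.instance Definition _ (R : realType) :=
  Measure_isSigmaFinite.Build _ _ _ (@lebesgue2 R) (lebesgue2_sigma_finite R).

(** * The data of Conditions A, B and C *)

Section JohnsonData.
Context {R : realType}.
Variables (C h g : R -> R) (gt : R * R -> R) (delta eps A : R).
Hypothesis hA : conditionA C delta eps.
Hypothesis hB : conditionB C h.
Hypothesis hC : conditionC C h eps g A gt.

Local Notation plane := (measurableTypeR R * measurableTypeR R)%type.

Local Notation D := (Omega eps h : set plane).

Definition Pcoord (a : plane) : R := a.1.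

(* Equal to the second coordinate on Omega, and bounded below everywhere. *)
Definition Qcoord (a : plane) : R := Num.max a.2 eps.

(** The indicator discards [gt] off Omega, where nothing is known of its sign or measurability, and
    lets all integrals run over the whole plane. *)
Definition density (a : plane) : R := \1_D a * gt a.

Let e0 : 0 < eps := eps_gt0 hA.
Let mD : measurable D := measurable_Omega hA hB.

Lemma measurable_Pcoord : measurable_fun setT Pcoord. Proof. exact: measurable_fst. Qed.

Lemma measurable_Qcoord : measurable_fun setT Qcoord.
Proof. by apply: measurable_maxr => //; exact: measurable_snd. Qed.

Lemma Qcoord_ge a : eps <= Qcoord a. Proof. by rewrite le_max lexx orbT. Qed.

Lemma Qcoord_Omega a : D a -> Qcoord a = a.2.
Proof. by move=> /andP[h1 _]; rewrite /Qcoord max_l. Qed.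

Lemma measurable_gt : measurable_fun D (gt : plane -> R).
Proof.
have [_ _ [V [oV DV sV]] _ _] := hC.
apply: (measurable_funS (plane_open_measurable oV) DV).
apply: plane_continuous_measurable => // w; rewrite inE => Vw.
by apply: differentiable_continuous; exact: (sV [::] w Vw).
Qed.

Lemma measurable_density : measurable_fun setT density.
Proof. exact: measurable_fun_indic_mul measurable_gt. Qed.

Lemma density_Omega a : D a -> density a = gt a.
Proof. by move=> Da; rewrite /density indicE mem_set// mul1r. Qed.

Lemma density_notin a : ~ D a -> density a = 0.
Proof. by move=> Da; rewrite /density indicE memNset// mul0r. Qed.

Lemma density_ge0 a : 0 <= density a.
Proof.
have [_ gt0 _ _ _] := hC; have [Da|Da] := pselect (D a).
  by rewrite density_Omega// ltW// gt0.
by rewrite density_notin.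
Qed.

Local Notation size2 := (size1 Pcoord Qcoord).

Lemma density_moments c : (@lebesgue2 R).-integrable setT
  (EFin \o (fun a => density a * expR (c * size2 a))).
Proof.
have [_ gt0 _ _ mom] := hC.
(* Condition C speaks of positive exponents, whereas [c] is any real number. *)
pose b := `|c| + 1; have b0 : 0 < b by rewrite ltr_wpDl.
have i1 : (@lebesgue2 R).-integrable D (EFin \o (fun a => expR (b * (a.2 + `|a.1|)) * gt a)).
  apply/integrableP; split.
    apply/measurable_EFinP; apply: measurable_funM; last exact: measurable_gt.
    apply: measurable_funTS; apply: measurableT_comp => //; apply: measurable_funM => //.
    apply: measurable_funD; first exact: measurable_snd.
    by apply: measurableT_comp => //; exact: measurable_fst.
  apply: le_lt_trans (mom b b0); rewrite le_eqVlt; apply/orP; left; apply/eqP.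
  apply: eq_integral => a; rewrite inE => Da /=.
  by rewrite ger0_norm// mulr_ge0 ?expR_ge0// ltW// gt0.
apply: le_integrable (integrable_indic_mul mD i1) => //.
  apply/measurable_EFinP; apply: measurable_funM; first exact: measurable_density.
  apply: measurableT_comp => //; apply: measurable_funM => //.
  exact: measurable_G measurable_Pcoord measurable_Qcoord.
move=> a _ /=; rewrite lee_fin; have [Da|Da] := pselect (D a); last first.
  by rewrite density_notin// mul0r normr0.
rewrite density_Omega// indicE mem_set// mul1r /size1 Qcoord_Omega//.
have g0 := ltW (gt0 _ Da).
rewrite normrM (ger0_norm g0) (ger0_norm (expR_ge0 _)) (le_trans _ (ler_norm _))//.
rewrite mulrC ler_wpM2r// ler_expR ler_wpM2r//.
  by have /andP[h1 _] := Da; rewrite addr_ge0// (le_trans (ltW e0)).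
by rewrite (le_trans (ler_norm _))// lerDl.
Qed.

(** On Omega the phase is at most [C y'], hence at most [C y + 1] near [y] by continuity, and the
    radius [Num.min r t] keeps [t'] between [0] and [2 * t]. *)
Lemma phase_dominated (y t : R) : 0 < t -> exists c r : R, 0 < r /\
  forall y' t' : R, `|y' - y| < r -> `|t' - t| < r -> forall a, density a != 0 ->
    2 * Qcoord a * phase (Pcoord a) (Qcoord a) y' * t' <= c * size2 a.
Proof.
move=> t0; have [C0 [C1 _ _] _ _ _] := hA.
have cC : {for y, continuous C}.
  by apply: differentiable_continuous; exact/derivable1_diffP.
have op : \forall z \near y, C z < C y + 1 by apply: (cvgr_lt _ cC); rewrite ltrDl.
have [r /= r0 hr] := (nbhs_ballP _ _).1 op.
exists (2 * (C y + 1) * (2 * t)), (Num.min r t); split; first by rewrite lt_min r0.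
move=> y' t'; rewrite !lt_min => /andP[yr _] /andP[_ tt] a da.
have Da : D a by apply: contrapT => Da; move: da; rewrite density_notin// eqxx.
have Cy : C y' < C y + 1 by apply: hr; rewrite -ball_normE /= distrC.
have Q0 : 0 <= Qcoord a by rewrite (le_trans (ltW e0))// Qcoord_ge.
have ph : phase (Pcoord a) (Qcoord a) y' <= C y + 1.
  rewrite Qcoord_Omega//; move: (Da); rewrite (OmegaE hA hB) => -[_ /(_ y') /le_trans]; apply.
  exact: ltW.
have t2 : t' <= 2 * t by move: tt; rewrite ltr_norml; lra.
have t'0 : 0 <= t' by move: tt; rewrite ltr_norml; lra.
have Cy0 : 0 <= C y + 1 by rewrite addr_ge0// ltW.
apply: (@le_trans _ _ (2 * Qcoord a * (C y + 1) * (2 * t))).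
  apply: (@le_trans _ _ (2 * Qcoord a * (C y + 1) * t')).
    by rewrite ler_wpM2r// ler_wpM2l// mulr_ge0.
  by rewrite ler_wpM2l// !mulr_ge0.
have -> : 2 * Qcoord a * (C y + 1) * (2 * t) = 2 * (C y + 1) * (2 * t) * Qcoord a by ring.
by rewrite ler_wpM2l ?lerDl// !mulr_ge0// ltW.
Qed.

Local Notation wX := (wt Pcoord Qcoord density).

Lemma wX_admissible (X : R * R * R) : 0 < X.2 -> admissible (@lebesgue2 R) Pcoord Qcoord (wX X).
Proof.
exact: (admissible_wt e0 measurable_Pcoord measurable_Qcoord Qcoord_ge measurable_density
  density_ge0 density_moments phase_dominated).
Qed.

(** The product of the two waves based at [x] lacks the factor e^(-2 q x), which is the x-term of
    [theta]; so the kernel is the same for every base point. *)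
Lemma marchenko_kernelE (x y t xi z : R) :
  marchenko_kernel eps h gt xi z y t = kern (@lebesgue2 R) Pcoord Qcoord (wX (x, y, t)) x xi z.
Proof.
rewrite /marchenko_kernel /kern /cwint [LHS]cintegral_indic_mul.
apply: eq_cintegral => -[p q] _.
have [Da|Da] := pselect (D (p, q)); last first.
  have -> : \1_D (p, q) = 0 :> R by rewrite indicE memNset.
  by rewrite /wt density_notin// !mul0r ?rmorph0 ?mul0r ?mulr0.
have -> : \1_D (p, q) = 1 :> R by rewrite indicE mem_set.
rewrite /wt density_Omega// rmorph1 mul1r [(gt (p, q) * expR _)%:C%C]rmorphM [RHS]mulrA [RHS]mulrAC.
congr (_ * _).
rewrite -[X in _ = _ * X]/((expR (theta Pcoord Qcoord (x, y, t) (p, q)))%:C%C).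
rewrite -expc_real /wave conjc_expc -!expcD; congr expc.
have Q1 : Qcoord (p, q) = q by exact: Qcoord_Omega.
rewrite /theta /alpha Q1 /Pcoord /=.
by apply: complex_ext; rewrite !ReImE /=; ring.
Qed.

Let u (X : R * R * R) := moment (@lebesgue2 R) Pcoord Qcoord (wX X).

Lemma u_cdiff i j (X : R * R * R) : 0 < X.2 ->
  cdiff (fun Y => u Y i j) X
    (sylv (u X) 1 i j)
    (X.2%:C%C * (quarter_i * sylv (u X) 2 i j) + (X.1.2 * X.2 / 24)%:C%C * sylv (u X) 1 i j)
    (- sylv (u X) 3 i j + X.1.2%:C%C * (quarter_i * sylv (u X) 2 i j)
       + (X.1.2 ^+ 2 / 48)%:C%C * sylv (u X) 1 i j).
Proof.
exact: (moment_cdiff e0 measurable_Pcoord measurable_Qcoord Qcoord_ge measurable_density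
  density_ge0 density_moments phase_dominated).
Qed.

Lemma u00_real (X : R * R * R) : 0 < X.2 -> cIm (u X 0 0) = 0.
Proof.
move=> t0.
exact: (moment00_real e0 measurable_Pcoord measurable_Qcoord Qcoord_ge (wX_admissible t0)).
Qed.

Definition johnson_v := moment_v u.

Let dX_U00 (X : R * R * R) : ev u (dX (Umon _ 0 0)) X = sylv (u X) 1 0 0.
Proof. exact: esym (sylv1E u X 0 0). Qed.

Lemma johnson_vE x y t : johnson_v x y t = - 2 * cRe (sylv (u (x, y, t)) 1 0 0).
Proof. by rewrite -dX_U00. Qed.

Lemma sylv1_real (X : R * R * R) : 0 < X.2 -> cIm (sylv (u X) 1 0 0) = 0.
Proof.
move=> t0; have [rx _ _] := real_derivations u_cdiff (e := Umon _ 0 0) u00_real.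
by rewrite -dX_U00; exact: (rx X t0).
Qed.

Lemma johnson_v_marchenko : marchenko_determines (marchenko_kernel eps h gt) johnson_v.
Proof.
exists (fun x z y t => sol (@lebesgue2 R) Pcoord Qcoord (wX (x, y, t)) x z) => x y t t0.
have hw : admissible (@lebesgue2 R) Pcoord Qcoord (wX (x, y, t)) by exact: wX_admissible.
have mP := measurable_Pcoord; have mQ := measurable_Qcoord.
have lhsE k z : marchenko_lhs (marchenko_kernel eps h gt) x y t k z =
    k z + kern (@lebesgue2 R) Pcoord Qcoord (wX (x, y, t)) x x z +
    cintegral lebesgue_measure `[x, +oo[ (fun xi => k xi * kern (@lebesgue2 R) Pcoord Qcoord (wX (x, y, t)) x xi z).
  refine (f_equal2 (fun a b => k z + a + b) (marchenko_kernelE x y t x z) _).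
  apply: eq_cintegral => xi _.
  exact: (f_equal (fun a => k xi * a) (marchenko_kernelE x y t xi z)).
(* On the diagonal the base point moves with [x'], but the wave equals 1 there, so the dependence on
   [x'] is that of the weight. *)
have diagE : (fun x' => sol (@lebesgue2 R) Pcoord Qcoord (wX (x', y, t)) x' x') =
    (fun x' => - u (x', y, t) 0 0).
  by apply/funext => x'; rewrite sol_diag.
have [dR dI] := cdiff_is_derive_x (@u_cdiff 0 0 (x, y, t) t0).
have eR : is_derive x 1 (fun x' => cRe (- u (x', y, t) 0 0)) (- cRe (sylv (u (x, y, t)) 1 0 0)).
  by under eq_fun do rewrite ReN; exact: is_deriveN.
have eI : is_derive x 1 (fun x' => cIm (- u (x', y, t) 0 0)) (- cIm (sylv (u (x, y, t)) 1 0 0)).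
  by under eq_fun do rewrite ImN; exact: is_deriveN.
split.
- apply: (sol_L2 e0 mP mQ Qcoord_ge).
  exact: hw.
- move=> z xz; rewrite lhsE; exact: (sol_marchenko e0 mP mQ Qcoord_ge hw xz).
- move=> k k2 hk; apply: (sol_unique e0 mP mQ Qcoord_ge hw k2).
  by apply: ae_lebesgue_imp hk => z hz xz; rewrite -lhsE; exact: hz.
- by rewrite diagE; split; apply: ex_derive.
- rewrite diagE /cderive !derive1E (@derive_val _ _ _ _ _ _ _ eR) (@derive_val _ _ _ _ _ _ _ eI).
  rewrite (@sylv1_real (x, y, t) t0) johnson_vE.
  move: (cRe (sylv _ _ _ _)) => b.
  by apply: complex_ext; rewrite !ReImE /=; ring.
Qed.

Lemma johnson_v_decay (y t : R) : 0 < t -> johnson_v x y t @[x --> +oo] --> 0.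
Proof.
move=> t0; have ha x : admissible (@lebesgue2 R) Pcoord Qcoord (wX (x, y, t)) by exact: wX_admissible.
have [K hK] := sylv1_decay e0 measurable_Pcoord measurable_Qcoord Qcoord_ge density_ge0 ha.
have vb x : 0 <= x -> `|johnson_v x y t| <= 2 * K * expR (- (2 * eps) * (x - 0)).
  move=> x0; rewrite johnson_vE normrM normrN [`|2|]ger0_norm//.
  by rewrite -mulrA ler_wpM2l// (le_trans (Re_le_normc _))// subr0 hK.
have lim0 : 2 * K * expR (- (2 * eps) * (x - 0)) @[x --> +oo] --> (0 : R).
  rewrite -[X in _ --> X](mulr0 (2 * K)); apply: cvgM; first exact: cvg_cst.
  by apply: expR_decay; rewrite mulr_gt0.
apply/cvgr0Pnorm_le => d d0.
move/cvgr0Pnorm_le : lim0 => /(_ _ d0) hd.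
near=> x.
have x0 : 0 <= x by near: x; exact: nbhs_pinfty_ge.
rewrite (le_trans (vb x x0))// (le_trans (ler_norm _))//.
by near: x.
Unshelve. all: by end_near. Qed.

End JohnsonData.

Theorem lemma2 (R : realType) (C h g : R -> R) (gt : R * R -> R)
    (delta eps A : R)
    (hA : conditionA C delta eps)
    (hB : conditionB C h)
    (hC : conditionC C h eps g A gt) :
  exists v : R -> R -> R -> R,
    [/\ marchenko_determines (marchenko_kernel eps h gt) v,
        smooth_on [set w : R * R * R | 0 < w.2] (fun w => v w.1.1 w.1.2 w.2),
        forall x y t : R, 0 < t -> johnson_equation v x y t,
        forall y t : R, 0 < t -> v x y t @[x --> +oo] --> 0
      & forall x y t : R, 0 < t -> exists M : R, `|v x y t| <= M].
Proof.
exists (johnson_v h gt eps); split.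
- exact: johnson_v_marchenko hA hB hC.
- exact: moment_v_smooth (u_cdiff hA hB hC).
- by move=> x y t t0; exact: moment_v_johnson (u_cdiff hA hB hC) (u00_real hA hB hC) _ _ _ t0.
- by move=> y t t0; exact: johnson_v_decay hA hB hC _ _ t0.
(* Boundedness at a fixed point is finiteness of the value, so the modulus itself is a bound. *)
- by move=> x y t _; exists `|johnson_v h gt eps x y t|.
Qed.
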